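(* Let $A:=H_{1,\eta}(G)$ be the symplectic reflection algebra of a symplectic reflection group $G$. Let $T_G$ (respectively $S_G$) be the number of conjugacy classes of $G$ consisting of elements without eigenvalue $1$ (respectively $-1$). If $A$ is a simple associative algebra, then the Lie superalgebra $[A^S,A^S]$ has at least $S_G$ linearly independent supersymmetric invariant non-degenerate bilinear forms, and the Lie algebra $[A^L,A^L]/([A^L,A^L]\cap\mathbb{C})$ has at least $T_G$ linearly independent symmetric invariant non-degenerate bilinear forms.
   Context: Let $V=\mathbb{C}^{2N}$ carry a non-degenerate antisymmetric bilinear form $\omega$, and let $Sp(2N)\subset \mathrm{End}(V)$ be the group of linear maps preserving $\omega$. An element $R\in Sp(2N)$ is a symplectic reflection if $\mathrm{rk}(R-1)=2$. A symplectic reflection group is a finite subgroup $G\subset Sp(2N)$ generated by a set of symplectic reflections; $\mathcal{R}$ denotes the set of all symplectic reflections in $G$. For $R\in\mathcal{R}$ put $V_R=\mathrm{Im}(R-1)$, $Z_R=\mathrm{Ker}(R-1)$; then $V=V_R\oplus Z_R$ is an $\omega$-orthogonal decomposition, and $\omega_R(x,y):=\omega(x_{V_R},y_{V_R})$, where $x_{V_R}$ denotes the component of $x$ in $V_R$. Let $\eta:\mathcal{R}\to\mathbb{C}$, $R\mapsto\eta_R$, be constant on $G$-conjugacy classes. The symplectic reflection algebra $H_{1,\eta}(G)$ is the unital associative complex algebra generated by $V$ and the group algebra $\mathbb{C}[G]$ subject to the relations $gx=g(x)g$ for $g\in G$, $x\in V$, and $[x,y]=xy-yx=\omega(x,y)+\sum_{R\in\mathcal{R}}\eta_R\,\omega_R(x,y)R$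 for $x,y\in V$. It is a superalgebra with parity $\pi(x)=1$ for $x\in V$ and $\pi(g)=0$ for $g\in G$. $A^L$ denotes the space $A$ regarded as a Lie algebra with bracket $fg-gf$; $A^S$ denotes the space $A$ regarded as a Lie superalgebra with bracket $fg-(-1)^{\pi(f)\pi(g)}gf$ (homogeneous $f,g$). $[A^L,A^L]$ and $[A^S,A^S]$ denote the linear spans of all the respective brackets, and $\mathbb{C}\subset A$ denotes the scalar multiples of the unit. A bilinear form $B$ is invariant if $B([x,y],z)=B(x,[y,z])$ for all $x,y,z$, where the bracket is that of the Lie (super)algebra in question; it is supersymmetric if $B(x,y)=(-1)^{\pi(x)\pi(y)}B(y,x)$ for homogeneous $x,y$; it is non-degenerate if $B(v,x)=0$ for all $x$ implies $v=0$. *)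

(* Defs.v *)
From HB Require Import structures.
From mathcomp Require Import all_boot all_order all_fingroup all_algebra.
From mathcomp Require Import sesquilinear boolp complex reals.

Set Implicit Arguments.
Unset Strict Implicit.
Unset Printing Implicit Defensive.

Import GRing.Theory.
Local Open Scope ring_scope.
Local Open Scope quotient_scope.

Section Forms.
Variables (K : fieldType) (L : lmodType K).

Definition form_nondegenerate (B : L -> L -> K) : Prop :=
  forall v, (forall x, B v x = 0) -> v = 0.

Definition form_antisymmetric (B : L -> L -> K) : Prop :=
  forall x y, B x y = - B y x.

Definition form_symmetric (B : L -> L -> K) : Prop :=
  forall x y, B x y = B y x.

(* [homog b x]: x is homogeneous of parity b, with odd = true. *)
Definition form_supersymmetric (homog : bool -> L -> Prop)
    (B : L -> L -> K) : Prop :=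
  forall (b c : bool) x y,
    homog b x -> homog c y -> B x y = (-1) ^+ (b && c) * B y x.

Definition form_invariant (br : L -> L -> L) (B : L -> L -> K) : Prop :=
  forall x y z, B (br x y) z = B x (br y z).

Definition forms_independent (n : nat) (B : 'I_n -> L -> L -> K) : Prop :=
  forall c : 'I_n -> K,
    (forall x y, \sum_(i < n) c i * B i x y = 0) -> forall i, c i = 0.

End Forms.

Section Derived.
Variables (K : fieldType) (L : lmodType K) (br : L -> L -> L).

Definition in_derived : {pred L} := fun x =>
  `[< exists s : seq (K * (L * L)),
        x = \sum_(p <- s) p.1 *: br p.2.1 p.2.2 >].

Fact in_derived_closed : submod_closed in_derived.
Proof.
split=> [|a x y /asboolP[s ->] /asboolP[t ->]]; apply/asboolP.
  by exists [::]; rewrite big_nil.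
exists ([seq (a * p.1, p.2) | p <- s] ++ t).
rewrite big_cat big_map /= scaler_sumr; congr (_ + _).
by apply: eq_bigr => p _; rewrite scalerA.
Qed.
HB.instance Definition _ :=
  GRing.isSubmodClosed.Build K L in_derived in_derived_closed.

Fact in_derived_br x y : br x y \in in_derived.
Proof. by apply/asboolP; exists [:: (1, (x, y))]; rewrite big_seq1 scale1r. Qed.

Record derived := Derived { derived_val : L; _ : derived_val \in in_derived }.
HB.instance Definition _ := [isSub for derived_val].
HB.instance Definition _ := [Choice of derived by <:].
HB.instance Definition _ := [SubChoice_isSubLmodule of derived by <:].

Definition derived_br (x y : derived) : derived :=
  Derived (in_derived_br (derived_val x) (derived_val y)).

End Derived.

Section QuotientModule.
Variables (K : fieldType) (L : lmodType K) (J : submodClosed L).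

(* ring_quotient works with zmodClosed predicates, to which submodClosed does
   not coerce. *)
Definition quotmod_ker : {pred L} := fun x => x \in J.
Fact quotmod_ker_closed : zmod_closed quotmod_ker.
Proof.
split=> [|x y Jx Jy]; first exact: (rpred0 J).
by rewrite -scaleN1r; apply: (@rpredD _ J) => //; apply: (@rpredZ _ _ J).
Qed.
HB.instance Definition _ :=
  GRing.isZmodClosed.Build L quotmod_ker quotmod_ker_closed.

Definition quotmod := Quotient.quot quotmod_ker.
HB.instance Definition _ := GRing.Zmodule.on quotmod.

Definition quotmod_pi (x : L) : quotmod := \pi_(Quotient.quot quotmod_ker) x.
Definition quotmod_repr (u : quotmod) : L := generic_quotient.repr (u : Quotient.quot quotmod_ker).

Lemma quotmod_reprK : cancel quotmod_repr quotmod_pi.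
Proof. exact: generic_quotient.reprK. Qed.

Lemma quotmod_piP x y : quotmod_pi x = quotmod_pi y <-> x - y \in J.
Proof.
rewrite -[_ \in J]/(x - y \in quotmod_ker) Quotient.idealrBE.
by split=> [xy|/eqP]; [apply/eqP|].
Qed.

Lemma quotmod_piD x y : quotmod_pi (x + y) = quotmod_pi x + quotmod_pi y.
Proof. exact: raddfD. Qed.

Definition quotmod_scale (a : K) (u : quotmod) : quotmod :=
  quotmod_pi (a *: quotmod_repr u).

Lemma quotmod_scale_pi a x :
  quotmod_scale a (quotmod_pi x) = quotmod_pi (a *: x).
Proof.
apply/quotmod_piP; rewrite -scalerBr rpredZ //.
by apply/quotmod_piP; rewrite quotmod_reprK.
Qed.

Fact quotmod_scaleA a b u :
  quotmod_scale a (quotmod_scale b u) = quotmod_scale (a * b) u.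
Proof. by rewrite -[u]quotmod_reprK !quotmod_scale_pi scalerA. Qed.
Fact quotmod_scale1 : left_id 1 quotmod_scale.
Proof. by move=> u; rewrite -[u]quotmod_reprK quotmod_scale_pi scale1r. Qed.
Fact quotmod_scaleDr : right_distributive quotmod_scale +%R.
Proof.
move=> a u v; rewrite -[u]quotmod_reprK -[v]quotmod_reprK.
by rewrite -quotmod_piD !quotmod_scale_pi scalerDr quotmod_piD.
Qed.
Fact quotmod_scaleDl u : {morph quotmod_scale^~ u : a b / a + b}.
Proof.
move=> a b; rewrite -[u]quotmod_reprK !quotmod_scale_pi.
by rewrite scalerDl quotmod_piD.
Qed.
HB.instance Definition _ := GRing.Zmodule_isLmodule.Build K quotmod
  quotmod_scaleA quotmod_scale1 quotmod_scaleDr quotmod_scaleDl.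

(* The induced bracket; it is independent of the representatives when J is an
   ideal. *)
Definition quotmod_br (br : L -> L -> L) (u v : quotmod) : quotmod :=
  quotmod_pi (br (quotmod_repr u) (quotmod_repr v)).

End QuotientModule.

Section ReflectionGroups.
Variables (K : fieldType) (V : vectType K) (omega : V -> V -> K).
Variables (gT : finGroupType) (rho : gT -> 'End(V)).

Definition is_reflection (g : gT) : bool := \dim (limg (rho g - \1)%VF) == 2.

(* A finite subgroup of Sp(V), presented as a finite group gT acting faithfully
   on V by rho. *)
Record symplectic_reflection_group : Prop := SymplecticReflectionGroup {
  srg_one : rho 1%g = \1%VF;
  srg_mul : forall g h, rho (g * h)%g = (rho g \o rho h)%VF;
  srg_inj : injective rho;
  srg_symplectic : forall g x y, omega (rho g x) (rho g y) = omega x y;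
  srg_generated : exists2 S : {set gT},
    {in S, forall g, is_reflection g} & <<S>>%g = [set: gT]
}.

(* omega evaluated on the components in V_R = Im (R - 1) along
   Z_R = Ker (R - 1). *)
Definition omega_refl (r : gT) (x y : V) : K :=
  let p := daddv_pi (limg (rho r - \1)%VF) (lker (rho r - \1)%VF) in
  omega (p x) (p y).

(* eta is a function on reflections; its values elsewhere are never used. *)
Definition reflection_class_function (eta : gT -> K) : Prop :=
  forall r h : gT, is_reflection r -> eta (r ^ h)%g = eta r.

Definition num_classes_without_eigenvalue (a : K) : nat :=
  #|[set c in classes [set: gT] |
      [forall g in c, ~~ passmx.leigenvalue (rho g) a]]|.

End ReflectionGroups.

(* Noncommutative polynomial expressions in the generators of the algebra. *)
Inductive sra_expr (K : Type) (V : Type) (gT : Type) : Type :=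
  | Scal of K
  | Vec of V
  | Grp of gT
  | Sum of sra_expr K V gT & sra_expr K V gT
  | Prod of sra_expr K V gT & sra_expr K V gT.
Arguments Scal {K V gT}.
Arguments Vec {K V gT}.
Arguments Grp {K V gT}.

HB.instance Definition _ K V gT := gen_eqMixin (sra_expr K V gT).
HB.instance Definition _ K V gT := gen_choiceMixin (sra_expr K V gT).

Section SymplecticReflectionAlgebra.
Variables (K : fieldType) (V : vectType K) (omega : V -> V -> K).
Variables (gT : finGroupType) (rho : gT -> 'End(V)) (eta : gT -> K).

Local Notation expr := (sra_expr K V gT).

(* The smallest congruence on expressions that makes the quotient a unital
   associative K-algebra (K being mapped to it by Scal), makes Vec linear and
   Grp multiplicative, and contains the two defining relations. *)
Inductive sra_eq : expr -> expr -> Prop :=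
  | SraRefl e : sra_eq e e
  | SraSym e f : sra_eq e f -> sra_eq f e
  | SraTrans e f g : sra_eq e f -> sra_eq f g -> sra_eq e g
  | SraSum e e' f f' : sra_eq e e' -> sra_eq f f' -> sra_eq (Sum e f) (Sum e' f')
  | SraProd e e' f f' :
      sra_eq e e' -> sra_eq f f' -> sra_eq (Prod e f) (Prod e' f')
  | SraSumA e f g : sra_eq (Sum e (Sum f g)) (Sum (Sum e f) g)
  | SraSumC e f : sra_eq (Sum e f) (Sum f e)
  | SraSum0 e : sra_eq (Sum (Scal 0) e) e
  | SraSumN e : sra_eq (Sum (Prod (Scal (-1)) e) e) (Scal 0)
  | SraProdA e f g : sra_eq (Prod e (Prod f g)) (Prod (Prod e f) g)
  | SraProd1l e : sra_eq (Prod (Scal 1) e) e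
  | SraProd1r e : sra_eq (Prod e (Scal 1)) e
  | SraProdDl e f g : sra_eq (Prod (Sum e f) g) (Sum (Prod e g) (Prod f g))
  | SraProdDr e f g : sra_eq (Prod e (Sum f g)) (Sum (Prod e f) (Prod e g))
  | SraScalD a b : sra_eq (Scal (a + b)) (Sum (Scal a) (Scal b))
  | SraScalM a b : sra_eq (Scal (a * b)) (Prod (Scal a) (Scal b))
  | SraScalC a e : sra_eq (Prod (Scal a) e) (Prod e (Scal a))
  | SraVec a x y :
      sra_eq (Vec (a *: x + y)) (Sum (Prod (Scal a) (Vec x)) (Vec y))
  | SraGrp1 : sra_eq (Grp 1%g) (Scal 1)
  | SraGrpM g h : sra_eq (Grp (g * h)%g) (Prod (Grp g) (Grp h))
  | SraGrpVec g x :
      sra_eq (Prod (Grp g) (Vec x)) (Prod (Vec (rho g x)) (Grp g))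
  | SraVecVec x y :
      sra_eq
        (Sum (Prod (Vec x) (Vec y)) (Prod (Scal (-1)) (Prod (Vec y) (Vec x))))
        (Sum (Scal (omega x y))
           (\big[@Sum K V gT/Scal 0]_(r | is_reflection rho r)
              Prod (Scal (eta r * omega_refl omega rho r x y)) (Grp r))).

Definition sra_rel : rel expr := fun e f => `[< sra_eq e f >].

Fact sra_rel_equiv : equiv_class_of sra_rel.
Proof.
split=> [e|e f|f e g].
- by apply/asboolP; apply: SraRefl.
- by apply/asboolP/asboolP; apply: SraSym.
- by move=> /asboolP ef /asboolP fg; apply/asboolP; apply: SraTrans ef fg.
Qed.
Canonical sra_equiv := EquivRelPack sra_rel_equiv.

(* The algebra H_{1,eta}(G). MathComp's algebra structures require 1 != 0, which
   fails for some data (rho, omega, eta) that is not constrained here, so sra is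
   only declared as a ring and a K-module; see sra_scaleAl and sra_scaleAr. *)
Definition sra := {eq_quot sra_equiv}.
HB.instance Definition _ := Choice.on sra.

Definition sra_pi (e : expr) : sra := \pi_{eq_quot sra_equiv} e.
Definition sra_repr (u : sra) : expr := generic_quotient.repr (u : {eq_quot sra_equiv}).

Lemma sra_reprK : cancel sra_repr sra_pi. Proof. exact: generic_quotient.reprK. Qed.

Lemma sra_piP e f : sra_pi e = sra_pi f <-> sra_eq e f.
Proof.
split=> [/eqmodP ef|ef]; first by apply/asboolP; exact: ef.
by apply/eqmodP; apply/asboolP.
Qed.

Lemma sra_repr_pi e : sra_eq (sra_repr (sra_pi e)) e.
Proof. by apply/sra_piP; rewrite sra_reprK. Qed.

Definition sra_add (u v : sra) := sra_pi (Sum (sra_repr u) (sra_repr v)).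
Definition sra_mul (u v : sra) := sra_pi (Prod (sra_repr u) (sra_repr v)).

Lemma sra_add_pi e f : sra_add (sra_pi e) (sra_pi f) = sra_pi (Sum e f).
Proof. by apply/sra_piP/SraSum; apply: sra_repr_pi. Qed.
Lemma sra_mul_pi e f : sra_mul (sra_pi e) (sra_pi f) = sra_pi (Prod e f).
Proof. by apply/sra_piP/SraProd; apply: sra_repr_pi. Qed.

Definition sra_opp (u : sra) := sra_mul (sra_pi (Scal (-1))) u.

Fact sra_addA : associative sra_add.
Proof.
move=> u v w; rewrite -[u]sra_reprK -[v]sra_reprK -[w]sra_reprK !sra_add_pi.
exact/sra_piP/SraSumA.
Qed.
Fact sra_addC : commutative sra_add.
Proof. by move=> u v; apply/sra_piP/SraSumC. Qed.
Fact sra_add0 : left_id (sra_pi (Scal 0)) sra_add.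
Proof.
by move=> u; rewrite -[u]sra_reprK sra_add_pi; apply/sra_piP/SraSum0.
Qed.
Fact sra_addN : left_inverse (sra_pi (Scal 0)) sra_opp sra_add.
Proof.
move=> u; rewrite -[u]sra_reprK /sra_opp sra_mul_pi sra_add_pi.
exact/sra_piP/SraSumN.
Qed.
HB.instance Definition _ :=
  GRing.isZmodule.Build sra sra_addA sra_addC sra_add0 sra_addN.

Fact sra_mulA : associative sra_mul.
Proof.
move=> u v w; rewrite -[u]sra_reprK -[v]sra_reprK -[w]sra_reprK !sra_mul_pi.
exact/sra_piP/SraProdA.
Qed.
Fact sra_mul1l : left_id (sra_pi (Scal 1)) sra_mul.
Proof.
by move=> u; rewrite -[u]sra_reprK sra_mul_pi; apply/sra_piP/SraProd1l.
Qed.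
Fact sra_mul1r : right_id (sra_pi (Scal 1)) sra_mul.
Proof.
by move=> u; rewrite -[u]sra_reprK sra_mul_pi; apply/sra_piP/SraProd1r.
Qed.
Fact sra_mulDl : left_distributive sra_mul +%R.
Proof.
move=> u v w; rewrite -[u]sra_reprK -[v]sra_reprK -[w]sra_reprK.
rewrite /GRing.add /= !(sra_add_pi, sra_mul_pi).
exact/sra_piP/SraProdDl.
Qed.
Fact sra_mulDr : right_distributive sra_mul +%R.
Proof.
move=> u v w; rewrite -[u]sra_reprK -[v]sra_reprK -[w]sra_reprK.
rewrite /GRing.add /= !(sra_add_pi, sra_mul_pi).
exact/sra_piP/SraProdDr.
Qed.
HB.instance Definition _ := GRing.Zmodule_isPzRing.Build sra
  sra_mulA sra_mul1l sra_mul1r sra_mulDl sra_mulDr.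

Definition sra_scale (a : K) (u : sra) : sra := sra_pi (Scal a) * u.

Lemma sra_piD e f : sra_pi (Sum e f) = sra_pi e + sra_pi f.
Proof. by rewrite -sra_add_pi. Qed.
Lemma sra_piM e f : sra_pi (Prod e f) = sra_pi e * sra_pi f.
Proof. by rewrite -sra_mul_pi. Qed.
Lemma sra_pi_scalM a b :
  sra_pi (Scal (a * b)) = sra_pi (Scal a) * sra_pi (Scal b).
Proof. by rewrite -sra_piM; apply/sra_piP/SraScalM. Qed.

Fact sra_scaleA a b u : sra_scale a (sra_scale b u) = sra_scale (a * b) u.
Proof. by rewrite /sra_scale mulrA sra_pi_scalM. Qed.
Fact sra_scale1 : left_id 1 sra_scale.
Proof. exact: (@mul1r sra). Qed.
Fact sra_scaleDr : right_distributive sra_scale +%R.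
Proof. by move=> a u v; apply: mulrDr. Qed.
Fact sra_scaleDl u : {morph sra_scale^~ u : a b / a + b}.
Proof.
move=> a b; rewrite /sra_scale -mulrDl -sra_piD; congr (_ * _).
exact/sra_piP/SraScalD.
Qed.
HB.instance Definition _ := GRing.Zmodule_isLmodule.Build K sra
  sra_scaleA sra_scale1 sra_scaleDr sra_scaleDl.

Lemma sra_pi_scal_comm a (u : sra) : sra_pi (Scal a) * u = u * sra_pi (Scal a).
Proof. by rewrite -[u]sra_reprK -!sra_piM; apply/sra_piP/SraScalC. Qed.

Lemma sra_scaleE (a : K) (u : sra) : a *: u = sra_pi (Scal a) * u.
Proof. by []. Qed.
Lemma sra_scaleAl (a : K) (u v : sra) : a *: (u * v) = (a *: u) * v.
Proof. exact: mulrA. Qed.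
Lemma sra_scaleAr (a : K) (u v : sra) : a *: (u * v) = u * (a *: v).
Proof. by rewrite !sra_scaleE mulrA sra_pi_scal_comm -mulrA. Qed.

Lemma sra_pi_scal a : sra_pi (Scal a) = a *: (1 : sra).
Proof. by rewrite -[LHS]mulr1. Qed.

Definition sra_vec (x : V) : sra := sra_pi (Vec x).
Definition sra_grp (g : gT) : sra := sra_pi (Grp g).

Lemma sra_vecP a x y : sra_vec (a *: x + y) = a *: sra_vec x + sra_vec y.
Proof. by rewrite sra_scaleE -sra_piM -sra_piD; apply/sra_piP/SraVec. Qed.

Lemma sra_grp1 : sra_grp 1%g = 1.
Proof. exact/sra_piP/SraGrp1. Qed.

Lemma sra_grpM g h : sra_grp (g * h)%g = sra_grp g * sra_grp h.
Proof. by rewrite -sra_piM; apply/sra_piP/SraGrpM. Qed.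

Lemma sra_grp_vec g x : sra_grp g * sra_vec x = sra_vec (rho g x) * sra_grp g.
Proof. by rewrite -!sra_piM; apply/sra_piP/SraGrpVec. Qed.

Lemma sra_pi_sum (P : pred gT) (F : gT -> expr) :
  sra_pi (\big[@Sum K V gT/Scal 0]_(r | P r) F r) = \sum_(r | P r) sra_pi (F r).
Proof. by apply: (big_morph sra_pi sra_piD). Qed.

Lemma sra_piN e : sra_pi (Prod (Scal (-1)) e) = - sra_pi e.
Proof. by rewrite sra_piM sra_pi_scal -sra_scaleAl mul1r scaleN1r. Qed.

Lemma sra_vec_comm x y :
  sra_vec x * sra_vec y - sra_vec y * sra_vec x =
  omega x y *: (1 : sra) + \sum_(r | is_reflection rho r)
    (eta r * omega_refl omega rho r x y) *: sra_grp r.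
Proof.
have /sra_piP := SraVecVec x y; rewrite !sra_piD sra_piN !sra_piM => ->.
by rewrite sra_pi_scal sra_pi_sum; congr (_ + _); apply: eq_bigr=> r _;
  rewrite sra_piM.
Qed.

(* Even (b = false) and odd (b = true) components for the grading in which
   vectors are odd and group elements are even. *)
Fixpoint expr_part (e : expr) (b : bool) : sra :=
  match e with
  | Scal a => if b then 0 else a *: (1 : sra)
  | Vec x => if b then sra_vec x else 0
  | Grp g => if b then 0 else sra_grp g
  | Sum e f => expr_part e b + expr_part f b
  | Prod e f => \sum_(c : bool) expr_part e c * expr_part f (b (+) c)
  end.

Lemma expr_part_eq e f : sra_eq e f -> expr_part e =1 expr_part f.
Proof.
have scal11 (a : K) (u : sra) : a *: (1 : sra) * u = a *: u.
  by rewrite -sra_scaleAl mul1r.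
have scal1r (a : K) (u : sra) : u * (a *: (1 : sra)) = a *: u.
  by rewrite -sra_scaleAr mulr1.
pose simp := (mul0r, mulr0, addr0, add0r, scal11, scal1r, scaler0).
elim=> {e f} /=.
- by [].
- by move=> e f _ IH b; rewrite IH.
- by move=> e f g _ IH _ IH' b; rewrite IH IH'.
- by move=> e e' f f' _ IH _ IH' b; rewrite IH IH'.
- by move=> e e' f f' _ IH _ IH' b; apply: eq_bigr => c _; rewrite IH IH'.
- by move=> e f g b; rewrite addrA.
- by move=> e f b; rewrite addrC.
- by move=> e [] /=; rewrite ?scale0r add0r.
- by move=> e [] /=; rewrite ?big_bool /= ?simp ?scaleN1r ?addNr ?scale0r.
- by move=> e f g []; rewrite /= !big_bool /=;
    rewrite !(mulrDl, mulrDr) !mulrA [LHS](AC (2*2) ((2*3)*(1*4))).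
- by move=> e [] /=; rewrite ?big_bool /= ?simp scale1r.
- by move=> e [] /=; rewrite ?big_bool /= ?simp scale1r.
- move=> e f g b; rewrite -big_split; apply: eq_bigr => c _; exact: mulrDl.
- move=> e f g b; rewrite -big_split; apply: eq_bigr => c _; exact: mulrDr.
- by move=> x y []; rewrite ?addr0 ?scalerDl.
- by move=> x y []; rewrite ?big_bool /= ?simp ?scalerA.
- by move=> x e [] /=; rewrite ?big_bool /= ?simp.
- by move=> a x y [] /=; rewrite ?big_bool /= ?simp ?scaler0 ?sra_vecP ?addr0.
- by case; rewrite ?sra_grp1 ?scale1r.
- by move=> g h [] /=; rewrite ?big_bool /= ?simp ?sra_grpM.
- by move=> g x [] /=; rewrite ?big_bool /= ?simp ?sra_grp_vec.
- move=> x y b; have partS (P : pred gT) (F : gT -> expr) :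
      expr_part (\big[@Sum K V gT/Scal 0]_(r | P r) F r) b
      = \sum_(r | P r) expr_part (F r) b.
    apply: (big_morph (expr_part^~ b)) => //=.
    by case: b => //; rewrite scale0r.
  rewrite partS; case: b {partS} => /=; rewrite ?big_bool /= ?simp.
    by rewrite big1 // => r _; rewrite ?big_bool /= ?simp.
  rewrite scaleN1r sra_vec_comm; congr (_ + _).
  by apply: eq_bigr => r _; rewrite ?big_bool /= ?simp.
Qed.

Definition sra_part (u : sra) (b : bool) : sra := expr_part (sra_repr u) b.

Lemma sra_part_pi e b : sra_part (sra_pi e) b = expr_part e b.
Proof. exact/expr_part_eq/sra_repr_pi. Qed.

Lemma sra_part_sum u : \sum_(b : bool) sra_part u b = u.
Proof.
rewrite -[u in RHS]sra_reprK big_bool /sra_part.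
elim: (sra_repr u) => [a|x|g|e IHe f IHf|e IHe f IHf] /=.
- by rewrite add0r sra_pi_scal.
- by rewrite addr0.
- by rewrite add0r.
- by rewrite sra_piD -IHe -IHf addrACA.
rewrite sra_piM -IHe -IHf !big_bool /= mulrDl !mulrDr.
by rewrite addrACA [X in X + _]addrC addrACA.
Qed.

Definition sra_homog (b : bool) (u : sra) : Prop := sra_part u b = u.

Definition sra_lie (f g : sra) : sra := f * g - g * f.

(* The bracket f g - (-1)^(pi f pi g) g f of homogeneous elements, extended
   bilinearly. *)
Definition sra_superlie (f g : sra) : sra :=
  \sum_(b : bool) \sum_(c : bool)
    (sra_part f b * sra_part g c
     - (-1) ^+ (b && c) * (sra_part g c * sra_part f b)).

Definition sra_simple : Prop :=
  (1 : sra) != 0 /\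
  forall I : sra -> Prop,
    I 0 -> (forall u v, I u -> I v -> I (u + v)) ->
    (forall a u, I u -> I (a * u)) -> (forall a u, I u -> I (u * a)) ->
    (forall u, I u -> u = 0) \/ (forall u, I u).

(* With A := sra, the types sra_dsuper, sra_dlie and sra_qlie are [A^S, A^S],
   [A^L, A^L] and [A^L, A^L] / ([A^L, A^L] /\ K). *)
Definition sra_dsuper := derived sra_superlie.

Definition sra_dsuper_br : sra_dsuper -> sra_dsuper -> sra_dsuper :=
  derived_br (br := sra_superlie).

Definition sra_dsuper_homog (b : bool) (x : sra_dsuper) : Prop :=
  sra_homog b (derived_val x).

Definition sra_dlie := derived sra_lie.

Definition sra_dlie_scalars : {pred sra_dlie} :=
  fun x => `[< exists a : K, derived_val x = a *: (1 : sra) >].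

Fact sra_dlie_scalars_closed : submod_closed sra_dlie_scalars.
Proof.
split=> [|a x y /asboolP[b xE] /asboolP[c yE]]; apply/asboolP.
  by exists 0; rewrite scale0r.
by exists (a * b + c); rewrite scalerDl -scalerA -xE -yE.
Qed.
HB.instance Definition _ := GRing.isSubmodClosed.Build K sra_dlie
  sra_dlie_scalars sra_dlie_scalars_closed.

Definition sra_qlie := quotmod sra_dlie_scalars.
Definition sra_qlie_br : sra_qlie -> sra_qlie -> sra_qlie :=
  quotmod_br (derived_br (br := sra_lie)).

Lemma sra_qlie_br_pi (x y : sra_dlie) :
  sra_qlie_br (quotmod_pi _ x) (quotmod_pi _ y) =
  quotmod_pi _ (derived_br x y).
Proof.
have [a xE] : exists a : K,
    derived_val (quotmod_repr (quotmod_pi sra_dlie_scalars x)) = derived_val x + a *: (1 : sra).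
  have /asboolP[a aE] : quotmod_repr (quotmod_pi sra_dlie_scalars x) - x
      \in sra_dlie_scalars by apply/quotmod_piP; rewrite quotmod_reprK.
  by exists a; rewrite -aE addrC subrK.
have [b yE] : exists b : K,
    derived_val (quotmod_repr (quotmod_pi sra_dlie_scalars y)) = derived_val y + b *: (1 : sra).
  have /asboolP[b bE] : quotmod_repr (quotmod_pi sra_dlie_scalars y) - y
      \in sra_dlie_scalars by apply/quotmod_piP; rewrite quotmod_reprK.
  by exists b; rewrite -bE addrC subrK.
rewrite /sra_qlie_br /quotmod_br; congr (quotmod_pi _ _); apply: val_inj => /=.
rewrite xE yE; set u : sra := derived_val x; set v : sra := derived_val y.
have comm_scal (c : K) (w : sra) : w * (c *: (1 : sra)) = c *: (1 : sra) * w.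
  by rewrite -sra_scaleAl -sra_scaleAr mulr1 mul1r.
rewrite /sra_lie !mulrDl !mulrDr !(comm_scal a) (comm_scal b u).
have addE (p q r s t : sra) : p + q + (r + s) - (t + r + (q + s)) = p - t.
  by rewrite [t + r + _]addrACA -[p + q + _]addrA -[t + q + _]addrA opprD addrACA subrr addr0.
exact: addE.
Qed.

End SymplecticReflectionAlgebra.

(* Main.v *)
Require Import Defs.
From HB Require Import structures.
From mathcomp Require Import all_boot all_order all_fingroup all_algebra.
From mathcomp Require Import sesquilinear complex reals.
From mathcomp Require Import boolp ring zify.

(* A nonzero trace (supertrace) tr on the simple algebra A gives the form
   tr (x y), whose radical is a proper two-sided ideal, hence zero. On the derived
   algebra its radical consists of (super)central elements. A central z is a
   scalar: a trace is determined by its values on G, so that the traces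
   tr (z ^ j _) are linearly dependent, hence z is algebraic over C. Linear
   independence of the forms reduces to that of the traces, and it remains to
   produce T_G traces (S_G supertraces).

   Put eps = 1 for traces and eps = -1 for supertraces. A functional F on A is a
   family of functions F (v_1 .. v_n g); F is built by increasing word length n,
   as a functional with F (v P g) = eps F (P g v) for the words P of odd length
   < n. Let h = eps g. The passage from n to n + 2 requires symmetric forms s_g on
   V^(n+2) with s_g ((h - 1) v, P) prescribed. The compatibility conditions for
   the existence of s_g hold on Im (h - 1) by the relations of A, and they say
   F ([P, v] g) = 0 on W = Ker (h - 1). The latter are achieved beforehand by
   changing F on the words of length n in W, by the algebraic Poincare lemma on the
   symplectic space W; this is done by increasing dimension of W, because the
   reflections r that contribute to [P, v] lead to group elements r g with
   smaller W. When W = 0 the value F (g) stays free, which accounts for T_G and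
   S_G. A Poincare lemma on V also proves the PBW theorem in dual form: there
   is a functional on A with any prescribed leading symbol. *)

Set Implicit Arguments.
Unset Strict Implicit.
Unset Printing Implicit Defensive.

Import GRing.Theory.
Local Open Scope ring_scope.

(** A commutator of two vectors lies in the group algebra and shortens a word by two letters. Hence
    even and odd words never interact, lengths advance by two, and the finished functional may be
    set to 0 on odd words. All homotopies are normalised by Euler's identity, which counts letters,
    so characteristic 0 is essential. On W the normalising constant is n + dim W. It is invertible
    even for n = 0 as long as W is nonzero, and for W = 0 there is no condition to satisfy: this is
    why exactly those group elements keep a free value. The symmetric forms are chosen for each g
    separately, so conjugation invariance is restored by averaging after every change. The two
    algebras treat scalars differently. The unit of G never has eigenvalue -1, so some supertrace is
    1 at the unit; it vanishes on brackets, hence [A^S,A^S] contains no nonzero scalar. A trace need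
    not separate scalars from brackets, and there they are divided out. A linear relation between
    forms makes the form of one combined trace vanish. If that trace were nonzero, nondegeneracy
    would leave no room for a nonzero element, although V <> 0 supplies one. *)

(** Reduces a goal that rearranges a known equation to an identity for [ring]. *)
Lemma eq_by_sub (Z : zmodType) (a b x y : Z) : a = b -> x - y = a - b -> x = y.
Proof. by move=> -> e; apply/eqP; rewrite -subr_eq0 e subrr. Qed.

(** * Multilinear functions of words *)

Section Words.
Variables (K : fieldType) (V : lmodType K).
Implicit Types (f s : seq V -> K) (phi : V -> seq V -> K) (p q r : seq V).

Definition multilinear f := forall a x y p q,
  f (p ++ (a *: x + y) :: q) = a * f (p ++ x :: q) + f (p ++ y :: q).

Definition symmetric_words f := forall p x y q,
  f (p ++ x :: y :: q) = f (p ++ y :: x :: q).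

(** Truncation to one length turns symmetry known only for words of length [n] into symmetry for all
    words, as the [leibniz] lemmas require. *)
Definition on_size n f p := if size p == n then f p else 0.

Lemma multilinear_on_size n f : multilinear f -> multilinear (on_size n f).
Proof.
move=> fl a x y p q; rewrite /on_size !size_cat /= fl.
by case: ifP => // _; rewrite mulr0 addr0.
Qed.

Lemma multilinearD f p q x y : multilinear f ->
  f (p ++ (x + y) :: q) = f (p ++ x :: q) + f (p ++ y :: q).
Proof. by move=> /(_ 1 x y p q); rewrite scale1r mul1r. Qed.

Lemma multilinear0 f p q : multilinear f -> f (p ++ 0 :: q) = 0.
Proof.
move=> fl; have := multilinearD p q 0 0 fl.
by rewrite addr0 => /eqP; rewrite -subr_eq0 opprD addrA subrr sub0r oppr_eq0 => /eqP.
Qed.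

Lemma multilinearZ f p q a x : multilinear f ->
  f (p ++ (a *: x) :: q) = a * f (p ++ x :: q).
Proof. by move=> fl; have := fl a x 0 p q; rewrite addr0 multilinear0 // addr0. Qed.

Lemma multilinearB f p q x y : multilinear f ->
  f (p ++ (x - y) :: q) = f (p ++ x :: q) - f (p ++ y :: q).
Proof.
by move=> fl; rewrite multilinearD // -scaleN1r multilinearZ // mulN1r.
Qed.

Lemma multilinear_sum (I : Type) (t : seq I) (E : I -> V) f p q :
    multilinear f ->
  f (p ++ (\sum_(i <- t) E i) :: q) = \sum_(i <- t) f (p ++ E i :: q).
Proof.
move=> fl; elim: t => [|i t IH]; first by rewrite !big_nil multilinear0.
by rewrite !big_cons multilinearD // IH.
Qed.

Lemma multilinear_prefix f p : multilinear f -> multilinear (fun q => f (p ++ q)).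
Proof. by move=> fl a x y q r /=; rewrite !catA fl. Qed.

Lemma multilinear_map f (L : {linear V -> V}) :
  multilinear f -> multilinear (fun q => f (map L q)).
Proof. by move=> fl a x y p q; rewrite !map_cat /= linearP fl. Qed.

Lemma symmetric_on_size n f :
    (forall p x y q, (size p + size q).+2 = n ->
       f (p ++ x :: y :: q) = f (p ++ y :: x :: q)) ->
  symmetric_words (on_size n f).
Proof.
move=> fs p x y q; rewrite /on_size !size_cat /= !addnS.
by case: eqP => // /fs ->.
Qed.

Lemma symmetric_prefix f p :
  symmetric_words f -> symmetric_words (fun q => f (p ++ q)).
Proof. by move=> fs q x y r; rewrite !catA fs. Qed.

Lemma symmetric_map f (L : V -> V) :
  symmetric_words f -> symmetric_words (fun q => f (map L q)).
Proof. by move=> fs p x y q; rewrite !map_cat /= fs. Qed.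

Lemma symmetric_perm f p q : symmetric_words f -> perm_eq p q -> f p = f q.
Proof.
move=> fs; apply: catCA_perm_subst => {p q} s1 s2 s3.
have mv r x p q : f (r ++ p ++ x :: q) = f (r ++ x :: p ++ q).
  elim: p r => //= y p IH r; rewrite -cat_rcons IH cat_rcons fs //.
suff: forall r, f (r ++ s1 ++ s2 ++ s3) = f (r ++ s2 ++ s1 ++ s3) by move/(_ [::]).
by elim: s2 => //= y s2 IH r; rewrite mv -!cat_rcons IH.
Qed.

(* leibniz pi phi [:: x_1; ..; x_n] is the sum over i of
   phi x_i [:: pi x_1; ..; pi x_(i-1); x_(i+1); ..; x_n]. *)
Fixpoint leibniz (pi : V -> V) phi p : K :=
  if p is x :: q then phi x q + leibniz pi (fun y r => phi y (pi x :: r)) q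
  else 0.

Lemma leibniz_cat pi phi p q : leibniz pi phi (p ++ q) =
  leibniz pi (fun y r => phi y (r ++ q)) p
  + leibniz pi (fun y r => phi y (map pi p ++ r)) q.
Proof.
elim: p phi => [|x p IH] phi /=; first by rewrite add0r.
by rewrite IH addrA.
Qed.

Lemma eq_leibniz pi phi phi' p : (forall y r, phi y r = phi' y r) ->
  leibniz pi phi p = leibniz pi phi' p.
Proof.
by elim: p phi phi' => //= x p IH phi phi' e; rewrite e; congr (_ + _); apply: IH.
Qed.

(** [P] restricts the letters of the word, [Q] those that [phi] sees, some of which have already
    been moved by [pi]. The two functions are compared only on words one letter shorter. *)
Lemma eq_leibniz_in (P Q : pred V) pi pi' phi phi' p :
    (forall x, P x -> pi x = pi' x) -> (forall x, P x -> Q x) ->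
    (forall x, P x -> Q (pi x)) -> all P p ->
    (forall y r, P y -> all Q r -> (size r).+1 = size p -> phi y r = phi' y r) ->
  leibniz pi phi p = leibniz pi' phi' p.
Proof.
move=> epi PQ Qpi; elim: p phi phi' => //= x p IH phi phi' /andP[Px Pp] e.
congr (_ + _); first by rewrite e // (sub_all PQ).
apply: IH => // y r Py Qr sz; rewrite epi // e //= ?sz // Qr andbT -epi //.
exact: Qpi.
Qed.

Lemma leibniz0 pi p : leibniz pi (fun _ _ => 0) p = 0.
Proof. by elim: p => //= x p ->; rewrite addr0. Qed.

Lemma leibniz_comb pi phi psi a p :
  leibniz pi (fun y r => a * phi y r + psi y r) p =
  a * leibniz pi phi p + leibniz pi psi p.
Proof.
elim: p phi psi => [|x p IH] phi psi /=; first by rewrite mulr0 addr0.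
by rewrite IH mulrDr addrACA.
Qed.

Lemma leibniz_sum pi (I : Type) (t : seq I) (phi : I -> V -> seq V -> K) p :
  leibniz pi (fun y r => \sum_(i <- t) phi i y r) p =
  \sum_(i <- t) leibniz pi (phi i) p.
Proof.
elim: t => [|i t IH].
  rewrite big_nil (@eq_leibniz _ _ (fun y r => 0)); last first.
    by move=> y r; rewrite big_nil.
  by elim: p => //= x p ->; rewrite addr0.
rewrite big_cons -IH -[X in _ = X + _]mul1r -leibniz_comb; apply: eq_leibniz => y r.
by rewrite big_cons mul1r.
Qed.

Lemma multilinear_leibniz (pi : {linear V -> V}) phi :
    (forall a x y p, phi (a *: x + y) p = a * phi x p + phi y p) ->
    (forall v, multilinear (phi v)) ->
  multilinear (leibniz pi phi).
Proof.
move=> phil phim a x y p q; rewrite !leibniz_cat /= phil.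
rewrite (@eq_leibniz _ _ (fun z r => a * phi z (r ++ x :: q) + phi z (r ++ y :: q)));
  last by move=> z r; rewrite phim.
rewrite [X in _ + (_ + X)](@eq_leibniz _ _ (fun z r =>
   a * phi z (map pi p ++ pi x :: r) + phi z (map pi p ++ pi y :: r)));
  last by move=> z r; rewrite linearP phim.
rewrite !leibniz_comb !mulrDr !addrA; ring.
Qed.

(** Exchanging neighbours x and y affects only the two summands that remove x or y, because the
    others are symmetric in their words. After moving the remaining letter to the front, these two
    summands are the sides of the second hypothesis. *)
Lemma symmetric_leibniz (pi : V -> V) phi :
    (forall v, symmetric_words (phi v)) ->
    (forall x y p, phi x (y :: p) + phi y (pi x :: p) =
                   phi y (x :: p) + phi x (pi y :: p)) ->
  symmetric_words (leibniz pi phi).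
Proof.
move=> phis phic p x y q; rewrite !leibniz_cat /= !addrA.
have rot z p' x' q' : phi z (p' ++ x' :: q') = phi z (x' :: p' ++ q').
  apply: symmetric_perm => //; by rewrite perm_sym -cat1s perm_catCA.
congr (_ + _); last by apply: eq_leibniz => z r; rewrite (phis z).
rewrite -!addrA; congr (_ + _); first by apply: eq_leibniz => z r; rewrite (phis z).
by rewrite !rot phic.
Qed.

(** Euler's identity: moving the removed letter back costs nothing, so every summand is [f p]. *)
Lemma leibniz_size f p : symmetric_words f ->
  leibniz id (fun x r => f (x :: r)) p = (size p)%:R * f p.
Proof.
elim: p f => [|x p IH] f fs /=; first by rewrite mul0r.
rewrite (@eq_leibniz _ _ (fun y r => f (x :: y :: r))); last first.
  by move=> y r; apply: (fs [::]).
by rewrite (IH (fun r => f (x :: r)) (symmetric_prefix [:: x] fs)) mulrS mulrDl mul1r.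
Qed.

End Words.

(** * The PBW theorem *)

Section PBW.
Variables (K : fieldType) (V : vectType K) (gT : finGroupType).
Variables (rho : gT -> 'End(V)) (kap : gT -> V -> V -> K).
Hypothesis charK : forall n, n.+1%:R != 0 :> K.
Hypothesis rhoM : forall g h x, rho (g * h)%g x = rho g (rho h x).
Hypothesis kap_linear : forall h a x y z,
  kap h (a *: x + y) z = a * kap h x z + kap h y z.
Hypothesis kap_anti : forall h x y, kap h x y = - kap h y x.
Hypothesis kap_conj : forall k h x y,
  kap h (rho k x) (rho k y) = kap (h ^ k)%g x y.
Hypothesis kap_jacobi : forall h x y z,
  kap h x y *: (rho h z - z) + kap h y z *: (rho h x - x)
  + kap h z x *: (rho h y - y) = 0.

Implicit Types (f : seq V -> gT -> K) (p q : seq V) (g h : gT).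

(* f p g stands for the value of a functional at the word p followed by g; the
   group element h of the commutator of x and y is moved to the right of q. *)
Definition pbw_upto n f :=
  (forall g, multilinear (f^~ g)) /\
  (forall p x y q g, ((size p + size q).+2 <= n)%N ->
     f (p ++ x :: y :: q) g - f (p ++ y :: x :: q) g =
     \sum_h kap h x y * f (p ++ map (rho h) q) (h * g)%g).

(** Equivariance of the commutator, by the substitution of k h k^-1 for h. *)
Lemma kap_conj_sum k g x y q (E : seq V -> gT -> K) :
  \sum_h kap h (rho k x) (rho k y) * E (map (rho h) (map (rho k) q)) (h * (k * g))%g =
  \sum_h kap h x y * E (map (rho k) (map (rho h) q)) (k * (h * g))%g.
Proof.
rewrite (reindex_inj (conjg_inj k^-1)%g) /=; apply: eq_bigr => h _.
rewrite kap_conj conjgKV; congr (_ * E _ _).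
  by rewrite -!map_comp; apply: eq_map => z /=; rewrite -!rhoM conjgE invgK !mulgA mulgKV.
by rewrite conjgE invgK !mulgA mulgKV.
Qed.

Lemma pbw_upto_cons n f x :
  pbw_upto n.+1 f -> pbw_upto n (fun p => f (x :: p)).
Proof.
move=> [fl fr]; split=> [g a y z p q|p y z q g sz]; first exact: (fl g a y z (x :: p)).
exact: (fr (x :: p)).
Qed.

(* Words of length m + 2 are treated by their first letter: F x extends
   f (x :: _), and th x y measures the failure of the relation in the first two
   letters. It is closed (thj), and s is the standard homotopy applied to it. *)
Lemma pbw_extend_step m f (F : V -> seq V -> gT -> K) :
    pbw_upto m.+1 f -> (forall x, pbw_upto m.+1 (F x)) ->
    (forall a x y p g, F (a *: x + y) p g = a * F x p g + F y p g) ->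
    (forall x p g, (size p <= m)%N -> F x p g = f (x :: p) g) ->
  exists f', pbw_upto m.+2 f' /\
    forall p g, (size p <= m.+1)%N -> f' p g = f p g.
Proof.
move=> [fl fr] FP Flin Ff.
pose th x y g p := F x (y :: p) g - F y (x :: p) g
  - \sum_h kap h x y * f (map (rho h) p) (h * g)%g.
have thl a x y z g p : th x (a *: y + z) g p = a * th x y g p + th x z g p.
  rewrite /th Flin; have [Fl _] := FP x; have /= -> := Fl g a y z [::] p.
  have -> : \sum_h kap h x (a *: y + z) * f (map (rho h) p) (h * g)%g =
    a * (\sum_h kap h x y * f (map (rho h) p) (h * g)%g) +
    \sum_h kap h x z * f (map (rho h) p) (h * g)%g.
    rewrite mulr_sumr -big_split; apply: eq_bigr => h _ /=.
    by rewrite kap_anti kap_linear [kap h y x]kap_anti [kap h z x]kap_anti; ring.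
  by ring.
have th_anti x y g p : th x y g p = - th y x g p.
  rewrite /th; have -> : \sum_h kap h x y * f (map (rho h) p) (h * g)%g =
    - \sum_h kap h y x * f (map (rho h) p) (h * g)%g.
    by rewrite -sumrN; apply: eq_bigr => h _; rewrite kap_anti mulNr.
  by ring.
have thl1 a x y z g p : th (a *: x + y) z g p = a * th x z g p + th y z g p.
  by rewrite th_anti thl [th x z _ _]th_anti [th y z _ _]th_anti; ring.
have thm x y g : multilinear (th x y g).
  move=> a u v p q; rewrite /th; have [Fxl _] := FP x; have [Fyl _] := FP y.
  have /= -> := Fxl g a u v (y :: p) q; have /= -> := Fyl g a u v (x :: p) q.
  have -> : \sum_h kap h x y * f (map (rho h) (p ++ (a *: u + v) :: q)) (h * g)%g =
    a * (\sum_h kap h x y * f (map (rho h) (p ++ u :: q)) (h * g)%g) +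
    \sum_h kap h x y * f (map (rho h) (p ++ v :: q)) (h * g)%g.
    rewrite mulr_sumr -big_split; apply: eq_bigr => h _ /=.
    by rewrite (multilinear_map (rho h) (fl _)); ring.
  by ring.
have ths x y g : symmetric_words (on_size m (th x y g)).
  apply: symmetric_on_size => p u v q sz.
  have [_ Fxr] := FP x; have [_ Fyr] := FP y.
  have sz' : ((size p + size q).+3 <= m.+1)%N by rewrite sz.
  have := Fxr (y :: p) u v q g sz'; have := Fyr (x :: p) u v q g sz' => /=.
  have szz h : (size (p ++ map (rho h) q) < m)%N.
    by rewrite size_cat size_map -sz.
  under eq_bigr => h _ do rewrite Ff /= //.
  move=> e1; under eq_bigr => h _ do rewrite Ff /= //.
  move=> e2.
  (* Both sides equal the double sum over [h] and [k] in which the commutators of x, y and of u, v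
     are both replaced by group elements. *)
  have e3 : \sum_h kap h x y * f (map (rho h) (p ++ u :: v :: q)) (h * g)%g
     - \sum_h kap h x y * f (map (rho h) (p ++ v :: u :: q)) (h * g)%g
     = \sum_h kap h u v * f (x :: y :: p ++ map (rho h) q) (h * g)%g
     - \sum_h kap h u v * f (y :: x :: p ++ map (rho h) q) (h * g)%g.
    rewrite -!sumrB.
    transitivity (\sum_h kap h x y * \sum_k kap k u v *
       f (map (rho h) (p ++ map (rho k) q)) (h * (k * g))%g).
      apply: eq_bigr => h _; rewrite -mulrBr !map_cat /= fr; last first.
        by rewrite !size_map ltnW // sz.
      congr (_ * _).
      rewrite (kap_conj_sum h g u v q (fun r => f (map (rho h) p ++ r))).
      by apply: eq_bigr => k _; rewrite map_cat.
    under eq_bigr => h _ do rewrite mulr_sumr.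
    rewrite exchange_big /=; apply: eq_bigr => k _.
    rewrite -mulrBr (fr [::]) /=; last by rewrite -ltnS; apply: szz.
    rewrite mulr_sumr; apply: eq_bigr => h _.
    by rewrite mulrCA.
  have e4 := congr2 +%R e2 (congr1 -%R (congr2 +%R e1 e3)).
  by apply: (eq_by_sub e4); rewrite /th; ring.
have thj x y z p g : (size p).+1 = m ->
    th x y g (z :: p) + th y z g (x :: p) + th z x g (y :: p) = 0.
  move=> sz.
  have [_ Fxr] := FP x; have [_ Fyr] := FP y; have [_ Fzr] := FP z.
  have sz' : ((size p).+2 <= m.+1)%N by rewrite ltnS sz.
  have := Fxr [::] y z p g sz'; have := Fyr [::] z x p g sz'.
  have := Fzr [::] x y p g sz' => /=.
  under eq_bigr => h _ do rewrite Ff ?size_map -?sz //.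
  move=> e1; under eq_bigr => h _ do rewrite Ff ?size_map -?sz //.
  move=> e2; under eq_bigr => h _ do rewrite Ff ?size_map -?sz //.
  move=> e3.
  (* By multilinearity the sides differ by terms with first letter [rho h z - z] and its cyclic
     analogues, which cancel by [kap_jacobi]. *)
  have e4 : \sum_h kap h x y * f (z :: map (rho h) p) (h * g)%g +
     \sum_h kap h z x * f (y :: map (rho h) p) (h * g)%g +
     \sum_h kap h y z * f (x :: map (rho h) p) (h * g)%g =
     \sum_h kap h x y * f (map (rho h) (z :: p)) (h * g)%g +
     \sum_h kap h z x * f (map (rho h) (y :: p)) (h * g)%g +
     \sum_h kap h y z * f (map (rho h) (x :: p)) (h * g)%g.
    rewrite -!big_split; apply: eq_bigr => h _ /=.
    have := kap_jacobi h x y z.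
    move/(congr1 (fun v => f ([::] ++ v :: map (rho h) p) (h * g)%g)).
    rewrite !(multilinearD _ _ _ _ (fl _)) !(multilinearZ _ _ _ _ (fl _)).
    rewrite !(multilinearB _ _ _ _ (fl _)) (multilinear0 _ _ (fl _)) /= => e4.
    by apply: (eq_by_sub (esym e4)); ring.
  have e5 := congr2 +%R (congr2 +%R (congr2 +%R e1 e2) e3) e4.
  by apply: (eq_by_sub e5); rewrite /th; ring.
(* In [sth] the homotopy returns [th x y] m + 2 times: twice from the summands removing the first
   letter, m times from the rest by closedness and Euler's identity. The sign makes [s] cancel the
   defect. *)
pose c : K := - (m.+2%:R)^-1.
pose s x g p : K := c * leibniz id (fun y r => on_size m (th x y g) r) p.
have ssym x g : symmetric_words (s x g).
  move=> p y z q; rewrite /s; congr (_ * _); apply: symmetric_leibniz.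
    by move=> v; apply: ths.
  move=> u v r; exact: addrC.
have smul x g : multilinear (s x g).
  move=> a u v p q; rewrite /s (@multilinear_leibniz _ _ idfun).
  - by ring.
  - by move=> b w z r; rewrite /on_size; case: ifP => _; rewrite ?thl // mulr0 addr0.
  - by move=> w; apply/multilinear_on_size/thm.
have sl a x y g p : s (a *: x + y) g p = a * s x g p + s y g p.
  rewrite /s (@eq_leibniz _ _ _ _ (fun v r => a * on_size m (th x v g) r
    + on_size m (th y v g) r)); first by rewrite leibniz_comb; ring.
  by move=> v r; rewrite /on_size; case: ifP => _; rewrite ?thl1 // mulr0 addr0.
have sth x y g p : size p = m -> s x g (y :: p) - s y g (x :: p) = - th x y g p.
  move=> sz; rewrite /s /=.
  have szE : on_size m (th x y g) p = th x y g p by rewrite /on_size sz eqxx.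
  have e : leibniz id (fun z r => on_size m (th x z g) (y :: r)) p
      - leibniz id (fun z r => on_size m (th y z g) (x :: r)) p
      = m%:R * th x y g p.
    have := leibniz_size p (ths x y g); rewrite sz szE => <-.
    rewrite -[X in _ - X]mul1r -mulNr addrC -leibniz_comb.
    apply: eq_leibniz => z r; rewrite /on_size /=; case: eqP => [szr|_]; last first.
      by rewrite mulr0 addr0.
    have := thj x y z r g szr; rewrite [th z x _ _]th_anti => ej.
    by apply: (eq_by_sub (esym ej)); ring.
  rewrite szE; have szE' : on_size m (th y x g) p = - th x y g p.
    by rewrite /on_size sz eqxx th_anti.
  rewrite szE'; have -> : c * (th x y g p + leibniz id (fun z r => on_size m (th x z g) (y :: r)) p) - c * (- th x y g p + leibniz id (fun z r => on_size m (th y z g) (x :: r)) p) =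
    c * (th x y g p *+ 2 + (leibniz id (fun z r => on_size m (th x z g) (y :: r)) p - leibniz id (fun z r => on_size m (th y z g) (x :: r)) p)) by ring.
  rewrite e; have -> : th x y g p *+ 2 + m%:R * th x y g p = m.+2%:R * th x y g p.
    by rewrite -[m.+2]addn2 natrD; ring.
  by rewrite mulrA /c mulNr mulVf ?mulN1r.
(* Only words of length m + 2 change. The symmetry of [s x] preserves the relations beyond the first
   letter, and [sth] repairs the one between the first two. *)
exists (fun p g => if p is x :: q then
    (if size q == m.+1 then F x q g + s x g q else f p g) else f p g).
split; last first.
  by case=> [|x q] g //= sz; case: eqP => // sz'; rewrite sz' ltnn in sz.
split=> [g a x y [|z p] q|[|z p] x y q g sz] /=.
- case: ifP => _; last exact: (fl g a x y [::] q).
  by rewrite Flin sl; ring.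
- rewrite !size_cat /=; case: ifP => _; last exact: (fl g a x y (z :: p) q).
  have [Fzl _] := FP z; have /= -> := Fzl g a x y p q.
  by rewrite smul; ring.
- have e := sth x y g q; rewrite /= in sz.
  case: (ltngtP (size q) m) => szq; [|by move: sz; rewrite !ltnS leqNgt szq|].
    rewrite !eqSS (ltn_eqF szq); rewrite (fr [::]) ?add0n //=.
    apply: eq_bigr => h _; case: (map _ q) (size_map (rho h) q) => //= z r szr.
    by rewrite (_ : (size r == m.+1) = false) //; apply/negbTE/eqP; lia.
  rewrite szq !eqxx; apply: (eq_by_sub (e szq)).
  have -> : \sum_h kap h x y * (fun p g => if p is x :: q then
    (if size q == m.+1 then F x q g + s x g q else f p g) else f p g) (map (rho h) q) (h * g)%g
    = \sum_h kap h x y * f (map (rho h) q) (h * g)%g.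
    apply: eq_bigr => h _; case: (map _ q) (size_map (rho h) q) => //= z r szr.
    by rewrite (_ : (size r == m.+1) = false) //; apply/negbTE/eqP; lia.
  by rewrite /th; ring.
- rewrite !size_cat /= !addnS; move: sz => /=; rewrite !addSn !ltnS => sz.
  case: eqP => sze; last first.
    rewrite (fr (z :: p)) //=; last by rewrite addSn; lia.
    apply: eq_bigr => h _; rewrite size_cat size_map.
    by rewrite (_ : (_ == m.+1) = false) //; apply/negbTE/eqP; lia.
  have [_ Fzr] := FP z; have ez := ssym z g p x y q.
  have := Fzr p x y q g; rewrite sze => /(_ (leqnn _)) ez'.
  rewrite ez opprD addrACA subrr addr0 ez'; apply: eq_bigr => h _.
  rewrite size_cat size_map (_ : (_ == m.+1) = false); last by apply/negbTE/eqP; lia.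
  by rewrite Ff // size_cat size_map ltnW.
Qed.

(** The induction hypothesis extends [f (b :: _)] for basis vectors [b] only. Other first letters
    are reached through coordinates, because independent choices for all vectors would not depend
    linearly on the letter. *)
Lemma pbw_extend n f : pbw_upto n f ->
  exists f', pbw_upto n.+1 f' /\ forall p g, (size p <= n)%N -> f' p g = f p g.
Proof.
elim: n f => [|n IH] f fP.
  by exists f; split=> //; split=> [|p x y q g //]; have [] := fP.
have ext (i : 'I_(\dim {:V})) : exists f', pbw_upto n.+1 f' /\
    (forall p g, (size p <= n)%N -> f' p g = f ((vbasis {:V})`_i :: p) g).
  exact/IH/pbw_upto_cons.
have [Fb FbP] := choice ext.
have [fl _] := fP.
apply: (@pbw_extend_step n f
  (fun x p g => \sum_i coord (vbasis {:V}) i x * Fb i p g)) => //.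
- move=> x; split=> [g a y z p q|p y z q g sz].
    rewrite mulr_sumr -big_split; apply: eq_bigr => i _ /=.
    by have [[Fl _] _] := FbP i; have /= -> := Fl g a y z p q; ring.
  rewrite -sumrB; under [RHS]eq_bigr => h _ do rewrite mulr_sumr.
  rewrite exchange_big /=; apply: eq_bigr => i _.
  have [[_ Fr] _] := FbP i; rewrite -mulrBr Fr // mulr_sumr.
  by apply: eq_bigr => h _; rewrite mulrCA.
- move=> a x y p g; rewrite mulr_sumr -big_split; apply: eq_bigr => i _ /=.
  by rewrite linearP /=; ring.
- move=> x p g sz; rewrite [in RHS](coord_vbasis (memvf x)).
  rewrite -[RHS]/(f ([::] ++ _ :: p) g) (multilinear_sum _ _ _ _ (fl g)).
  apply: eq_bigr => i _; rewrite (multilinearZ _ _ _ _ (fl g)).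
  by have [_ ->] := FbP i.
Qed.

End PBW.

(** * Reflections and the commutator coefficients *)

Section FiniteOrder.
Variables (K : fieldType) (V : vectType K).
Hypothesis charK : forall n, n.+1%:R != 0 :> K.

(** [pi] is the average of the powers of [h]. Averaging h^k - 1 = (h - 1)(1 + ... + h^(k-1)) over k
    gives pi - 1, so [c], minus the averaged second factor, inverts h - 1 up to [pi]. *)
Lemma finite_order_split (h : 'End(V)) m : (forall x, iter m.+1 h x = x) ->
  exists pi c : 'End(V), [/\ forall x, h (pi x) = pi x,
    forall x, h (c x) - c x = x - pi x, forall x, c (h x - x) = x - pi x,
    forall x, pi (h x) = pi x & forall x, h x = x -> pi x = x].
Proof.
move=> hm; pose hp k : 'End(V) := iter k (fun f => (h \o f)%VF) \1%VF.
have hpE k x : hp k x = iter k h x.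
  by elim: k => [|k IH]; rewrite /hp /= ?lfunE //= -[iter k _ _]/(hp k) IH.
pose a : K := m.+1%:R^-1.
have piE x : (a *: \sum_(k < m.+1) hp k) x = a *: \sum_(k < m.+1) iter k h x.
  by rewrite scale_lfunE sum_lfunE; congr (_ *: _); apply: eq_bigr.
have cE x : (- a *: \sum_(k < m.+1) \sum_(j < k) hp j) x =
    - a *: \sum_(k < m.+1) \sum_(j < k) iter j h x.
  rewrite scale_lfunE sum_lfunE; congr (_ *: _); apply: eq_bigr => k _.
  by rewrite sum_lfunE; apply: eq_bigr.
have hc k x : h (iter k h x) = iter k h (h x) by rewrite -iterS -iterSr.
have tele k x : h (\sum_(j < k) iter j h x) - \sum_(j < k) iter j h x
    = iter k h x - x.
  rewrite linear_sum -sumrB -(telescope_sumr (fun i => iter i h x) (leq0n k)).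
  by rewrite big_mkord; apply: eq_bigr.
have am x : a *: (x *+ m.+1) = x by rewrite -scaler_nat scalerA mulVf ?scale1r.
have avg x : - a *: \sum_(k < m.+1) (iter k h x - x)
    = x - a *: \sum_(k < m.+1) iter k h x.
  by rewrite sumrB sumr_const card_ord scalerBr !scaleNr am opprK addrC.
exists (a *: \sum_(k < m.+1) hp k), (- a *: \sum_(k < m.+1) \sum_(j < k) hp j).
have hpi x : h (\sum_(k < m.+1) iter k h x) = \sum_(k < m.+1) iter k h x.
  by apply/eqP; rewrite -subr_eq0 tele hm subrr.
split=> x.
- by rewrite !piE linearZ /= hpi.
- rewrite !cE linearZ /= -scalerBr linear_sum -sumrB piE -avg; congr (_ *: _).
  by apply: eq_bigr => k _; apply: tele.
- rewrite cE piE -avg; congr (_ *: _); apply: eq_bigr => k _.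
  rewrite -tele linear_sum -sumrB; apply: eq_bigr => j _.
  rewrite /= hc; elim: (nat_of_ord j) (x) => //= i IH y.
  by rewrite IH linearB.
- rewrite !piE; congr (_ *: _); rewrite -[RHS]hpi linear_sum.
  by apply: eq_bigr => k _; rewrite /= hc.
- move=> hx; rewrite piE -[RHS]am; congr (_ *: _).
  rewrite (eq_bigr (fun=> x)) ?sumr_const ?card_ord // => k _.
  by elim: (nat_of_ord k) => //= i ->.
Qed.
End FiniteOrder.

Section PlaneIdentity.
Variables (K : fieldType) (V : vectType K) (omega : {biscalar V}).
Hypothesis charK : forall n, n.+1%:R != 0 :> K.
Hypothesis omega_anti : form_antisymmetric omega.

Lemma form_self x : omega x x = 0.
Proof.
apply/eqP; have /eqP := omega_anti x x; rewrite -addr_eq0 -mulr2n -mulr_natl.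
by rewrite mulf_eq0 (negPf (charK 1)).
Qed.

(** The left side is alternating in three vectors of a plane. If one coefficient is nonzero, its
    pair of vectors is a basis in which the third expands; if all are zero, nothing is left. *)
Lemma plane_jacobi (U : {vspace V}) a b c : \dim U = 2 ->
    a \in U -> b \in U -> c \in U ->
  omega a b *: c + omega b c *: a + omega c a *: b = 0.
Proof.
move=> dU.
have key x y z : x \in U -> y \in U -> z \in U -> omega x y != 0 ->
    omega x y *: z + omega y z *: x + omega z x *: y = 0.
  move=> xU yU zU xy.
  have bas : basis_of U [:: x; y].
    rewrite basisEfree dU leqnn andbT; apply/andP; split; last first.
      by apply/span_subvP => t; rewrite !inE => /orP[]/eqP->.
    rewrite free_cons seq1_free span_seq1; apply/andP; split.
      apply: contra xy => /vlineP[k ->]; rewrite linearZl_LR /= form_self.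
      by rewrite mulr0.
    by apply: contra xy => /eqP->; rewrite linear0r.
  have : z \in <<[:: x; y]>>%VS by rewrite (span_basis bas).
  rewrite span_cons span_seq1 => /memv_addP[x' /vlineP[k ->] [y' /vlineP[l ->] ->]].
  rewrite linearDr linearDl /= !linearZr_LR !linearZl_LR /= !form_self.
  rewrite (omega_anti y x) !mulr0 add0r addr0 scalerDr !scalerA.
  rewrite -addrA addrACA -!scalerDl.
  have e u : omega x y * u + u * - omega x y = 0 by ring.
  by rewrite !e !scale0r addr0.
move=> aU bU cU.
have [ab0|ab] := eqVneq (omega a b) 0; last exact: key.
have [bc0|bc] := eqVneq (omega b c) 0; last first.
  by rewrite -(key b c a bU cU aU bc) addrC addrA addrAC -addrA addrC addrAC.
have [ca0|ca] := eqVneq (omega c a) 0; last first.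
  by rewrite -(key c a b cU aU bU ca) addrC addrA.
by rewrite ab0 bc0 ca0 !scale0r !addr0.
Qed.

End PlaneIdentity.

(** * Equivariance and Jacobi identity of the commutator coefficients *)

Section Kappa.
Variables (K : fieldType) (V : vectType K) (omega : {biscalar V}).
Variables (gT : finGroupType) (rho : gT -> 'End(V)) (eta : gT -> K).
Hypothesis charK : forall n, n.+1%:R != 0 :> K.
Hypothesis omega_anti : form_antisymmetric omega.
Hypothesis G_srg : symplectic_reflection_group omega rho.
Hypothesis eta_class : reflection_class_function rho eta.

Lemma srg_oneE x : rho 1%g x = x.
Proof. by rewrite (srg_one G_srg) lfunE. Qed.

Lemma srg_mulE g h x : rho (g * h)%g x = rho g (rho h x).
Proof. by rewrite (srg_mul G_srg) lfunE. Qed.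

Lemma srg_symplecticE g x y : omega (rho g x) (rho g y) = omega x y.
Proof. exact: (srg_symplectic G_srg). Qed.

Lemma srg_invK g x : rho g^-1%g (rho g x) = x.
Proof. by rewrite -srg_mulE mulVg srg_oneE. Qed.

Lemma srg_Kinv g x : rho g (rho g^-1%g x) = x.
Proof. by rewrite -srg_mulE mulgV srg_oneE. Qed.

Lemma srg_iter g k x : iter k (rho g) x = rho (g ^+ k)%g x.
Proof. by elim: k => [|k IH]; rewrite ?expg0 ?srg_oneE //= IH -srg_mulE expgS. Qed.

Definition moved_space r := limg (rho r - \1)%VF.
Definition fixed_space r := lker (rho r - \1)%VF.
Definition refl_proj r := daddv_pi (moved_space r) (fixed_space r).

Lemma fixed_spaceP r x : reflect (rho r x = x) (x \in fixed_space r).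
Proof.
rewrite memv_ker add_lfunE opp_lfunE id_lfunE subr_eq0.
exact: eqP.
Qed.

Lemma moved_spaceP r x : reflect (exists y, x = rho r y - y) (x \in moved_space r).
Proof.
apply: (iffP memv_imgP) => [[y _ ->]|[y ->]]; exists y; rewrite ?memvf //.
  by rewrite add_lfunE opp_lfunE id_lfunE.
by rewrite add_lfunE opp_lfunE id_lfunE.
Qed.

Lemma srg_split r :
  exists pi c : 'End(V), [/\ forall x, rho r (pi x) = pi x,
    forall x, rho r (c x) - c x = x - pi x, forall x, c (rho r x - x) = x - pi x,
    forall x, pi (rho r x) = pi x & forall x, rho r x = x -> pi x = x].
Proof.
apply: (finite_order_split charK (m := #[r]%g.-1)) => x.
by rewrite srg_iter prednK ?order_gt0 // expg_order srg_oneE.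
Qed.

Lemma moved_fixed_cap r : (moved_space r :&: fixed_space r = 0)%VS.
Proof.
have [pi [c [_ _ _ pir pifix]]] := srg_split r.
apply/eqP; rewrite -subv0; apply/subvP => x; rewrite memv_cap memv0.
case/andP=> /moved_spaceP[y ->] /fixed_spaceP/pifix.
by rewrite linearB /= pir subrr => <-.
Qed.

Lemma refl_proj_moved r x : refl_proj r x \in moved_space r.
Proof. exact: memv_pi. Qed.

Lemma refl_projP r x u : u \in moved_space r -> x - u \in fixed_space r ->
  refl_proj r x = u.
Proof.
move=> uM xuF; rewrite /refl_proj -[X in daddv_pi _ _ X](subrK u) linearD /=.
have cap := moved_fixed_cap r.
have cap' : (fixed_space r :&: moved_space r = 0)%VS by rewrite capvC.
rewrite (daddv_pi_id cap uM).
have xuS : x - u \in (moved_space r + fixed_space r)%VS.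
  by apply: subvP xuF; apply: addvSr.
have := daddv_pi_add cap xuS; rewrite (daddv_pi_id cap' xuF).
by move/(canRL (addrK _)); rewrite subrr => ->; rewrite add0r.
Qed.

Lemma refl_proj_fixed r x : x - refl_proj r x \in fixed_space r.
Proof.
have [pi [c [pifix ce _ _ _]]] := srg_split r.
rewrite (@refl_projP r x (x - pi x)) ?subKr; first exact/fixed_spaceP.
  by apply/moved_spaceP; exists (c x).
exact/fixed_spaceP.
Qed.

Lemma refl_proj_conj r k x :
  refl_proj r (rho k x) = rho k (refl_proj (r ^ k)%g x).
Proof.
have conjE y : rho r (rho k y) = rho k (rho (r ^ k)%g y).
  by rewrite -!srg_mulE conjgE !mulgA mulgV mul1g.
apply: refl_projP; last first.
  apply/fixed_spaceP; rewrite -linearB conjE /=.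
  by have /fixed_spaceP -> := refl_proj_fixed (r ^ k)%g x.
have /moved_spaceP[y ->] := refl_proj_moved (r ^ k)%g x.
by apply/moved_spaceP; exists (rho k y); rewrite conjE linearB.
Qed.

Lemma omega_reflE r x y :
  omega_refl omega rho r x y = omega (refl_proj r x) (refl_proj r y).
Proof. by []. Qed.

Lemma omega_refl_conj r k x y : omega_refl omega rho r (rho k x) (rho k y) =
  omega_refl omega rho (r ^ k)%g x y.
Proof. by rewrite !omega_reflE !refl_proj_conj srg_symplecticE. Qed.

Lemma is_reflection_conj r k : is_reflection rho (r ^ k)%g = is_reflection rho r.
Proof.
rewrite /is_reflection.
suff le s l : (\dim (moved_space (s ^ l)%g) <= \dim (moved_space s))%N.
  rewrite -/(moved_space r) -/(moved_space (r ^ k)%g).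
  rewrite (_ : \dim _ = \dim (moved_space r)) //.
  by apply/eqP; rewrite eqn_leq le -{1}[r](conjgK k) le.
have -> : moved_space (s ^ l)%g = (rho l^-1%g @: moved_space s)%VS.
  apply/vspaceP => x; apply/idP/idP.
    case/moved_spaceP=> y ->; apply/memv_imgP; exists (rho s (rho l y) - rho l y).
      by apply/moved_spaceP; exists (rho l y).
    by rewrite linearB /= srg_invK conjgE !srg_mulE.
  case/memv_imgP=> y /moved_spaceP[z ->] ->; apply/moved_spaceP.
  by exists (rho l^-1%g z); rewrite linearB /= conjgE !srg_mulE srg_Kinv.
by rewrite -[leqRHS](limg_ker_dim (rho l^-1%g)) leq_addl.
Qed.

Lemma refl1F : is_reflection rho 1%g = false.
Proof.
rewrite /is_reflection -/(moved_space 1%g) (_ : moved_space _ = 0%VS) ?dimv0 //.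
apply/eqP; rewrite -subv0; apply/subvP => x /moved_spaceP[y ->].
by rewrite srg_oneE subrr mem0v.
Qed.

(** Writes the whole relation for [x, y] as a single sum over the group: the term [omega x y] is the
    coefficient of the unit, which is never a reflection. *)
Definition kappa h x y : K :=
  if h == 1%g then omega x y
  else if is_reflection rho h then eta h * omega_refl omega rho h x y else 0.

Lemma kappa_sum (Z : lmodType K) x y (E : gT -> Z) :
  \sum_h kappa h x y *: E h = omega x y *: E 1%g +
    \sum_(r | is_reflection rho r) (eta r * omega_refl omega rho r x y) *: E r.
Proof.
rewrite (bigD1 1%g) //= {1}/kappa eqxx; congr (_ + _).
rewrite [LHS]big_mkcond [RHS]big_mkcond; apply: eq_bigr => h _ /=.
rewrite /kappa; have [->|] := eqVneq h 1%g; first by rewrite refl1F.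
by case: ifP => _; rewrite ?scale0r.
Qed.

Lemma kappa_linear h a x y z :
  kappa h (a *: x + y) z = a * kappa h x z + kappa h y z.
Proof.
rewrite /kappa; case: eqP => _; first by rewrite linearPl.
case: ifP => _; rewrite ?mulr0 ?addr0 // !omega_reflE linearP linearPl /=.
by ring.
Qed.

Lemma kappa_anti h x y : kappa h x y = - kappa h y x.
Proof.
rewrite /kappa; case: eqP => _ //; case: ifP => _; rewrite ?oppr0 // !omega_reflE.
by rewrite omega_anti mulrN.
Qed.

Lemma kappa_conj k h x y : kappa h (rho k x) (rho k y) = kappa (h ^ k)%g x y.
Proof.
rewrite /kappa conjg_eq1; case: eqP => _; first exact: srg_symplecticE.
by rewrite is_reflection_conj; case: ifP => // /eta_class ->; rewrite omega_refl_conj.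
Qed.

(** For a reflection, h - 1 sees only the components in the plane V_h, so the identity is the image
    of [plane_jacobi] under h - 1. It expresses the Jacobi identity for three vectors in the
    algebra. *)
Lemma kappa_jacobi h x y z :
  kappa h x y *: (rho h z - z) + kappa h y z *: (rho h x - x)
  + kappa h z x *: (rho h y - y) = 0.
Proof.
rewrite /kappa; case: eqP => [->|_]; first by rewrite !srg_oneE !subrr !scaler0 !addr0.
case: ifP => [rh|_]; last by rewrite !scale0r !addr0.
pose D : 'End(V) := (rho h - \1)%VF.
have DE u : rho h u - u = D (refl_proj h u).
  have /fixed_spaceP := refl_proj_fixed h u; rewrite linearB /= => e.
  rewrite /D add_lfunE opp_lfunE id_lfunE; apply: (eq_by_sub e).
  by rewrite !opprB addrCA [RHS]addrCA addrAC.
rewrite !omega_reflE -!scalerA -!scalerDr !DE.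
have := plane_jacobi charK omega_anti (eqP rh) (refl_proj_moved h x)
  (refl_proj_moved h y) (refl_proj_moved h z).
move=> e; transitivity (eta h *: D 0); last by rewrite linear0 scaler0.
by rewrite -e !linearD !linearZ.
Qed.

End Kappa.

(** * Functionals on the algebra *)

Section Functionals.
Variables (K : fieldType) (V : vectType K) (omega : {biscalar V}).
Variables (gT : finGroupType) (rho : gT -> 'End(V)) (eta : gT -> K).
Hypothesis charK : forall n, n.+1%:R != 0 :> K.
Hypothesis omega_anti : form_antisymmetric omega.
Hypothesis G_srg : symplectic_reflection_group omega rho.
Hypothesis eta_class : reflection_class_function rho eta.

Local Notation A := (sra omega rho eta).
Local Notation expr := (sra_expr K V gT).
Local Notation vec := (sra_vec omega rho eta).
Local Notation grp := (sra_grp omega rho eta).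
Local Notation kappa := (kappa omega rho eta).

Definition word (p : seq V) : A := \prod_(x <- p) vec x.

Lemma word_cons x p : word (x :: p) = vec x * word p.
Proof. exact: big_cons. Qed.

Lemma word_nil : word [::] = 1.
Proof. exact: big_nil. Qed.

Lemma word_cat p q : word (p ++ q) = word p * word q.
Proof. exact: big_cat. Qed.

Lemma sra_vec_is_linear : linear vec.
Proof. exact: sra_vecP. Qed.

HB.instance Definition _ := GRing.isLinear.Build K V A _ vec sra_vec_is_linear.

Lemma grp_word g p : grp g * word p = word (map (rho g) p) * grp g.
Proof.
elim: p => [|x p IH]; first by rewrite /= word_nil mulr1 mul1r.
by rewrite /= !word_cons mulrA sra_grp_vec -!mulrA IH.
Qed.

Lemma vec_comm x y : vec x * vec y - vec y * vec x = \sum_h kappa h x y *: grp h.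
Proof. by rewrite sra_vec_comm (kappa_sum _ G_srg) sra_grp1. Qed.

Definition pbw f := forall n, pbw_upto rho kappa n f.

(* If f represents the functional F then act e f represents F (e * _). *)
Fixpoint act (e : expr) (f : seq V -> gT -> K) : seq V -> gT -> K :=
  match e with
  | Scal a => fun p g => a * f p g
  | Vec x => fun p => f (x :: p)
  | Grp h => fun p g => f (map (rho h) p) (h * g)%g
  | Sum e1 e2 => fun p g => act e1 f p g + act e2 f p g
  | Prod e1 e2 => act e2 (act e1 f)
  end.

Lemma pbw_act e f : pbw f -> pbw (act e f).
Proof.
elim: e f => [a|x|h|e1 IH1 e2 IH2|e1 IH1 e2 IH2] f fP n //=.
- have [fl fr] := fP n; split=> [g b x y p q|p x y q g sz].
    by have /= -> := fl g b x y p q; ring.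
  rewrite -mulrBr fr // mulr_sumr; apply: eq_bigr => h _; exact: mulrCA.
- by apply/pbw_upto_cons/fP.
- have [fl fr] := fP n; split=> [g b x y p q|p x y q g sz].
    exact: (multilinear_map (rho h) (fl _)).
  rewrite !map_cat /= fr ?size_map //.
  rewrite (kap_conj_sum (srg_mulE G_srg) (kappa_conj charK G_srg eta_class)
    h g x y q (fun r => f (map (rho h) p ++ r))).
  by apply: eq_bigr => k _; rewrite map_cat.
- have [f1l f1r] := IH1 f fP n; have [f2l f2r] := IH2 f fP n.
  split=> [g b x y p q|p x y q g sz].
    by have /= -> := f1l g b x y p q; have /= -> := f2l g b x y p q; ring.
  rewrite opprD addrACA f1r // f2r // -big_split.
  by apply: eq_bigr => h _; rewrite mulrDr.
- exact/IH2/IH1.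
Qed.

Lemma pbw_multilinear f g : pbw f -> multilinear (f^~ g).
Proof. by move=> /(_ 0%N)[fl _]; apply: fl. Qed.

Lemma act_scale e a f p g :
  act e (fun p g => a * f p g) p g = a * act e f p g.
Proof.
elim: e f p g => /= [b|x|h|e1 IH1 e2 IH2|e1 IH1 e2 IH2] f p g //.
- by ring.
- by rewrite IH1 IH2 mulrDr.
- rewrite -IH2; congr (act e2 _ p g); apply/funext=> q; apply/funext=> h.
  exact: IH1.
Qed.

(** On [pbw] functions all defining relations act trivially, so [act] is the right action of the
    algebra on functionals. Hence [act e f [::] 1] depends only on the class of [e], which yields
    [pbw_functional]. *)
Lemma act_eq e e' : sra_eq omega rho eta e e' ->
  forall f, pbw f -> act e f = act e' f.
Proof.
elim=> {e e'} /=.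
- by [].
- by move=> e f _ IH k /IH.
- by move=> e f g _ IH1 _ IH2 k kP; rewrite IH1 // IH2.
- by move=> e e' f f' _ IH1 _ IH2 k kP; rewrite IH1 // IH2.
- by move=> e e' f f' _ IH1 _ IH2 k kP; rewrite IH1 // IH2 //; apply: pbw_act.
- by move=> e f g k _; apply/funext=> p; apply/funext=> h; rewrite addrA.
- by move=> e f k _; apply/funext=> p; apply/funext=> h; rewrite addrC.
- by move=> e k _; apply/funext=> p; apply/funext=> h; rewrite mul0r add0r.
- move=> e k kP; apply/funext=> p; apply/funext=> g; rewrite mul0r.
  by rewrite act_scale mulN1r addNr.
- by [].
- by move=> e k _; congr act; apply/funext=> p; apply/funext=> h; rewrite mul1r.
- by move=> e k _; apply/funext=> p; apply/funext=> h; rewrite mul1r.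
- move=> e f g k kP; apply/funext=> p; apply/funext=> h.
  elim: g (act e k) (act f k) p h => /= [a|x|s|e1 IH1 e2 IH2|e1 IH1 e2 IH2] u v p h //.
  + by ring.
  + by rewrite IH1 IH2; ring.
  + rewrite -IH2; congr (act e2 _ p h); apply/funext=> p'; apply/funext=> h'.
    exact: IH1.
- by [].
- by move=> a b k _; apply/funext=> p; apply/funext=> h; rewrite mulrDl.
- by move=> a b k _; apply/funext=> p; apply/funext=> h; ring.
- by move=> a e k _; apply/funext=> p; apply/funext=> h; rewrite act_scale.
- move=> a x y k kP; apply/funext=> p; apply/funext=> h.
  by have /= -> := pbw_multilinear h kP a x y [::] p.
- move=> k _; apply/funext=> p; apply/funext=> h; rewrite mul1g mul1r.
  by rewrite (eq_map (srg_oneE G_srg)) map_id.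
- move=> g h k _; apply/funext=> p; apply/funext=> s.
  rewrite -map_comp mulgA; congr k.
  by apply: eq_map => x /=; rewrite (srg_mulE G_srg).
- by [].
- move=> x y k kP; apply/funext=> p; apply/funext=> g.
  have [_ kr] := kP (size p).+2.
  have /= e1 := kr [::] x y p g (leqnn _).
  rewrite mulN1r e1.
  have -> : act (\big[Sum (gT:=gT)/Scal 0]_(r | is_reflection rho r)
     Prod (Scal (eta r * omega_refl omega rho r x y)) (Grp r)) k p g =
     \sum_(r | is_reflection rho r) (eta r * omega_refl omega rho r x y)
       * k (map (rho r) p) (r * g)%g.
    apply: (big_morph (fun e => act e k p g)) => //=; first by rewrite mul0r.
  have := kappa_sum eta G_srg x y (fun h => k (map (rho h) p) (h * g)%g : K^o).
  move=> ->; rewrite mul1g; congr (_ * k _ _ + _).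
  by rewrite (eq_map (srg_oneE G_srg)) map_id.
Qed.

Lemma pbw_functional f : pbw f ->
  exists F : {scalar A}, forall p g, F (word p * grp g) = f p g.
Proof.
move=> fP; pose F0 k (a : A) := act (sra_repr a) k [::] 1%g.
have F0pi k e : pbw k -> F0 k (sra_pi omega rho eta e) = act e k [::] 1%g.
  by move=> kP; rewrite /F0 (act_eq (sra_repr_pi omega rho eta e)).
have F0_lin k : pbw k -> linear_for *%R (F0 k).
  move=> kP a x y; rewrite -[x]sra_reprK -[y]sra_reprK sra_scaleE -sra_piM -sra_piD.
  rewrite !F0pi //=; congr (_ + _).
  exact: act_scale.
have F0word k p g : pbw k -> F0 k (word p * grp g) = k p g.
  elim: p k => [|x p IH] k kP; first by rewrite word_nil mul1r F0pi //= mulg1.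
  rewrite word_cons -mulrA -[word p * grp g]sra_reprK -sra_piM F0pi //=.
  rewrite -[act _ _ _ _]/(F0 (fun p => k (x :: p)) (word p * grp g)) IH //.
  exact: (@pbw_act (Vec x)).
pose F : {scalar A} := HB.pack (F0 f) (GRing.isLinear.Build _ _ _ _ _ (F0_lin f fP)).
by exists F => p g; apply: F0word.
Qed.

(** Dependent choice followed by a diagonal: the value at [p] is read off at stage [size p], where
    it is final because k <= b k. The bound [b k] is k + n for PBW and 2k for traces. *)
Lemma wordfun_limit (P : nat -> (seq V -> gT -> K) -> Prop) (b : nat -> nat) f0 :
    (forall k, k <= b k)%N -> (forall k, b k <= b k.+1)%N -> P 0%N f0 ->
    (forall k f, P k f -> exists f', P k.+1 f' /\
       (forall p g, (size p <= b k)%N -> f' p g = f p g)) ->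
  exists f, (forall p g, (size p <= b 0)%N -> f p g = f0 p g) /\
    (forall k, exists f', P k f' /\
       (forall p g, (size p <= b k)%N -> f p g = f' p g)).
Proof.
move=> kb bmono P0 step.
have next k (f : {f | P k f}) : {f' : {f | P k.+1 f} |
    forall p g, (size p <= b k)%N -> sval f' p g = sval f p g}.
  case: f => f fP; have [f' [f'P ff']] := cid (step k f fP).
  by exists (exist _ f' f'P).
pose fs := fix fs k : {f | P k f} :=
  if k is k'.+1 then sval (next k' (fs k')) else exist _ f0 P0.
have fsS k p g : (size p <= b k)%N -> sval (fs k.+1) p g = sval (fs k) p g.
  by move=> sz; rewrite /= (svalP (next k (fs k))).
have bm k l : (b k <= b (k + l))%N.
  by elim: l => [|l IH]; rewrite ?addn0 // addnS (leq_trans IH).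
have fsD k l p g : (size p <= b k)%N -> sval (fs (k + l)%N) p g = sval (fs k) p g.
  move=> sz; elim: l => [|l IH]; first by rewrite addn0.
  by rewrite addnS fsS // (leq_trans sz).
exists (fun p g => sval (fs (size p)) p g); split=> [p g sz|k].
  by rewrite -[size p]add0n fsD.
exists (sval (fs k)); split=> [|p g sz]; first exact: svalP.
have [le|/ltnW le] := leqP (size p) k; last by rewrite -(subnKC le) fsD.
by rewrite -(subnKC le) fsD.
Qed.

(** A symmetric symbol supported in length [n] satisfies the relations up to that length, since a
    commutator leads to shorter words, where the function is 0. [pbw_extend] then continues it to
    all lengths. *)
Lemma symbol_functional n (s : seq V -> K) g :
    multilinear s -> symmetric_words s ->
  exists F : {scalar A}, forall p h, (size p <= n)%N ->
    F (word p * grp h) = if (size p == n) && (h == g) then s p else 0.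
Proof.
move=> sm ss; pose f0 p h := if (size p == n) && (h == g) then s p else 0.
have f0P : pbw_upto rho kappa n f0.
  split=> [h a x y p q|p x y q h sz].
    rewrite /f0 !size_cat /=; case: ifP => _; first exact: sm.
    by rewrite mulr0 addr0.
  rewrite /f0 !size_cat /= ss subrr big1 // => k _.
  rewrite size_cat size_map (_ : (_ == n) = false) ?mulr0 //.
  by apply/negbTE/eqP; lia.
have := @wordfun_limit (fun k => pbw_upto rho kappa (k + n)) (fun k => k + n)%N f0.
case.
- by move=> k; rewrite leq_addr.
- by move=> k; rewrite leq_add2r.
- exact: f0P.
- move=> k f fP; have [] := pbw_extend charK (srg_mulE G_srg)
    (kappa_linear omega rho eta) (kappa_anti rho eta omega_anti)
    (kappa_conj charK G_srg eta_class) (kappa_jacobi eta charK omega_anti G_srg) fP.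
  by move=> f' f'P; exists f'.
move=> f [ff0 fk]; have fP : pbw f.
  move=> k; split=> [h a x y p q|p x y q h sz].
    have [f' [[f'l _] ff']] := fk (size (p ++ x :: q)).
    by rewrite !ff' ?f'l // !size_cat /= leq_addr.
  have [f' [[_ f'r] ff']] := fk k.
  have le m : (m <= k)%N -> (m <= k + n)%N by move=> /leq_trans; apply; rewrite leq_addr.
  rewrite !ff' ?size_cat /= ?addnS ?le // f'r ?le //; apply: eq_bigr => l _.
  by rewrite ff' // size_cat size_map le // ltnW // ltnW.
have [F FE] := pbw_functional fP; exists F => p h sz.
by rewrite FE ff0.
Qed.

Lemma sra_span (a : A) : exists t : seq (K * (seq V * gT)),
  a = \sum_(c <- t) c.1 *: (word c.2.1 * grp c.2.2).
Proof.
rewrite -[a]sra_reprK; elim: (sra_repr a) => [c|x|h|e1 [t1 IH1] e2 [t2 IH2]|e1 [t1 IH1] e2 [t2 IH2]].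
- by exists [:: (c, ([::], 1%g))]; rewrite big_seq1 /= word_nil sra_grp1 mulr1 sra_pi_scal.
- by exists [:: (1, ([:: x], 1%g))]; rewrite big_seq1 /= word_cons word_nil sra_grp1 !mulr1 scale1r.
- by exists [:: (1, ([::], h))]; rewrite big_seq1 /= word_nil mul1r scale1r.
- by exists (t1 ++ t2); rewrite sra_piD IH1 IH2 big_cat.
exists [seq (c.1 * d.1, (c.2.1 ++ map (rho c.2.2) d.2.1, (c.2.2 * d.2.2)%g)) | c <- t1, d <- t2].
rewrite sra_piM IH1 IH2 big_allpairs_dep mulr_suml; apply: eq_bigr => c _.
rewrite mulr_sumr; apply: eq_bigr => d _ /=.
rewrite -sra_scaleAl -sra_scaleAr scalerA; congr (_ *: _).
by rewrite word_cat sra_grpM -!mulrA; congr (_ * _); rewrite !mulrA grp_word.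
Qed.

Lemma sra_ind (P : A -> Prop) :
    (forall a x y, P x -> P y -> P (a *: x + y)) -> P 0 ->
    (forall p g, P (word p * grp g)) -> forall a, P a.
Proof.
move=> PD P0 Pw a; have [t ->] := sra_span a.
by elim: t => [|c t IH]; rewrite ?big_nil // big_cons; apply: PD.
Qed.

End Functionals.

(** * Construction of twisted traces *)

Section Traces.
Variables (K : fieldType) (V : vectType K) (omega : {biscalar V}).
Variables (gT : finGroupType) (rho : gT -> 'End(V)) (eta : gT -> K).
Hypothesis charK : forall n, n.+1%:R != 0 :> K.
Hypothesis omega_anti : form_antisymmetric omega.
Hypothesis omega_nondeg : form_nondegenerate omega.
Hypothesis G_srg : symplectic_reflection_group omega rho.
Hypothesis eta_class : reflection_class_function rho eta.
Variable eps : K.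
Hypothesis eps2 : eps * eps = 1.

Local Notation A := (sra omega rho eta).
Local Notation vec := (sra_vec omega rho eta).
Local Notation grp := (sra_grp omega rho eta).
Local Notation kappa := (kappa omega rho eta).
Local Notation word := (word omega rho eta).
Implicit Types (F : {scalar A}) (p q r : seq V).

Lemma scalarMl F a (x y : A) : F (a *: x * y) = a * F (x * y).
Proof. by rewrite -sra_scaleAl linearZ. Qed.

Lemma scalarMr F a (x y : A) : F (x * (a *: y)) = a * F (x * y).
Proof. by rewrite -sra_scaleAr linearZ. Qed.

(* The sign eps = 1 corresponds to traces and eps = -1 to supertraces: moving
   a vector around an odd word multiplies the functional by eps. *)
Definition twist g : 'End(V) := eps *: rho g.

Lemma twistE g x : twist g x = eps *: rho g x.
Proof. by rewrite scale_lfunE. Qed.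

Lemma grp_vec_twist g x : grp g * vec x = eps *: (vec (twist g x) * grp g).
Proof. by rewrite sra_grp_vec twistE linearZ /= -sra_scaleAl scalerA eps2 scale1r. Qed.

Lemma twist_symplectic g x y : omega (twist g x) (twist g y) = omega x y.
Proof.
by rewrite !twistE linearZr_LR linearZl_LR /= mulrA eps2 mul1r (srg_symplecticE G_srg).
Qed.

Definition twist_fixed g : pred V := fun x => twist g x == x.
Definition twist_fixed_space g := lker (twist g - \1)%VF.

Lemma twist_fixed_spaceE g x : (x \in twist_fixed_space g) = twist_fixed g x.
Proof. by rewrite memv_ker add_lfunE opp_lfunE id_lfunE subr_eq0. Qed.

Lemma twist_split g :
  exists pi c : 'End(V), [/\ forall x, twist g (pi x) = pi x,
    forall x, twist g (c x) - c x = x - pi x,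
    forall x, c (twist g x - x) = x - pi x,
    forall x, pi (twist g x) = pi x & forall x, twist g x = x -> pi x = x].
Proof.
(* Twice the order of [g] also removes the sign, because eps^2 = 1. *)
apply: (finite_order_split charK (m := (#[g]%g * 2)%N.-1)) => x.
rewrite prednK ?muln_gt0 ?order_gt0 //.
have -> k : iter k (twist g) x = eps ^+ k *: rho (g ^+ k)%g x.
  elim: k => [|k IH]; first by rewrite expr0 expg0 scale1r (srg_oneE G_srg).
  by rewrite /= IH twistE linearZ /= scalerA exprS expgS (srg_mulE G_srg).
rewrite expgM expg_order expg1n (srg_oneE G_srg) mulnC exprM expr2 eps2.
by rewrite expr1n scale1r.
Qed.

Definition comm (a b : A) : A := a * b - b * a.

Definition conj_invariant F := forall h a, F (grp h * a) = F (a * grp h).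

Definition trace_upto n F := forall v p g, odd (size p) -> (size p < n)%N ->
  F (vec v * word p * grp g) = eps * F (word p * grp g * vec v).

(* The obstruction to extending F at g from words of length n to n + 2. *)
Definition closed_on_fixed n F g := forall v p, twist_fixed g v ->
  all (twist_fixed g) p -> size p = n.+1 -> F (comm (word p) (vec v) * grp g) = 0.

Lemma conj_invariant_comm F x y a : conj_invariant F ->
  F (comm (vec x) (vec y) * a) = F (a * comm (vec x) (vec y)).
Proof.
move=> Fi; rewrite /comm (vec_comm _ G_srg) mulr_suml mulr_sumr !linear_sum.
by apply: eq_bigr => h _; rewrite /= scalarMl scalarMr Fi.
Qed.

Lemma grp_comm_twist g x y : grp g * comm (vec x) (vec y) =
  comm (vec (twist g x)) (vec (twist g y)) * grp g.
Proof.
have e u v : grp g * (vec u * vec v) = vec (twist g u) * vec (twist g v) * grp g.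
  rewrite mulrA grp_vec_twist -sra_scaleAl -mulrA grp_vec_twist -sra_scaleAr.
  by rewrite scalerA eps2 scale1r !mulrA.
by rewrite /comm mulrBr !e mulrBl.
Qed.

(** * The defect of the trace property and its integrability conditions *)

(** Adding a symmetric [s] to [F] at [g] lowers this defect by [s ((twist g v - v) :: p)], so [s]
    has to match it. *)
Definition beta F g v p : K :=
  F (vec v * word p * grp g) - eps * F (word p * grp g * vec v).

Lemma betaE F g v p : beta F g v p =
  F (vec v * word p * grp g) - F (word p * vec (twist g v) * grp g).
Proof. by rewrite /beta -!mulrA grp_vec_twist scalarMr [eps * (eps * _)]mulrA eps2 mul1r. Qed.

Lemma beta_linear F g a x y p :
  beta F g (a *: x + y) p = a * beta F g x p + beta F g y p.
Proof.
rewrite /beta linearP !mulrDl !mulrDr -!sra_scaleAl -!sra_scaleAr.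
by rewrite !linearD !linearZ /=; ring.
Qed.

Lemma word_multilinear a x y p q : word (p ++ (a *: x + y) :: q) =
  a *: word (p ++ x :: q) + word (p ++ y :: q).
Proof.
rewrite !word_cat !word_cons linearP /= mulrDl mulrDr.
by rewrite -sra_scaleAl -sra_scaleAr.
Qed.

Lemma multilinear_beta F g v : multilinear (beta F g v).
Proof.
move=> a x y p q; rewrite /beta word_multilinear !mulrDl !mulrDr !mulrDl.
rewrite -?(sra_scaleAl, sra_scaleAr) !linearD !linearZ /=; ring.
Qed.

Lemma word_mid p x y q :
  word (p ++ x :: y :: q) - word (p ++ y :: x :: q) =
  \sum_h kappa h x y *: (word (p ++ map (rho h) q) * grp h).
Proof.
rewrite !word_cat !word_cons !mulrA -!mulrBl -[_ * _ * _]mulrA -[X in _ - X]mulrA.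
rewrite -mulrBr (vec_comm _ G_srg) mulr_sumr mulr_suml; apply: eq_bigr => h _.
by rewrite -sra_scaleAr -sra_scaleAl word_cat -!mulrA grp_word.
Qed.

(** Exchanging two letters leaves words of length n - 1 followed by a group element. These are odd
    and shorter than [n], so their defect is already 0. *)
Lemma beta_symmetric n F g v : odd n = false ->
  trace_upto n F -> symmetric_words (on_size n.+1 (beta F g v)).
Proof.
move=> n_even Ft; apply: symmetric_on_size => p x y q sz.
apply/eqP; rewrite -subr_eq0 /beta.
set w1 := word _; set w2 := word (p ++ y :: _).
have -> : F (vec v * w1 * grp g) - eps * F (w1 * grp g * vec v) -
  (F (vec v * w2 * grp g) - eps * F (w2 * grp g * vec v)) =
  F (vec v * (w1 - w2) * grp g) - eps * F ((w1 - w2) * grp g * vec v).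
  by rewrite mulrBr !mulrBl !linearB /=; ring.
rewrite word_mid mulr_sumr !mulr_suml !linear_sum mulr_sumr -sumrB big1 // => h _.
rewrite /= -sra_scaleAr -!sra_scaleAl !linearZ /= -!mulrA -sra_grpM !mulrA.
rewrite -[_ * grp h * grp g]mulrA -sra_grpM Ft ?mulrA; first by ring.
  rewrite size_cat size_map; have /(congr1 odd) := sz; rewrite /= n_even negbK.
  by move=> ->.
by rewrite size_cat size_map -ltnS -sz.
Qed.


Lemma perm_rot_head (x : V) p q : perm_eq (x :: p ++ q) (p ++ x :: q).
Proof. by rewrite perm_sym -cat1s perm_catCA. Qed.

Lemma beta_perm n F g v p q : odd n = false -> trace_upto n F ->
  size p = n.+1 -> perm_eq p q -> beta F g v p = beta F g v q.
Proof.
move=> n_even Ft sz pq; have := symmetric_perm (beta_symmetric g v n_even Ft) pq.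
by rewrite /on_size sz -(perm_size pq) sz eqxx.
Qed.

(** With h = [twist g], conjugation invariance lets [x, y], an element of the group algebra, travel
    around the word: F (p [hx, hy] g) = F (p g [x, y]) = F ([x, y] p g). Expanded, this is the
    symmetry that the desired [s] has on two letters of Im (h - 1). *)
Lemma beta_swap n F g x y p : odd n = false -> conj_invariant F ->
    trace_upto n F -> size p = n ->
  beta F g x ((twist g y - y) :: p) = beta F g y ((twist g x - x) :: p).
Proof.
move=> n_even Fi Ft sz.
have bB u v w : beta F g u ((v - w) :: p) = beta F g u (v :: p) - beta F g u (w :: p).
  exact: (multilinearB [::] p v w (multilinear_beta F g u)).
have szs z : size (z :: p) = n.+1 by rewrite /= sz.
have rot u z : beta F g u (z :: p) = beta F g u (p ++ [:: z]).
  by apply: (beta_perm g u n_even Ft) => //; rewrite -{1}[p]cats0 perm_rot_head.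
have Fc : F (word p * comm (vec (twist g x)) (vec (twist g y)) * grp g) =
    F (comm (vec x) (vec y) * (word p * grp g)).
  by rewrite -mulrA -grp_comm_twist conj_invariant_comm // -mulrA.
rewrite !bB !(rot _ (twist g _)) !betaE !word_cat !word_cons !word_nil !mulr1.
move: Fc; rewrite /comm !mulrBr !mulrBl !linearB /= !mulrA => Fc.
by apply: (eq_by_sub Fc); ring.
Qed.

(** This is forced by the equation for [s], as (twist g - 1) v = 0. Each letter of [p] splits into a
    fixed part, left to [closed_on_fixed], and a part in Im (twist g - 1), which [beta_swap] trades
    for (twist g - 1) v. *)
Lemma beta_fixed0 n F g v p : odd n = false -> conj_invariant F ->
    trace_upto n F -> closed_on_fixed n F g -> twist_fixed g v ->
    size p = n.+1 -> beta F g v p = 0.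
Proof.
move=> n_even Fi Ft Fc gv; have [pi [c [pifix ce _ _ _]]] := twist_split g.
suff H q : forall r, all (twist_fixed g) r -> size (r ++ q) = n.+1 ->
    beta F g v (r ++ q) = 0 by exact: (H p [::]).
elim: q => [|x q IH] r rfix.
  rewrite cats0 => sz; rewrite betaE (eqP gv).
  by have := Fc v r gv rfix sz; rewrite /comm mulrBl linearB => /eqP;
    rewrite -oppr_eq0 opprB => /eqP.
move=> sz; have bm := multilinear_beta F g v.
have -> : x = pi x + (twist g (c x) - c x) by rewrite ce addrC subrK.
rewrite (multilinearD _ _ _ _ bm) -cat_rcons IH ?add0r; last 2 first.
- by rewrite all_rcons rfix andbT /twist_fixed pifix.
- by move: sz; rewrite cat_rcons !size_cat.
rewrite (@beta_perm n F g v _ ((twist g (c x) - c x) :: r ++ q)) //; last 2 first.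
- by move: sz; rewrite !size_cat.
- by rewrite perm_sym perm_rot_head.
rewrite (beta_swap g _ _ n_even Fi Ft); last first.
  by move: sz; rewrite !size_cat /= addnS => -[].
rewrite (eqP gv) subrr.
exact: (multilinear0 [::] (r ++ q) (multilinear_beta F g (c x))).
Qed.

(* A homotopy on Im (twist g - 1), with c the inverse of twist g - 1 there. *)
Lemma beta_exact n F g : odd n = false -> conj_invariant F ->
    trace_upto n F -> closed_on_fixed n F g ->
  exists s : seq V -> K, [/\ multilinear s, symmetric_words s &
    forall v p, size p = n.+1 -> s ((twist g v - v) :: p) = beta F g v p].
Proof.
move=> n_even Fi Ft Fc; have [pi [c [pifix ce ec pih _]]] := twist_split g.
exists (leibniz pi (fun x => on_size n.+1 (beta F g (c x)))); split.
- apply: multilinear_leibniz => [a x y p|x].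
    by rewrite /on_size; case: ifP => _; rewrite ?mulr0 ?addr0 // linearP beta_linear.
  exact/multilinear_on_size/multilinear_beta.
- apply: symmetric_leibniz => [x|x y p]; first exact: beta_symmetric.
  rewrite /on_size /= eqSS; case: eqP => // sz.
  have bB u v w : beta F g u ((v - w) :: p) = beta F g u (v :: p) - beta F g u (w :: p).
    exact: (multilinearB [::] p v w (multilinear_beta F g u)).
  have := beta_swap g (c x) (c y) n_even Fi Ft sz.
  by rewrite !ce !bB => e; apply: (eq_by_sub e); ring.
(* All summands but the first contain pi (h v - v) = 0 with h = [twist g]. The first is the defect
   at c (h v - v) = v - pi v, where [pi v] contributes nothing by [beta_fixed0]. *)
move=> v p sz /=; rewrite (@eq_leibniz _ _ _ _ (fun _ _ => 0)) ?leibniz0; last first.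
  move=> y r; rewrite linearB /= pih subrr.
  exact: (multilinear0 [::] r (multilinear_on_size _ (multilinear_beta F g _))).
rewrite addr0 /on_size sz eqxx ec.
have := beta_linear F g (-1) (pi v) v p.
have pifixv : twist_fixed g (pi v) by rewrite /twist_fixed pifix.
by rewrite (beta_fixed0 n_even Fi Ft Fc pifixv sz) mulr0 add0r scaleN1r addrC.
Qed.

(** * Averaging over the group and adding leading symbols *)

Definition conj_average F (a : A) : K :=
  #|gT|%:R^-1 * \sum_h F (grp h * a * grp h^-1%g).

Lemma conj_average_is_linear F : linear_for *%R (conj_average F).
Proof.
move=> a x y; rewrite /conj_average mulrCA -mulrDr; congr (_ * _).
rewrite mulr_sumr -big_split; apply: eq_bigr => h _ /=.
by rewrite mulrDr mulrDl linearD /= -sra_scaleAr -sra_scaleAl linearZ.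
Qed.

HB.instance Definition _ F :=
  GRing.isLinear.Build K A K _ (conj_average F) (conj_average_is_linear F).

Lemma card_neq0 : #|gT|%:R != 0 :> K.
Proof. by rewrite -(@prednK #|gT|) ?charK //; apply/card_gt0P; exists 1%g. Qed.

Lemma conj_average_invariant F : conj_invariant (conj_average F).
Proof.
move=> h a; rewrite /= /conj_average; congr (_ * _).
rewrite (reindex_inj (mulIg h^-1%g)) /=; apply: eq_bigr => k _.
by rewrite !mulrA -sra_grpM mulgKV invMg invgK sra_grpM !mulrA.
Qed.

Lemma conj_average_const F a k :
  (forall h, F (grp h * a * grp h^-1%g) = k) -> conj_average F a = k.
Proof.
move=> e; rewrite /conj_average (eq_bigr (fun=> k)) ?sumr_const //.
by rewrite -[k *+ _]mulr_natl mulKf ?card_neq0.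
Qed.

Lemma grp_mulVK h : grp h^-1%g * grp h = 1.
Proof. by rewrite -sra_grpM mulVg sra_grp1. Qed.

Lemma conj_word h p g : grp h * (word p * grp g) * grp h^-1%g =
  word (map (rho h) p) * grp (g ^ h^-1)%g.
Proof.
by rewrite mulrA grp_word conjgE invgK -!mulrA -!sra_grpM !mulgA.
Qed.

Lemma word_grp_vec F p g v :
  F (word p * grp g * vec v) = eps * F (word (p ++ [:: twist g v]) * grp g).
Proof.
by rewrite -mulrA grp_vec_twist scalarMr word_cat word_cons word_nil mulr1 !mulrA.
Qed.

Lemma trace_uptoP n F : trace_upto n F <->
  forall v p g, odd (size p) -> (size p < n)%N ->
    F (word (v :: p) * grp g) = F (word (p ++ [:: twist g v]) * grp g).
Proof.
split=> Ft v p g podd pn.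
  by rewrite word_cons Ft // word_grp_vec mulrA eps2 mul1r.
by rewrite -word_cons Ft // word_grp_vec mulrA eps2 mul1r.
Qed.

Lemma conj_average_trace n F : trace_upto n F -> trace_upto n (conj_average F).
Proof.
move=> Ft v p g podd pn /=; rewrite /conj_average [RHS]mulrCA [eps * _]mulr_sumr; congr (_ * _).
apply: eq_bigr => h _.
have -> : grp h * (vec v * word p * grp g) * grp h^-1%g =
    vec (rho h v) * word (map (rho h) p) * grp (g ^ h^-1)%g.
  by rewrite -word_cons conj_word word_cons.
rewrite Ft ?size_map //; congr (_ * F _).
have e : vec v * grp h^-1%g = grp h^-1%g * vec (rho h v).
  by rewrite sra_grp_vec (srg_invK G_srg).
by rewrite -conj_word -[LHS]mulrA -e !mulrA.
Qed.

Definition add_functionals F (S : gT -> {scalar A}) (a : A) : K :=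
  F a + \sum_g S g a.

Lemma add_functionals_is_linear F S : linear_for *%R (add_functionals F S).
Proof.
move=> a x y; rewrite /add_functionals linearP /=.
have -> : \sum_g S g (a *: x + y) = a * \sum_g S g x + \sum_g S g y.
  by rewrite mulr_sumr -big_split; apply: eq_bigr => g _; rewrite linearP.
by ring.
Qed.

HB.instance Definition _ F S :=
  GRing.isLinear.Build K A K _ (add_functionals F S) (add_functionals_is_linear F S).

Lemma add_symbols n F (s : gT -> seq V -> K) :
    (forall g, multilinear (s g)) -> (forall g, symmetric_words (s g)) ->
  exists F' : {scalar A}, forall p g, (size p <= n)%N ->
    F' (word p * grp g) =
    F (word p * grp g) + if size p == n then s g p else 0.
Proof.
move=> sm ss.
have [S SE] := choice (fun g => symbol_functional charK omega_anti G_srg eta_class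
  n g (sm g) (ss g)).
exists (add_functionals F S) => p g sz; rewrite /= /add_functionals; congr (_ + _).
rewrite (bigD1 g) //= SE // eqxx andbT big1 ?addr0 // => h hg.
by rewrite SE // [g == h]eq_sym (negPf hg) andbF.
Qed.

Lemma conj_invariantJ F a h : conj_invariant F ->
  F (grp h * a * grp h^-1%g) = F a.
Proof. by move=> Fi; rewrite -mulrA Fi -mulrA grp_mulVK mulr1. Qed.

Lemma conj_average_keep F F' p g : conj_invariant F ->
    (forall h, F' (word (map (rho h) p) * grp (g ^ h^-1)%g) =
               F (word (map (rho h) p) * grp (g ^ h^-1)%g)) ->
  conj_average F' (word p * grp g) = F (word p * grp g).
Proof.
move=> Fi e; apply: conj_average_const => h.
by rewrite conj_word e -conj_word conj_invariantJ.
Qed.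

Lemma trace_extend n F : odd n = false -> conj_invariant F -> trace_upto n F ->
    (forall g, closed_on_fixed n F g) ->
  exists F' : {scalar A}, [/\ conj_invariant F', trace_upto n.+2 F' &
    forall p g, (size p <= n.+1)%N -> F' (word p * grp g) = F (word p * grp g)].
Proof.
move=> n_even Fi Ft Fc.
have [s sP] := choice (fun g => beta_exact n_even Fi Ft (Fc g)).
have sm g : multilinear (s g) by case: (sP g).
have ss g : symmetric_words (s g) by case: (sP g).
have [F1 F1E] := add_symbols n.+2 F sm ss.
exists (conj_average F1); split; first exact: conj_average_invariant.
  apply: conj_average_trace; apply/trace_uptoP => v p g podd pn.
  rewrite !F1E ?size_cat ?addn1 //=.
  (* As [p] is odd and [n] even, either [p] has length n + 1, where [s] removes the defect, or it is
     shorter than [n], where the values are those of [F]. *)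
  case: eqP => [[sz]|nsz]; last first.
    have sz : (size p < n)%N.
      move: pn; rewrite ltnS leq_eqVlt => /orP[/eqP e|]; first by case: nsz; rewrite e.
      by rewrite ltnS leq_eqVlt => /orP[/eqP e|//]; move: podd; rewrite e n_even.
    by rewrite !addr0; move/trace_uptoP: Ft => ->.
  have [_ _ /(_ v p sz)] := sP g; rewrite betaE => e.
  have := multilinearB [::] p (twist g v) v (sm g); rewrite /= e.
  rewrite (@symmetric_perm _ _ _ (p ++ [:: twist g v]) (twist g v :: p)) //; last first.
    by rewrite perm_sym -{1}[p]cats0 perm_rot_head.
  by rewrite word_cat !word_cons word_nil mulr1 => e'; apply: (eq_by_sub e'); ring.
move=> p g sz; apply: conj_average_keep => // h.
by rewrite F1E ?size_map ?(leq_trans sz) // ltn_eqF ?addr0.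
Qed.

(** * Fixed spaces under conjugation and multiplication by reflections *)

Lemma twist_conj g k x : twist g (rho k x) = rho k (twist (g ^ k)%g x).
Proof.
rewrite !twistE linearZ; congr (_ *: _) => /=.
by rewrite -!(srg_mulE G_srg) conjgE !mulgA mulgV mul1g.
Qed.

Lemma twist_fixed_conj g k x : twist_fixed g (rho k x) = twist_fixed (g ^ k)%g x.
Proof.
rewrite /twist_fixed twist_conj; apply/eqP/eqP => [/(congr1 (rho k^-1%g))|-> //].
by rewrite !(srg_invK G_srg).
Qed.

Lemma twist_dim_conj g k :
  \dim (twist_fixed_space (g ^ k)%g) = \dim (twist_fixed_space g).
Proof.
suff le s l : (\dim (twist_fixed_space (s ^ l)%g) <= \dim (twist_fixed_space s))%N.
  by apply/eqP; rewrite eqn_leq le -{1}[g](conjgK k) le.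
suff -> : twist_fixed_space (s ^ l)%g = (rho l^-1%g @: twist_fixed_space s)%VS.
  by rewrite -[leqRHS](limg_ker_dim (rho l^-1%g)) leq_addl.
apply/vspaceP => x; rewrite twist_fixed_spaceE -twist_fixed_conj; apply/idP/idP.
  move=> lx; apply/memv_imgP; exists (rho l x); first by rewrite twist_fixed_spaceE.
  by rewrite (srg_invK G_srg).
by case/memv_imgP=> y; rewrite twist_fixed_spaceE => ys ->; rewrite (srg_Kinv G_srg).
Qed.

Lemma omega_nondeg_eq x y : (forall z, omega z x = omega z y) -> x = y.
Proof.
move=> e; apply/eqP; rewrite -subr_eq0; apply/eqP/omega_nondeg => z.
by rewrite omega_anti linearBr /= e subrr oppr0.
Qed.

(* A vector fixed by g r is orthogonal to Im(1 - r^-1), hence fixed by r. *)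
Lemma twist_dim_mulr g (r : gT) a b : is_reflection rho r ->
    twist_fixed g a -> twist_fixed g b -> omega_refl omega rho r a b != 0 ->
  (\dim (twist_fixed_space (g * r)%g) < \dim (twist_fixed_space g))%N.
Proof.
move=> rr ga gb ab.
have twM x : twist (g * r)%g x = twist g (rho r x).
  by rewrite !twistE (srg_mulE G_srg).
have rfix x : twist_fixed (g * r)%g x -> rho r x = x.
  move=> /eqP; rewrite twM => grx.
  have orth w : twist_fixed g w -> omega (w - rho r^-1%g w) x = 0.
    move=> /eqP gw; rewrite linearBl /=.
    have <- : omega (twist g w) x = omega w x by rewrite gw.
    rewrite -{1}grx twist_symplectic -{1}[w](srg_Kinv G_srg r).
    by rewrite (srg_symplecticE G_srg) subrr.
  have proj y : y - rho r^-1%g y =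
      refl_proj rho r y - rho r^-1%g (refl_proj rho r y).
    have /fixed_spaceP e := refl_proj_fixed charK G_srg r y.
    have := congr1 (rho r^-1%g) e; rewrite (srg_invK G_srg) linearB /= => e'.
    by apply: (eq_by_sub e');
      rewrite !opprB addrACA [RHS]addrACA [- _ - _]addrC.
  (* [L] vanishes on the components of [a] and [b] in the plane V_r. They span it since their
     pairing is nonzero, and [plane_jacobi] expresses every other component through them. *)
  pose L u := omega (u - rho r^-1%g u) x.
  have Llin c u v : L (c *: u + v) = c * L u + L v.
    by rewrite /L linearP opprD addrACA -scalerBr linearPl.
  have L0 : L 0 = 0 by rewrite /L linear0 subrr linear0l.
  have LZ c u : L (c *: u) = c * L u by rewrite -[c *: u]addr0 Llin L0 addr0.
  have La : L (refl_proj rho r a) = 0 by rewrite /L -proj orth.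
  have Lb : L (refl_proj rho r b) = 0 by rewrite /L -proj orth.
  apply: omega_nondeg_eq => z; apply/eqP.
  rewrite -(srg_symplecticE G_srg r^-1%g) (srg_invK G_srg) eq_sym -subr_eq0 -linearBl /=.
  rewrite proj -/(L (refl_proj rho r z)).
  have := plane_jacobi charK omega_anti (eqP rr)
    (refl_proj_moved rho r a) (refl_proj_moved rho r b) (refl_proj_moved rho r z).
  move/(congr1 L); rewrite L0 -addrA Llin Llin LZ La Lb !mulr0 !addr0 => /eqP.
  by rewrite mulf_eq0 (negPf ab).
rewrite ltn_neqAle.
have sub : (twist_fixed_space (g * r)%g <= twist_fixed_space g)%VS.
  apply/subvP => x; rewrite !twist_fixed_spaceE => grx.
  by move: (grx); rewrite /twist_fixed twM (rfix _ grx).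
rewrite dimvS // andbT (dimv_leqif_sup sub); apply: contra ab => /subvP sub'.
(* With equal dimensions [a] would be fixed by g r, hence by r, and its component in V_r would be
   0. *)
have ar : rho r a = a by apply/rfix; rewrite -twist_fixed_spaceE sub' ?twist_fixed_spaceE.
rewrite omega_reflE; have -> : refl_proj rho r a = 0.
  apply: (refl_projP charK G_srg); first exact: mem0v.
  by apply/fixed_spaceP; rewrite subr0.
by rewrite linear0l.
Qed.

Lemma twist_dim_mull g (r : gT) a b : is_reflection rho r ->
    twist_fixed g a -> twist_fixed g b -> omega_refl omega rho r a b != 0 ->
  (\dim (twist_fixed_space (r * g)%g) < \dim (twist_fixed_space g))%N.
Proof.
move=> rr ga gb ab; rewrite -(twist_dim_conj (r * g)%g r).
by rewrite conjgE -mulgA mulKg; apply: twist_dim_mulr ga gb ab.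
Qed.

(** * Commutators of words with vectors and the cocycle identity *)

Definition mul_functional F (x y a : A) : K := F (x * a * y).

Lemma mul_functional_is_linear F x y : linear_for *%R (mul_functional F x y).
Proof.
move=> c a b; rewrite /mul_functional mulrDr mulrDl linearD /=.
by rewrite -sra_scaleAr -sra_scaleAl linearZ.
Qed.

HB.instance Definition _ F x y := GRing.isLinear.Build K A K _
  (mul_functional F x y) (mul_functional_is_linear F x y).

(** The derivation rule, with each group element carried to the far left; the letters it passes are
    moved by h^-1, which is the map in [leibniz]. *)
Lemma comm_expand F p x : F (comm (word p) (vec x)) =
  \sum_h leibniz (rho h^-1%g)
     (fun y r => kappa h y x * F (grp h * word r)) p.
Proof.
elim: p F => [|q p IH] F.
  rewrite word_nil /comm mul1r mulr1 subrr linear0 big1 // => h _.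
have -> : comm (word (q :: p)) (vec x) =
    comm (vec q) (vec x) * word p + vec q * comm (word p) (vec x).
  by rewrite /comm word_cons mulrBl mulrBr !mulrA [RHS]addrC addrA subrK.
rewrite linearD /= {1}/comm (vec_comm _ G_srg) mulr_suml linear_sum.
have -> b : F (vec q * b) = mul_functional F (vec q) 1 b.
  by rewrite /= /mul_functional mulr1.
rewrite IH -big_split.
apply: eq_bigr => h _ /=; rewrite scalarMl; congr (_ + _); apply: eq_leibniz => y r.
by rewrite /= /mul_functional mulr1 word_cons !mulrA sra_grp_vec (srg_Kinv G_srg).
Qed.

Lemma comm_jacobi a b c :
  comm (comm a b) c - comm (comm a c) b = a * comm b c - comm b c * a.
Proof.
rewrite /comm !mulrBl !mulrBr !mulrA !opprB addrACA !subrKA.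
by rewrite [RHS]addrACA [LHS]addrACA [- _ - _]addrC.
Qed.

Lemma word_scale c p : word (map (fun x => c *: x) p) = c ^+ size p *: word p.
Proof.
elim: p => [|x p IH]; first by rewrite scale1r.
by rewrite /= !word_cons IH linearZ /= -sra_scaleAl -sra_scaleAr scalerA exprS.
Qed.

Lemma eps_even n : odd n = false -> eps ^+ n = 1.
Proof.
by move=> n_even; rewrite -(odd_double_half n) n_even -mul2n exprM expr2 eps2 expr1n.
Qed.

(** As [pi] inverts [twist g] on the letters, [betaE] gives F (pi x q g) - F (q x g) for each
    summand: one letter passes from the right end to the left end. [acc] collects the letters
    already moved, and the sum telescopes. *)
Lemma beta_telescope n F g (pi : V -> V) p acc : odd n = false ->
    trace_upto n F -> {in p, forall x, twist g (pi x) = x} ->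
    (size acc + size p = n.+2)%N ->
  leibniz pi (fun y r => beta F g (pi y) (acc ++ r)) p =
  F (word (rev (map pi p) ++ acc) * grp g) - F (word (acc ++ rev p) * grp g).
Proof.
move=> n_even Ft; elim: p acc => [|x p IH] acc pix sz.
  by rewrite /= cats0 subrr.
have sz' : (size acc + size p = n.+1)%N by move: sz; rewrite /= addnS => -[].
rewrite /= (@eq_leibniz_in _ _ predT predT pi pi _
  (fun y r => beta F g (pi y) ((pi x :: acc) ++ r))) ?all_predT //; last first.
  move=> y r _ _ szr; apply: (beta_perm g (pi y) n_even Ft).
    by rewrite size_cat /= szr.
  by rewrite perm_sym perm_rot_head.
rewrite IH; last 2 first.
- by move=> y py; apply: pix; rewrite inE py orbT.
- by rewrite /= addSn sz'.
rewrite (@beta_perm n F g _ (acc ++ p) (acc ++ rev p)) ?size_cat //; last first.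
  by rewrite perm_cat2l perm_sym perm_rev.
rewrite betaE pix ?mem_head // !rev_cons cat_rcons -[rcons (rev p) x]cats1 !catA.
by rewrite !word_cat !word_cons word_nil mulr1 !mulrA; ring.
Qed.

Definition comm_functional F g y (a : A) : K := F (comm a (vec y) * grp g).

Lemma comm_functional_is_linear F g y : linear_for *%R (comm_functional F g y).
Proof.
move=> c a b; rewrite /comm_functional.
have -> : comm (c *: a + b) (vec y) = c *: comm a (vec y) + comm b (vec y).
  by rewrite /comm mulrDl mulrDr opprD addrACA -sra_scaleAl -sra_scaleAr -scalerBr.
by rewrite mulrDl linearD /= -sra_scaleAl linearZ.
Qed.

HB.instance Definition _ F g y := GRing.isLinear.Build K A K _
  (comm_functional F g y) (comm_functional_is_linear F g y).

Lemma comm_grp_word F g k y r : conj_invariant F -> twist_fixed g y ->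
  F (comm (grp k * word r) (vec y) * grp g) =
  - beta F (g * k)%g (rho k^-1%g y) r.
Proof.
move=> Fi /eqP gy; rewrite /comm mulrBl linearB /= /beta opprB; congr (_ - _).
  rewrite -!mulrA Fi -!mulrA -[in LHS]sra_grpM.
  have -> : vec y * grp (g * k)%g = eps *: (grp (g * k)%g * vec (rho k^-1%g y)).
    rewrite sra_grp_vec (srg_mulE G_srg) (srg_Kinv G_srg) -{1}gy twistE linearZ.
    by rewrite /= -sra_scaleAl.
  by rewrite scalarMr !mulrA.
have -> : vec y * (grp k * word r) * grp g =
    grp k * (vec (rho k^-1%g y) * word r * grp g).
  by rewrite !mulrA sra_grp_vec (srg_Kinv G_srg).
by rewrite Fi -!mulrA -sra_grpM.
Qed.

(* The Jacobi identity for k makes a combination t of x, y, z invariant under k,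
   hence under twist (g k), where F is already closed; the remaining sum
   telescopes. *)
Lemma reflection_terms_sym n F g (k : gT) p x y : odd n = false ->
    conj_invariant F -> trace_upto n F -> closed_on_fixed n F (g * k)%g ->
    twist_fixed g x -> twist_fixed g y -> all (twist_fixed g) p ->
    size p = n.+2 ->
  leibniz (rho k^-1%g) (fun z r =>
    kappa k z x * comm_functional F g y (grp k * word r)) p =
  leibniz (rho k^-1%g) (fun z r =>
    kappa k z y * comm_functional F g x (grp k * word r)) p.
Proof.
move=> n_even Fi Ft Fc gx gy gp sz; rewrite /comm_functional.
pose b z r := beta F (g * k)%g (rho k^-1%g z) r.
transitivity (leibniz (rho k^-1%g) (fun z r =>
    kappa k x y * b z r + kappa k z y * F (comm (grp k * word r) (vec x) * grp g)) p).
  apply: (@eq_leibniz_in _ _ (twist_fixed g) predT) => // z r gz _ szr.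
  rewrite !comm_grp_word // -/(b x r) -/(b y r).
  pose t := kappa k x y *: z + kappa k y z *: x + kappa k z x *: y.
  have kt : rho k t = t.
    have DE u : (rho k - \1)%VF u = rho k u - u by rewrite add_lfunE opp_lfunE id_lfunE.
    apply/eqP; rewrite -subr_eq0 -DE; move: (rho k - \1)%VF DE => D DE.
    rewrite /t !linearD !linearZ /= !DE.
    exact/eqP/(kappa_jacobi eta charK omega_anti G_srg).
  have gt : twist_fixed g t.
    by rewrite /twist_fixed /t !linearD !linearZ /= (eqP gx) (eqP gy) (eqP gz).
  have gkt : twist_fixed (g * k)%g t.
    by rewrite /twist_fixed twistE (srg_mulE G_srg) kt -twistE; exact: gt.
  have ekt : rho k^-1%g t = t by rewrite -{1}kt (srg_invK G_srg).
  have szr' : size r = n.+1 by move: szr; rewrite sz => -[].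
  have bt : b t r = 0 by rewrite /b ekt (beta_fixed0 n_even Fi Ft Fc gkt szr').
  have blin c u v : b (c *: u + v) r = c * b u r + b v r.
    by rewrite /b linearP beta_linear.
  have b0 : b 0 r = 0.
    by have := blin (-1) 0 0; rewrite scaler0 add0r mulN1r addNr.
  have := bt; rewrite /t -addrA -[kappa k z x *: y]addr0 !blin b0 => e.
  by apply: (eq_by_sub (esym e)); rewrite [kappa k z y](kappa_anti _ _ omega_anti); ring.
rewrite leibniz_comb /b (@beta_telescope n F (g * k)%g (rho k^-1%g) p [::]) //; last first.
  move=> z pz; rewrite twistE (srg_mulE G_srg) (srg_Kinv G_srg) -twistE.
  exact/eqP/(allP gp).
rewrite /= cats0 [X in _ * X](_ : _ = 0) ?mulr0 ?add0r //; apply/eqP.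
(* The two ends of the telescope agree: conjugation by g k sends k^-1 z to g z = eps z, and the
   signs cancel since the length is even. *)
rewrite subr_eq0 -map_rev -Fi grp_word -map_comp.
have -> : map (rho (g * k)%g \o rho k^-1%g) (rev p) = map (fun z => eps *: z) (rev p).
  apply/eq_in_map => z; rewrite mem_rev => /(allP gp)/eqP gz.
  rewrite /= (srg_mulE G_srg) (srg_Kinv G_srg) -[in RHS]gz twistE scalerA eps2.
  by rewrite scale1r.
have en : eps ^+ n.+2 = 1 by apply: eps_even; rewrite /= negbK.
by rewrite word_scale size_rev sz en scale1r.
Qed.

(** Closedness of v -> F ([_, v] g) on W. Double commutators with x and y are symmetric under F (_
    g), because [x, y] commutes with g and F is conjugation invariant. Each h <> 1 contributes a
    symmetric amount by itself, which leaves the terms with omega. *)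
Lemma comm_cocycle n F g p x y : odd n = false ->
    conj_invariant F -> trace_upto n F ->
    (forall k, is_reflection rho k -> (exists a b, [/\ twist_fixed g a,
       twist_fixed g b & omega_refl omega rho k a b != 0]) ->
       closed_on_fixed n F (g * k)%g) ->
    twist_fixed g x -> twist_fixed g y -> all (twist_fixed g) p ->
    size p = n.+2 ->
  leibniz id (fun z r => omega z x * F (comm (word r) (vec y) * grp g)) p =
  leibniz id (fun z r => omega z y * F (comm (word r) (vec x) * grp g)) p.
Proof.
move=> n_even Fi Ft Fc gx gy gp sz.
have e1 u v : leibniz (rho 1^-1%g) (fun z r =>
    kappa 1%g z u * comm_functional F g v (grp 1%g * word r)) p =
    leibniz id (fun z r => omega z u * F (comm (word r) (vec v) * grp g)) p.
  apply: (@eq_leibniz_in _ _ predT predT); rewrite ?all_predT //.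
    by move=> z _; rewrite invg1 (srg_oneE G_srg).
  by move=> z r _ _ _; rewrite /kappa eqxx /comm_functional sra_grp1 mul1r.
rewrite -!e1.
have eh h : h != 1%g -> leibniz (rho h^-1%g) (fun z r =>
    kappa h z x * comm_functional F g y (grp h * word r)) p =
  leibniz (rho h^-1%g) (fun z r =>
    kappa h z y * comm_functional F g x (grp h * word r)) p.
  move=> h1; have [/andP[rh /asboolP ab]|nh] := boolP (is_reflection rho h &&
     `[< exists a b, [/\ twist_fixed g a, twist_fixed g b &
         omega_refl omega rho h a b != 0] >]).
    exact: (reflection_terms_sym n_even Fi Ft (Fc h rh ab)).
  have k0 a b : twist_fixed g a -> twist_fixed g b -> kappa h a b = 0.
    move=> ga gb; rewrite /kappa (negPf h1); case: ifP => // rh.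
    move: nh; rewrite rh => /asboolP nab; have [->|ab] := eqVneq (omega_refl omega rho h a b) 0.
      by rewrite mulr0.
    by case: nab; exists a, b.
  by apply: (@eq_leibniz_in _ _ (twist_fixed g) predT) => // z r gz _ _; rewrite !k0 // !mul0r.
have jac : comm_functional F g y (comm (word p) (vec x)) =
    comm_functional F g x (comm (word p) (vec y)).
  apply/eqP; rewrite -subr_eq0 /comm_functional -linearB -mulrBl /=.
  have -> : comm (comm (word p) (vec x)) (vec y) - comm (comm (word p) (vec y)) (vec x) =
     word p * comm (vec x) (vec y) - comm (vec x) (vec y) * word p.
    exact: comm_jacobi.
  rewrite mulrBl linearB /= -mulrA.
  have -> : comm (vec x) (vec y) * grp g = grp g * comm (vec x) (vec y).
    by rewrite grp_comm_twist (eqP gx) (eqP gy).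
  by rewrite -[X in _ - F X]mulrA conj_invariant_comm // mulrA subrr.
move: jac; rewrite !comm_expand (bigD1 1%g) //= [in RHS](bigD1 1%g) //=.
rewrite (eq_bigr (fun h => leibniz (rho h^-1%g) (fun z r =>
    kappa h z y * comm_functional F g x (grp h * word r)) p)) //.
exact: addIr.
Qed.

(** * Duality and contraction on the fixed space *)

Lemma omega_riesz (phi : {scalar V}) : exists y, forall x, omega x y = phi x.
Proof.
pose b := vbasis {:V}; pose n := \dim {:V}.
have T_lin : linear (fun y => \sum_(j < n) omega b`_j y *: b`_j).
  move=> c x y; rewrite scaler_sumr -big_split; apply: eq_bigr => j _ /=.
  by rewrite linearPr /= scalerDl scalerA.
pose T0 : {linear V -> V} := HB.pack (fun y => \sum_(j < n) omega b`_j y *: b`_j)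
  (GRing.isLinear.Build K V V _ _ T_lin).
pose T := linfun T0.
have bfree : free b := basis_free (vbasisP _).
have TE y : T y = \sum_(j < n) omega b`_j y *: b`_j by rewrite lfunE.
have ext x y : (forall j : 'I_n, omega b`_j y = phi b`_j) -> omega x y = phi x.
  move=> e; rewrite (coord_vbasis (memvf x)) linear_sum linear_sumlz /=.
  by apply: eq_bigr => j _; rewrite linearZl_LR linearZ /= e.
have Tinj : lker T == 0%VS.
  rewrite -subv0; apply/subvP => y; rewrite memv_ker memv0 TE => /eqP Ty.
  apply/eqP/omega_nondeg => x; rewrite omega_anti.
  rewrite (coord_vbasis (memvf x)) linear_sumlz /= big1 ?oppr0 // => j _.
  rewrite linearZl_LR /=; have := coord_sum_free (fun j => omega b`_j y) j bfree.
  by rewrite Ty linear0 => <-; rewrite mulr0.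
have /memv_imgP[y _ Ty] : \sum_(j < n) phi b`_j *: b`_j \in limg T.
  by rewrite (lker0_limgf Tinj) memvf.
exists y => x; apply: ext => j; rewrite -(coord_sum_free (fun j => omega b`_j y) j bfree).
by rewrite -TE -Ty coord_sum_free.
Qed.

Lemma twist_fixed_omega g pi c x y :
    (forall x, twist g (c x) - c x = x - pi x) -> twist_fixed g x ->
  omega x (pi y) = omega x y.
Proof.
move=> ce /eqP gx; apply/eqP; rewrite eq_sym -subr_eq0 -linearBr /= -ce.
by rewrite linearBr /= -{1}gx twist_symplectic subrr.
Qed.

(** The vectors representing the coordinates of a basis of W are projected to W. Their pairings with
    W survive, because W is orthogonal to Im (twist g - 1). *)
Lemma dual_bases g (d := \dim (twist_fixed_space g)) :
  exists x y : 'I_d -> V, [/\ forall i, twist_fixed g (x i),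
    forall i, twist_fixed g (y i), forall i, omega (x i) (y i) = 1,
    forall u, twist_fixed g u -> \sum_i omega u (y i) *: x i = u &
    forall u, twist_fixed g u -> \sum_i omega (x i) u *: y i = u].
Proof.
have [pi [c [pifix ce _ _ pid]]] := twist_split g.
pose b := vbasis (twist_fixed_space g).
have phi_lin (i : 'I_d) : linear_for *%R (fun v => coord b i (pi v)).
  by move=> a u v; rewrite !linearP.
have [y' y'E] := choice (fun i : 'I_d =>
  omega_riesz (HB.pack (fun v => coord b i (pi v)) (GRing.isLinear.Build K V K _ _ (phi_lin i)))).
have bfree : free b := basis_free (vbasisP _).
have xfix (i : 'I_d) : twist_fixed g b`_i.
  by rewrite -twist_fixed_spaceE; apply/vbasis_mem/memt_nth.
have yE i u : twist_fixed g u -> omega u (pi (y' i)) = coord b i u.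
  by move=> gu; rewrite (twist_fixed_omega _ ce gu) y'E /= pid //; exact/eqP.
have xy u : twist_fixed g u -> \sum_i omega u (pi (y' i)) *: b`_i = u.
  move=> gu; have uW : u \in twist_fixed_space g by rewrite twist_fixed_spaceE.
  rewrite [RHS](coord_vbasis uW).
  by apply: eq_bigr => i _; rewrite yE.
exists (fun i => b`_i), (fun i => pi (y' i)); split=> //.
- by move=> i; rewrite /twist_fixed pifix.
- by move=> i; rewrite yE // coord_free // eqxx.
move=> u gu; apply: omega_nondeg_eq => w.
have fixpi v : twist_fixed g (pi v) by rewrite /twist_fixed pifix.
have swap v : twist_fixed g v -> omega w v = omega (pi w) v.
  by move=> gv; rewrite omega_anti [RHS]omega_anti (twist_fixed_omega _ ce gv).
rewrite swap; last first.
  rewrite /twist_fixed linear_sum; apply/eqP; apply: eq_bigr => i _.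
  by rewrite linearZ /= pifix.
rewrite (swap u gu) -{2}(xy (pi w)) // linear_sumr linear_sumlz /=.
by apply: eq_bigr => i _; rewrite linearZr_LR linearZl_LR /= mulrC.
Qed.

Lemma comm_symmetric n F g y : odd n = false -> trace_upto n F ->
    twist_fixed g y ->
  symmetric_words (on_size n.+1 (fun p => comm_functional F g y (word p))).
Proof.
move=> n_even Ft /eqP gy; apply: symmetric_on_size => p u v q sz.
apply/eqP; rewrite -subr_eq0 -linearB /= word_mid linear_sum big1 // => h _.
rewrite linearZ /= /comm_functional /comm mulrBl linearB /=.
have -> : word (p ++ map (rho h) q) * grp h * vec y * grp g =
    eps *: (word (p ++ map (rho h) q) * grp (h * g)%g * vec y).
  rewrite sra_grpM -!mulrA grp_vec_twist gy -!sra_scaleAr scalerA eps2.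
  by rewrite scale1r.
rewrite linearZ /= [vec y * _]mulrA -[_ * grp h * grp g]mulrA -sra_grpM Ft.
- by rewrite subrr mulr0.
- rewrite size_cat size_map; have /(congr1 odd) := sz; rewrite /= n_even negbK.
  by move=> ->.
- by rewrite size_cat size_map -ltnS -sz.
Qed.

Lemma multilinear_functional F : multilinear (fun p => F (word p)).
Proof. by move=> a x y p q; rewrite word_multilinear linearP. Qed.

(* Poincare lemma on the symplectic space twist_fixed_space g: s is obtained by
   contracting the closed form with a pair of dual bases. *)
Lemma fixed_exact n F g : odd n = false -> conj_invariant F -> trace_upto n F ->
    (forall k, is_reflection rho k -> (exists a b, [/\ twist_fixed g a,
       twist_fixed g b & omega_refl omega rho k a b != 0]) ->
       closed_on_fixed n F (g * k)%g) ->
    (0 < \dim (twist_fixed_space g))%N ->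
  exists s : seq V -> K, [/\ multilinear s, symmetric_words s,
    forall v p, s ((twist g v - v) :: p) = 0 &
    forall v p, twist_fixed g v -> all (twist_fixed g) p -> size p = n.+1 ->
      leibniz id (fun z r => omega z v * s r) p =
      - F (comm (word p) (vec v) * grp g)].
Proof.
move=> n_even Fi Ft Fc d_gt0; have [pi [c [pifix ce _ pih pid]]] := twist_split g.
have [x [y [xfix yfix xy1 xyu yxu]]] := dual_bases g.
set d := \dim _ in d_gt0 x y xfix yfix xy1 xyu yxu.
pose Gam v p := comm_functional F g v (word p).
(* Contracting the closed form returns it n + d times: [d] from the pairings
   [omega (x i) (y i) = 1], n + 1 from Euler's identity, and -1 from the terms with
   [omega (x i) v]. *)
pose k : K := - (n + d)%:R^-1.
have nd0 : (n + d)%:R != 0 :> K by rewrite -(@prednK (n + d)) ?charK // addn_gt0 d_gt0 orbT.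
have Gm v : multilinear (on_size n.+1 (Gam v)).
  exact/multilinear_on_size/(multilinear_functional (comm_functional F g v)).
have Gs v : twist_fixed g v -> symmetric_words (on_size n.+1 (Gam v)).
  exact: comm_symmetric.
(* Composition with [pi] makes [s] vanish on Im (twist g - 1), so that adding it does not disturb
   the trace property already reached. *)
exists (fun r => k * \sum_i on_size n.+1 (Gam (y i)) (x i :: map pi r)); split.
- move=> a u v p q.
  have -> : \sum_i on_size n.+1 (Gam (y i)) (x i :: map pi (p ++ (a *: u + v) :: q)) =
    a * \sum_i on_size n.+1 (Gam (y i)) (x i :: map pi (p ++ u :: q)) +
    \sum_i on_size n.+1 (Gam (y i)) (x i :: map pi (p ++ v :: q)).
    rewrite mulr_sumr -big_split; apply: eq_bigr => i _.
    exact: (multilinear_map pi (multilinear_prefix [:: x i] (Gm (y i)))).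
  by ring.
- move=> p u v q; congr (_ * _); apply: eq_bigr => i _.
  exact: (symmetric_map pi (symmetric_prefix [:: x i] (Gs _ (yfix i)))).
- move=> v p; rewrite big1 ?mulr0 // => i _; rewrite /= linearB /= pih subrr.
  exact: (multilinear0 [:: x i] (map pi p) (Gm (y i))).
move=> v p gv gp sz.
pose S i z r := omega z v * Gam (y i) (x i :: r).
rewrite (@eq_leibniz_in _ _ (twist_fixed g) (twist_fixed g) id id _
   (fun z r => k * \sum_i S i z r + 0)) //; last first.
  move=> z r _ gr szr; rewrite addr0 mulrCA mulr_sumr; congr (_ * _).
  apply: eq_bigr => i _; rewrite /S /on_size /= size_map szr sz eqxx.
  congr (_ * _); congr (Gam _ (_ :: _)).
  by rewrite -[RHS]map_id; apply/eq_in_map => u /(allP gr)/eqP/pid.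
rewrite leibniz_comb leibniz0 addr0 leibniz_sum.
have Sx i : leibniz id (S i) p = Gam v p +
   leibniz id (fun z r => omega z (y i) * Gam v (x i :: r)) p - omega (x i) v * Gam (y i) p.
  have gxp : all (twist_fixed g) (x i :: p) by rewrite /= xfix.
  have szx : size (x i :: p) = n.+2 by rewrite /= sz.
  have := comm_cocycle n_even Fi Ft Fc gv (yfix i) gxp szx.
  rewrite /= xy1 mul1r => e; apply: (eq_by_sub e).
  by rewrite /S /Gam /comm_functional; ring.
under eq_bigr => i _ do rewrite Sx.
rewrite sumrB big_split /= sumr_const card_ord -leibniz_sum.
rewrite (@eq_leibniz_in _ _ (twist_fixed g) predT id id _
   (fun z r => on_size n.+1 (Gam v) (z :: r))) //; last first.
  move=> z r gz _ szr; rewrite /on_size /= szr sz eqxx.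
  have Gml : multilinear (Gam v) := multilinear_functional (comm_functional F g v).
  rewrite -[X in _ = Gam v (X :: r)](xyu z gz).
  rewrite (multilinear_sum _ _ [::] r Gml); apply: eq_bigr => i _.
  by rewrite (multilinearZ [::] r _ _ Gml).
rewrite (leibniz_size p (Gs v gv)) sz /on_size sz eqxx.
have -> : \sum_i omega (x i) v * Gam (y i) p = Gam v p.
  have GE u : Gam u p = mul_functional F 1 (grp g) (word (p ++ [:: u])) -
      mul_functional F 1 (grp g) (word ([::] ++ u :: p)).
    rewrite /Gam /comm_functional /mul_functional /comm !mul1r word_cat.
    by rewrite !word_cons word_nil mulr1 mulrBl linearB.
  have fm := multilinear_functional (mul_functional F 1 (grp g)).
  rewrite -{2}(yxu v gv) GE !(multilinear_sum _ _ _ _ fm) -sumrB.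
  apply: eq_bigr => i _.
  by rewrite GE !(multilinearZ _ _ _ _ fm) mulrBr.
rewrite -[Gam v p *+ _]mulr_natl -[X in _ = - X]/(Gam v p) /k.
set t := Gam v p; have -> : d%:R * t + n.+1%:R * t - t = (n + d)%:R * t.
  by rewrite natrD mulrS; ring.
by rewrite mulNr mulKf.
Qed.

(** * Removing the obstruction by induction on the dimension of the fixed space *)

Lemma kappa_fixed_reflection g (h : gT) x y : h != 1%g ->
    twist_fixed g x -> twist_fixed g y -> kappa h x y != 0 ->
  is_reflection rho h /\ omega_refl omega rho h x y != 0.
Proof.
move=> h1 gx gy; rewrite /kappa (negPf h1); case: ifP => [rh|_]; last by rewrite eqxx.
by rewrite mulf_eq0 negb_or => /andP[].
Qed.

Lemma twist_fixed_dim0 g x : \dim (twist_fixed_space g) = 0%N ->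
  twist_fixed g x -> x = 0.
Proof.
move=> /eqP; rewrite dimv_eq0 => /eqP W0.
by rewrite -twist_fixed_spaceE W0 memv0 => /eqP.
Qed.

Lemma conj_average_closed n F g :
  (forall h, closed_on_fixed n F (g ^ h)%g) ->
  closed_on_fixed n (conj_average F) g.
Proof.
move=> Fg v p gv gp sz; apply: conj_average_const => h.
have -> : grp h * (comm (word p) (vec v) * grp g) * grp h^-1%g =
   comm (word (map (rho h) p)) (vec (rho h v)) * grp (g ^ h^-1)%g.
  have := conj_word h (p ++ [:: v]) g; have := conj_word h (v :: p) g.
  rewrite /comm !map_cat /= !word_cat !word_cons !word_nil !mulr1 => e1 e2.
  by rewrite !mulrBl mulrBr mulrBl e1 e2.
apply: Fg; last by rewrite size_map.
  by rewrite twist_fixed_conj conjgKV.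
by rewrite all_map; apply: sub_all gp => x; rewrite /= twist_fixed_conj conjgKV.
Qed.

Lemma comm_grp_expand F g p v : F (comm (word p) (vec v) * grp g) =
  \sum_h leibniz (rho h^-1%g)
    (fun y r => kappa h y v * F (word (map (rho h) r) * grp (h * g)%g)) p.
Proof.
have e a : mul_functional F 1 (grp g) a = F (a * grp g).
  by rewrite /mul_functional mul1r.
rewrite -e comm_expand; apply: eq_bigr => h _.
by apply: eq_leibniz => y r; rewrite /= e grp_word -mulrA sra_grpM.
Qed.

(** A reflection that contributes on fixed letters leads to some h g with a smaller fixed space, by
    [twist_dim_mull], and there [F] is assumed to vanish. *)
Lemma comm_fixed_expand F g p v : twist_fixed g v -> all (twist_fixed g) p ->
    (forall h r, (\dim (twist_fixed_space (h * g)%g) <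
                  \dim (twist_fixed_space g))%N ->
       (size r).+1 = size p -> F (word r * grp (h * g)%g) = 0) ->
  F (comm (word p) (vec v) * grp g) =
  leibniz id (fun y r => omega y v * F (word r * grp g)) p.
Proof.
move=> gv gp F0; rewrite comm_grp_expand (bigD1 1%g) //= [X in _ + X]big1 ?addr0.
  apply: (@eq_leibniz_in _ _ predT predT); rewrite ?all_predT //.
    by move=> z _; rewrite invg1 (srg_oneE G_srg).
  move=> z r _ _ _; rewrite /kappa eqxx mul1g (eq_map (srg_oneE G_srg)).
  by rewrite map_id.
move=> h h1; rewrite -[RHS](leibniz0 (rho h^-1%g) p).
apply: (@eq_leibniz_in _ _ (twist_fixed g) predT) => // y r gy _ szr.
have [->|/(kappa_fixed_reflection h1 gy gv)[rh hyv]] := eqVneq (kappa h y v) 0.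
  by rewrite mul0r.
by rewrite F0 ?size_map ?mulr0 // (twist_dim_mull rh gy gv hyv).
Qed.

Definition closed_below n d F :=
  forall g, (\dim (twist_fixed_space g) < d)%N -> closed_on_fixed n F g.

(** The correction is supported on elements whose fixed space has dimension exactly [d]. By
    [comm_fixed_expand] it affects the obstruction at such an element only through its own symbol,
    and not at all at elements of smaller dimension. For d = 0 the condition is empty and [F] stays
    as it is. *)
Lemma closed_below_step n d F : odd n = false -> conj_invariant F ->
    trace_upto n F -> closed_below n d F ->
  exists F' : {scalar A}, [/\ conj_invariant F', trace_upto n F',
    closed_below n d.+1 F' &
    forall p g, (size p <= n)%N ->
      (size p < n)%N || (\dim (twist_fixed_space g) == 0%N) ->
      F' (word p * grp g) = F (word p * grp g)].
Proof.
move=> n_even Fi Ft Fc; have [->|d_gt0] := posnP d.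
  exists F; split=> // g; rewrite ltnS leqn0 => /eqP g0 v p gv _ _.
  by rewrite (twist_fixed_dim0 g0 gv) /comm linear0 mulr0 mul0r subrr mul0r linear0.
have sex g : exists s : seq V -> K, [/\ multilinear s, symmetric_words s,
    forall v p, s ((twist g v - v) :: p) = 0,
    \dim (twist_fixed_space g) != d -> forall r, s r = 0 &
    \dim (twist_fixed_space g) == d -> forall v p, twist_fixed g v ->
      all (twist_fixed g) p -> size p = n.+1 ->
      leibniz id (fun z r => omega z v * s r) p =
      - F (comm (word p) (vec v) * grp g)].
  have [gd|gd] := eqVneq (\dim (twist_fixed_space g)) d; last first.
    by exists (fun=> 0); split=> // a x y p q; rewrite mulr0 addr0.
  have [||s [sm ss s0 sE]] := @fixed_exact n F g n_even Fi Ft; last by exists s; split.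
    move=> k rk [a [b [ga gb ab]]]; apply: Fc.
    by rewrite -gd (twist_dim_mulr rk ga gb ab).
  by rewrite gd.
have [s sP] := choice sex.
have sm g : multilinear (s g) by case: (sP g).
have ss g : symmetric_words (s g) by case: (sP g).
have [F1 F1E] := add_symbols n F sm ss.
exists (conj_average F1); split.
- exact: conj_average_invariant.
- apply: conj_average_trace; apply/trace_uptoP => v p g podd pn.
  rewrite !F1E ?size_cat ?addn1 //=; congr (_ + _).
    by move/trace_uptoP: Ft => ->.
  case: ifP => // _; have [_ _ s0 _ _] := sP g.
  have := multilinearB [::] p (twist g v) v (sm g); rewrite /= s0.
  rewrite (@symmetric_perm _ _ _ (p ++ [:: twist g v]) (twist g v :: p)) //; last first.
    by rewrite perm_sym -{1}[p]cats0 perm_rot_head.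
  by move/esym/eqP; rewrite subr_eq0 => /eqP.
- suff cl g : (\dim (twist_fixed_space g) < d.+1)%N -> closed_on_fixed n F1 g.
    by move=> g gd; apply: conj_average_closed => h; apply: cl; rewrite twist_dim_conj.
  move=> gd v p gv gp sz.
  have [D DE] : exists D : {scalar A}, forall a, D a = F1 a - F a by exists (F1 \- F).
  have Ds q h : size q = n -> D (word q * grp h) = s h q.
    by move=> szq; rewrite DE F1E szq // eqxx addrC addKr.
  have F1D a : F1 a = F a + D a by rewrite DE addrC subrK.
  rewrite F1D (@comm_fixed_expand D) //; last first.
    move=> h r lt; rewrite sz => -[szr]; rewrite Ds //.
    have [_ _ _ s0 _] := sP (h * g)%g; rewrite s0 // neq_ltn.
    by rewrite (leq_trans lt) // -ltnS.
  rewrite (@eq_leibniz_in _ _ predT predT id id _ (fun y r => omega y v * s g r))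
    ?all_predT //; last by move=> y r _ _; rewrite sz => -[szr]; rewrite Ds.
  have [_ _ _ sd0 sd] := sP g.
  move: gd; rewrite ltnS leq_eqVlt => /orP[gd|gd].
    by rewrite sd // subrr.
  rewrite Fc // add0r -[RHS](leibniz0 id p); apply: eq_leibniz => y r.
  by rewrite sd0 ?mulr0 // neq_ltn gd.
move=> p g sz szd; apply: conj_average_keep => // h.
rewrite F1E ?size_map //; case: (size p =P n) szd => [->|_ _]; last by rewrite addr0.
rewrite ltnn /= => /eqP g0; have [_ _ _ s0 _] := sP (g ^ h^-1)%g.
by rewrite s0 ?addr0 // twist_dim_conj g0 eq_sym -lt0n.
Qed.

Lemma closed_everywhere n F : odd n = false -> conj_invariant F ->
    trace_upto n F ->
  exists F' : {scalar A}, [/\ conj_invariant F', trace_upto n F',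
    forall g, closed_on_fixed n F' g &
    forall p g, (size p <= n)%N ->
      (size p < n)%N || (\dim (twist_fixed_space g) == 0%N) ->
      F' (word p * grp g) = F (word p * grp g)].
Proof.
move=> n_even Fi Ft.
have H d : exists F' : {scalar A}, [/\ conj_invariant F', trace_upto n F',
    closed_below n d F' &
    forall p g, (size p <= n)%N ->
      (size p < n)%N || (\dim (twist_fixed_space g) == 0%N) ->
      F' (word p * grp g) = F (word p * grp g)].
  elim: d => [|d [F1 [F1i F1t F1c F1E]]]; first by exists F.
  have [F2 [F2i F2t F2c F2E]] := closed_below_step n_even F1i F1t F1c.
  by exists F2; split=> // p g sz sd; rewrite F2E // F1E.
have [F' [Fi' Ft' Fc' FE']] := H (\dim {:V}).+1.
by exists F'; split=> // g; apply: Fc'; rewrite ltnS dimvS ?subvf.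
Qed.

(** * Existence of twisted traces *)

Definition parity_part b (a : A) : A := sra_part a b.

Lemma parity_part_is_linear b : linear (parity_part b).
Proof.
move=> c x y; rewrite /parity_part -[x]sra_reprK -[y]sra_reprK.
rewrite sra_scaleE -sra_piM -sra_piD !sra_part_pi /= big_bool /= mul0r add0r addbF.
by rewrite -sra_scaleAl mul1r.
Qed.

HB.instance Definition _ b := GRing.isLinear.Build K A A _
  (parity_part b) (parity_part_is_linear b).

Lemma sra_part_mul (x y : A) b :
  sra_part (x * y) b = \sum_(c : bool) sra_part x c * sra_part y (b (+) c).
Proof. by rewrite -[x in LHS]sra_reprK -[y in LHS]sra_reprK -sra_piM sra_part_pi. Qed.

Lemma sra_part_grp g b : sra_part (grp g) b = if b then 0 else grp g.
Proof. by rewrite sra_part_pi. Qed.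

Lemma sra_part_vec x b : sra_part (vec x) b = if b then vec x else 0.
Proof. by rewrite sra_part_pi. Qed.

Lemma sra_part_word p g b : sra_part (word p * grp g) b =
  if odd (size p) == b then word p * grp g else 0.
Proof.
elim: p b => [|x p IH] b; first by rewrite word_nil mul1r sra_part_grp; case: b.
rewrite word_cons -mulrA sra_part_mul big_bool /= !sra_part_vec mul0r addr0 IH.
by rewrite addbT; case: (odd _) b => [] [] /=; rewrite ?mulr0.
Qed.

Lemma twisted_trace_exists (c : gT -> K) : (forall g h, c (g ^ h)%g = c g) ->
  exists T : {scalar A}, [/\ conj_invariant T,
    forall v a, T (vec v * a) = eps * T (a * vec v),
    forall a, T (sra_part a true) = 0 &
    forall g, \dim (twist_fixed_space g) = 0%N -> T (grp g) = c g].
Proof.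
move=> cJ.
pose level k (f : seq V -> gT -> K) := exists F : {scalar A},
  [/\ forall p g, F (word p * grp g) = f p g, conj_invariant F,
      trace_upto k.*2 F & forall g, closed_on_fixed k.*2 F g].
have [F0 [F0i F0t F0c F0E]] : exists F0 : {scalar A}, [/\ conj_invariant F0,
    trace_upto 0 F0, forall g, closed_on_fixed 0 F0 g &
    forall g, \dim (twist_fixed_space g) = 0%N -> F0 (grp g) = c g].
  pose s g p := on_size 0 (fun=> c g) p.
  have sm g : multilinear (s g) by move=> a x y [|? ?] q; rewrite /s /on_size /= mulr0 addr0.
  have ss g : symmetric_words (s g) by move=> [|? ?] x y q; rewrite /s /on_size.
  have [F FE] := add_symbols 0 (\0 : {scalar A}) sm ss.
  have F'i := conj_average_invariant F.
  have F't : trace_upto 0 (conj_average F) by [].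
  (* Closing up in length 0 may alter the values prescribed on the group, except where the fixed
     space is 0. *)
  have [F1 [F1i F1t F1c F1E]] := @closed_everywhere 0%N _ (erefl _) F'i F't.
  exists F1; split=> // g g0; have := F1E [::] g (leqnn _); rewrite g0 word_nil mul1r.
  move=> ->; last by rewrite orbT.
  apply: conj_average_const => h.
  have -> : grp h * grp g * grp h^-1%g = word [::] * grp (g ^ h^-1)%g.
    by rewrite -(conj_word h [::] g) word_nil mul1r.
  by rewrite FE //= /s /on_size /= add0r cJ.
have step k f : level k f -> exists f', level k.+1 f' /\
    (forall p g, (size p <= k.*2)%N -> f' p g = f p g).
  move=> [F [FE Fi Ft Fc]].
  have ke : odd k.*2 = false by rewrite odd_double.
  have [F1 [F1i F1t F1E]] := trace_extend ke Fi Ft Fc.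
  have ke' : odd k.*2.+2 = false by rewrite /= odd_double.
  have [F2 [F2i F2t F2c F2E]] := closed_everywhere ke' F1i F1t.
  exists (fun p g => F2 (word p * grp g)); split.
    by exists F2; split=> //; rewrite doubleS.
  move=> p g sz; rewrite F2E; last 2 first.
  - by rewrite (leq_trans sz) // leqW.
  - by rewrite ltnS leqW.
  by rewrite F1E ?FE // leqW.
have [||||f [f0 fk]] := @wordfun_limit K V gT level double
    (fun p g => F0 (word p * grp g)).
- by move=> k; rewrite -addnn leq_addr.
- by move=> k; rewrite doubleS leqW.
- by exists F0.
- exact: step.
have fF k : exists F : {scalar A}, [/\ conj_invariant F, trace_upto k.*2 F &
    forall p g, (size p <= k.*2)%N -> f p g = F (word p * grp g)].
  have [f' [[F [FE Fi Ft _]] ff']] := fk k.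
  by exists F; split=> // p g sz; rewrite FE ff'.
have lek k : (k <= k.*2)%N by rewrite -addnn leq_addr.
have fP : pbw omega rho eta f.
  move=> n; split=> [g a x y p q|p x y q g sz].
    have [F [_ _ fE]] := fF (size (p ++ x :: q)).
    rewrite !fE ?word_multilinear ?mulrDl -?sra_scaleAl ?linearP //;
      by apply: leq_trans (lek _); rewrite !size_cat.
  have [F [_ _ fE]] := fF (size (p ++ x :: y :: q)).
  rewrite !fE ?(leq_trans _ (lek _)) ?size_cat // -linearB -mulrBl word_mid.
  rewrite mulr_suml linear_sum; apply: eq_bigr => h _.
  rewrite -sra_scaleAl linearZ /= -mulrA -sra_grpM fE //.
  by apply: leq_trans (lek _); rewrite !size_cat size_map /= leq_add2l leqW.
have [T TE] := pbw_functional charK G_srg eta_class fP.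
have part_word b p g : parity_part b (word p * grp g) =
  if odd (size p) == b then word p * grp g else 0 by exact: sra_part_word.
have span_eq (F1 F2 : {scalar A}) :
    (forall p g, F1 (word p * grp g) = F2 (word p * grp g)) -> F1 =1 F2.
  move=> e; apply: sra_ind => // [a x y ex ey|]; first by rewrite !linearP ex ey.
  by rewrite !linear0.
(* Trace identities are known only for words of even total length. Dropping the odd part makes the
   remaining ones trivial. *)
have [T' T'a] : exists T' : {scalar A}, forall a, T' a = T (parity_part false a).
  by exists (T \o parity_part false).
have T'E p g : T' (word p * grp g) = if odd (size p) then 0 else f p g.
  rewrite T'a part_word; case: (odd _) => /=; first exact: linear0.
  exact: TE.
exists T'; split.
- move=> h a; pose L : {scalar A} := mul_functional T' (grp h) 1.
  pose R : {scalar A} := mul_functional T' 1 (grp h).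
  have : L a = R a; last by rewrite /= /mul_functional mul1r mulr1.
  apply: span_eq => p g; rewrite /= /mul_functional mul1r mulr1.
  rewrite mulrA grp_word -!mulrA -!sra_grpM !T'E size_map; case: ifP => // _.
  have [F [Fi _ fE]] := fF (size p).
  rewrite !fE ?size_map ?lek // !sra_grpM !mulrA -grp_word -mulrA.
  by rewrite -mulrA Fi !mulrA.
- move=> v a; pose L : {scalar A} := mul_functional T' (vec v) 1.
  pose R : {scalar A} := mul_functional T' 1 (eps *: vec v).
  suff : L a = R a.
    by rewrite /= /mul_functional mul1r mulr1 -sra_scaleAr linearZ.
  apply: span_eq => p g; rewrite /= /mul_functional mul1r mulr1 mulrA -word_cons.
  have -> : word p * grp g * (eps *: vec v) = word (p ++ [:: twist g v]) * grp g.
    rewrite -mulrA -sra_scaleAr grp_vec_twist scalerA eps2 scale1r.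
    by rewrite word_cat word_cons word_nil mulr1 !mulrA.
  rewrite !T'E size_cat addn1 /=; case: ifP => // /negbFE podd.
  have [F [_ Ft fE]] := fF (size p).+1.
  rewrite !fE ?size_cat ?addn1 ?lek //; move/trace_uptoP: Ft; apply=> //.
- move=> a; apply: (span_eq (T' \o parity_part true) \0) => p g.
  by rewrite /= part_word T'a; case podd: (odd (size p));
    rewrite /= ?part_word ?podd /= !linear0.
- move=> g g0; have := T'E [::] g; rewrite word_nil mul1r => -> /=.
  by rewrite f0 // word_nil mul1r F0E.
Qed.

(** * Twisted traces are determined by their values on the group *)

Lemma functional_symmetric n F g :
    (forall p h, (size p).+2 = n -> F (word p * grp h) = 0) ->
  symmetric_words (on_size n (fun p => F (word p * grp g))).
Proof.
move=> F0; apply: symmetric_on_size => p x y q sz.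
apply/eqP; rewrite -subr_eq0 -linearB -mulrBl word_mid mulr_suml linear_sum.
rewrite big1 // => h _; rewrite -sra_scaleAl linearZ /= -mulrA -sra_grpM F0 ?mulr0 //.
by rewrite size_cat size_map.
Qed.

(* Letters in Im (twist g - 1) can be rotated away; on words fixed by twist g the
   contraction of [fixed_exact] reduces to group elements with smaller fixed
   spaces. *)
Lemma trace_eq0 F : conj_invariant F ->
    (forall v a, F (vec v * a) = eps * F (a * vec v)) ->
    (forall g, F (grp g) = 0) ->
  forall a, F a = 0.
Proof.
move=> Fi Ft F1 a; suff H n p g : size p = n -> F (word p * grp g) = 0.
  apply: (sra_ind (P := fun a => F a = 0)) => [c x y Fx Fy||p g].
  - by rewrite linearP Fx Fy mulr0 addr0.
  - exact: linear0.
  - exact: H.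
elim/ltn_ind: n p g => -[_ [|//] g _|n IH p g szp]; first by rewrite word_nil mul1r.
move: {2}(\dim _) (erefl (\dim (twist_fixed_space g))) => d.
elim/ltn_ind: d g p szp => d IHd g p szp dg.
pose f := on_size n.+1 (fun p => F (word p * grp g)).
have fm : multilinear f.
  apply: multilinear_on_size => c x y q r.
  by rewrite word_multilinear mulrDl -sra_scaleAl linearP.
have fs : symmetric_words f.
  by apply: functional_symmetric => q h sz; apply: (IH (size q)) => //; rewrite -sz.
suff f0 : forall q, f q = 0 by have := f0 p; rewrite /f /on_size szp eqxx.
have rot y q : f ((twist g y - y) :: q) = 0.
  rewrite (multilinearB [::] q _ _ fm) /= (_ : f (y :: q) = f (twist g y :: q)) ?subrr //.
  rewrite [RHS](@symmetric_perm _ _ _ _ (q ++ [:: twist g y])) //; last first.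
    by rewrite -{1}[q]cats0 perm_rot_head.
  rewrite /f /on_size size_cat addn1 /=; case: ifP => // _.
  by rewrite word_cons -mulrA Ft word_grp_vec mulrA eps2 mul1r.
move=> q; have [pi [c [pifix ce _ _ _]]] := twist_split g.
suff fixed r : all (twist_fixed g) r -> f r = 0.
  suff H r : all (twist_fixed g) r -> f (r ++ q) = 0 by exact: (H [::]).
  elim: q r => [|x q IHq] r gr; first by rewrite cats0 fixed.
  have -> : x = pi x + (twist g (c x) - c x) by rewrite ce addrC subrK.
  rewrite (multilinearD _ _ _ _ fm) -cat_rcons IHq ?add0r; last first.
    by rewrite all_rcons gr andbT /twist_fixed pifix.
  by rewrite (@symmetric_perm _ _ _ _ ((twist g (c x) - c x) :: r ++ q)) //
    perm_sym perm_rot_head.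
move=> gr; rewrite /f /on_size; case: eqP => // szr.
have [x [y [xfix yfix xy1 xyu _]]] := dual_bases g.
have e i : leibniz id (fun z s => omega z (y i) * F (word s * grp g)) (x i :: r) = 0.
  rewrite -comm_fixed_expand //=; last 2 first.
  - by rewrite xfix.
  - by move=> h s lt [szs]; apply: (IHd _ _ _ _ _ (erefl _)); rewrite -?dg ?szs.
  rewrite /comm mulrBl linearB /= -[X in _ - F X]mulrA Ft word_grp_vec.
  have /eqP -> := yfix i; rewrite [eps * (eps * _)]mulrA eps2 mul1r.
  by rewrite word_cat [word [:: _]]word_cons word_nil mulr1 subrr.
(* Removing [x i] itself gives the value at [r], [d] times in all. The other summands, recombined by
   [xyu], give it n + 1 times by Euler's identity, so d + n + 1 times the value is 0. *)
have : \sum_i leibniz id (fun z s => omega z (y i) * F (word s * grp g)) (x i :: r) = 0.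
  by rewrite big1.
rewrite /= big_split /=; under eq_bigr => i _ do rewrite xy1 mul1r.
rewrite sumr_const card_ord -leibniz_sum.
rewrite (@eq_leibniz_in _ _ (twist_fixed g) predT id id _ (fun z s => f (z :: s))) //;
  last first.
  move=> z s gz _ szs; rewrite -[in RHS](xyu z gz) (multilinear_sum _ _ [::] s fm).
  apply: eq_bigr => i _; rewrite (multilinearZ [::] s _ _ fm) /f /on_size /=.
  by rewrite szs szr eqxx.
rewrite (leibniz_size r fs) /f /on_size szr eqxx -[F _ *+ _]mulr_natl.
rewrite -mulrDl -natrD addnS.
by move/eqP; rewrite mulf_eq0 (negPf (charK _)) => /eqP.
Qed.

End Traces.

(** * Invariant forms on a simple algebra *)

Section TwistedTraces.
Variables (K : fieldType) (V : vectType K) (omega : {biscalar V}).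
Variables (gT : finGroupType) (rho : gT -> 'End(V)) (eta : gT -> K).
Hypothesis charK : forall n, n.+1%:R != 0 :> K.
Hypothesis closedK : forall p : {poly K}, size p != 1 -> exists x, root p x.
Hypothesis omega_anti : form_antisymmetric omega.
Hypothesis omega_nondeg : form_nondegenerate omega.
Hypothesis G_srg : symplectic_reflection_group omega rho.
Hypothesis eta_class : reflection_class_function rho eta.
Hypothesis A_simple : sra_simple omega rho eta.

Local Notation A := (sra omega rho eta).
Local Notation vec := (sra_vec omega rho eta).
Local Notation grp := (sra_grp omega rho eta).
Local Notation word := (word omega rho eta).
Implicit Types (T : {scalar A}).

Definition twisted_trace (eps : K) T :=
  [/\ conj_invariant T, forall v a, T (vec v * a) = eps * T (a * vec v) &
      forall a, T (sra_part a true) = 0].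

Lemma simple_proper_ideal0 (I : A -> Prop) :
    I 0 -> (forall u v, I u -> I v -> I (u + v)) ->
    (forall a u, I u -> I (a * u)) -> (forall a u, I u -> I (u * a)) ->
  ~ I 1 -> forall u, I u -> u = 0.
Proof. by case: A_simple => _ /[apply] /[apply] /[apply] /[apply] -[//|I1 []]. Qed.

Lemma scalar_comm (c : K) (a : A) : a * (c *: (1 : A)) = c *: a.
Proof. by rewrite -sra_scaleAr mulr1. Qed.

Lemma scalar_mull (c : K) (a : A) : (c *: (1 : A)) * a = c *: a.
Proof. by rewrite -sra_scaleAl mul1r. Qed.

(** * Nondegeneracy of twisted traces and the centre *)

Section OneSign.
Variable eps : K.
Hypothesis eps2 : eps * eps = 1.

Lemma twisted_trace_mul T p g b : twisted_trace eps T ->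
  T (word p * grp g * b) = eps ^+ size p * T (b * (word p * grp g)).
Proof.
case=> Ti Tt _; elim: p b => [|x p IH] b.
  by rewrite (word_nil omega rho eta) !mul1r Ti.
by rewrite (word_cons omega rho eta) -!mulrA Tt 2!mulrA -[_ * b * _]mulrA IH exprS -!mulrA.
Qed.

Lemma twisted_trace_homog T (x b : A) d : twisted_trace eps T ->
  T (sra_part x d * b) = eps ^+ d * T (b * sra_part x d).
Proof.
move=> TT; pose L : {scalar A} := mul_functional T 1 b \o parity_part d.
pose R : {scalar A} := mul_functional T (eps ^+ d *: b) 1 \o parity_part d.
suff : L x = R x.
  by rewrite /= /mul_functional /parity_part mul1r mulr1 -sra_scaleAl linearZ.
apply: (sra_ind (P := fun x => L x = R x)) => [c u v eu ev||p g].
- by rewrite !linearP eu ev.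
- by rewrite !linear0.
rewrite /= /mul_functional mul1r mulr1 -sra_scaleAl linearZ /= /parity_part.
rewrite sra_part_word; case: eqP => [<-|_]; last by rewrite mulr0 mul0r linear0 mulr0.
rewrite (twisted_trace_mul _ _ _ TT); congr (_ * _).
by rewrite -{1}(odd_double_half (size p)) exprD -mul2n exprM expr2 eps2 expr1n mulr1.
Qed.

Lemma twisted_trace_nondeg T : twisted_trace eps T -> (exists a, T a != 0) ->
  forall x, (forall b, T (x * b) = 0) -> x = 0.
Proof.
move=> TT [a0 Ta0]; apply: (@simple_proper_ideal0 (fun x => forall b, T (x * b) = 0)).
- by move=> b; rewrite mul0r linear0.
- by move=> u v Iu Iv b; rewrite mulrDl linearD /= Iu Iv addr0.
- move=> a u Iu b; rewrite -(sra_part_sum a) mulr_suml mulr_suml linear_sum big1 // => d _.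
  by rewrite /= -mulrA (twisted_trace_homog _ _ _ TT) -mulrA Iu mulr0.
- by move=> a u Iu b; rewrite -mulrA Iu.
by move=> /(_ a0); rewrite mul1r => /eqP; rewrite (negPf Ta0).
Qed.

Definition poly_eval (z : A) (p : {poly K}) : A := \sum_(i < size p) p`_i *: z ^+ i.

Lemma poly_evalE z (p : {poly K}) n : (size p <= n)%N ->
  poly_eval z p = \sum_(i < n) p`_i *: z ^+ i.
Proof.
move=> sz; rewrite /poly_eval -!(big_mkord xpredT (fun i => p`_i *: z ^+ i)).
have e : \sum_(size p <= i < n) p`_i *: z ^+ i = 0.
  rewrite big_nat_cond big1 // => i; rewrite andbT => /andP[le _].
  by rewrite nth_default // scale0r.
by rewrite [RHS](big_cat_nat _ sz) //= e addr0.
Qed.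

Lemma poly_eval_factor z c p :
  poly_eval z (('X - c%:P) * p) = (z - c *: (1 : A)) * poly_eval z p.
Proof.
rewrite (@poly_evalE z _ (size p).+1); last first.
  by rewrite (leq_trans (size_polyMleq _ _)) // size_XsubC.
rewrite [RHS]mulrBl scalar_mull {2}(@poly_evalE z p (size p).+1) //.
under eq_bigr => i _ do rewrite mulrBl coefB mul_polyC coefZ mulrC coefMX /= scalerBl.
rewrite sumrB scaler_sumr; congr (_ - _); last first.
  by apply: eq_bigr => i _; rewrite scalerA.
rewrite big_ord_recl /= scale0r add0r mulr_sumr; apply: eq_bigr => i _.
by rewrite -sra_scaleAr exprS.
Qed.

Lemma comm_poly_eval z p a : z * a = a * z -> poly_eval z p * a = a * poly_eval z p.
Proof.
move=> za; rewrite mulr_suml mulr_sumr; apply: eq_bigr => i _.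
rewrite -sra_scaleAl -sra_scaleAr; congr (_ *: _).
by elim: (nat_of_ord i) => [|k IH]; rewrite ?mul1r ?mulr1 // exprS -mulrA IH mulrA za mulrA.
Qed.

(** Split off a root: (z - c) q(z) = 0. Either q(z) = 0 with [q] of smaller degree, or the
    annihilator of the central element q(z) is a proper two-sided ideal, hence 0, and z = c. *)
Lemma central_algebraic z (p : {poly K}) : (forall a, z * a = a * z) -> p != 0 ->
  poly_eval z p = 0 -> exists c : K, z = c *: (1 : A).
Proof.
move=> zc; move: {2}(size p) (leqnn (size p)) => n; elim: n p => [|n IH] p.
  by rewrite leqn0 size_poly_eq0 => ->.
move=> szp p0 pz; have [sz1|sz1] := eqVneq (size p) 1%N.
  move: pz; rewrite (@poly_evalE z p 1) ?sz1 // big_ord1 expr0 => /eqP.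
  have /size_poly1P[c c0 ->] : size p == 1%N by rewrite sz1.
  rewrite coefC /= => /eqP/(congr1 (fun a => c^-1 *: a)).
  rewrite scalerA mulVf // scale1r scaler0 => one0.
  by case: A_simple => /eqP; rewrite one0.
have [c /factor_theorem[q pq]] := closedK sz1.
have q0 : q != 0 by apply: contra p0 => /eqP q0; rewrite pq q0 mul0r.
have szq : (size q <= n)%N.
  move: szp; rewrite pq size_Mmonic ?monicXsubC // size_XsubC addn2 /=.
  by rewrite ltnS.
have [qz|qz] := eqVneq (poly_eval z q) 0; first exact: IH qz.
exists c; apply/eqP; rewrite -subr_eq0; apply/eqP.
apply: (@simple_proper_ideal0 (fun x => x * poly_eval z q = 0)).
- by rewrite mul0r.
- by move=> u v eu ev; rewrite mulrDl eu ev addr0.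
- by move=> a u eu; rewrite -mulrA eu mulr0.
- by move=> a u eu; rewrite -mulrA -comm_poly_eval // mulrA eu mul0r.
- by rewrite mul1r; apply/eqP.
by rewrite -poly_eval_factor -pz pq mulrC.
Qed.

(* By trace_eq0 a functional a |-> T (w a) with w central vanishes as soon as it
   vanishes on the group, so a linear relation between the #|gT| + 1 rows
   T (z ^+ j * g) gives a polynomial annihilating z. *)
Lemma central_scalar T z : twisted_trace eps T -> (exists a, T a != 0) ->
  (forall a, z * a = a * z) -> exists c : K, z = c *: (1 : A).
Proof.
move=> TT Tn0 zc; have [Ti Tt _] := TT.
pose m := #|gT|.
pose M : 'M[K]_(m.+1, m) := \matrix_(j, i) T (z ^+ j * grp (enum_val i)).
have [c c0 cM] : exists2 c : 'rV[K]_m.+1, c != 0 & c *m M = 0.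
  have : kermx M != 0.
    rewrite -mxrank_eq0 mxrank_ker subn_eq0 -ltnNge ltnS.
    exact: rank_leq_col.
  by case/rowV0Pn => v /sub_kermxP vM v0; exists v.
pose p := \poly_(j < m.+1) c 0 (inord j).
have p0 : p != 0.
  apply: contra c0 => /eqP p0; apply/eqP/rowP => j; rewrite mxE.
  have := congr1 (fun q : {poly K} => q`_j) p0.
  by rewrite coef_poly ltn_ord inord_val coef0.
apply: (central_algebraic zc p0); apply: (twisted_trace_nondeg TT Tn0).
set w := poly_eval z p.
have wc a : w * a = a * w by apply: comm_poly_eval.
have [F FE] : exists F : {scalar A}, forall a, F a = T (w * a).
  by exists (mul_functional T w 1) => a; rewrite /= /mul_functional mulr1.
move=> b; rewrite -FE.
apply: (trace_eq0 charK omega_anti omega_nondeg G_srg eps2).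
- by move=> h a; rewrite !FE mulrA wc -mulrA Ti mulrA.
- by move=> v a; rewrite !FE mulrA wc -mulrA Tt mulrA.
move=> g; rewrite FE /w (@poly_evalE z p m.+1) ?size_poly // mulr_suml linear_sum.
have := congr1 (fun N : 'rV_m => N 0 (enum_rank g)) cM; rewrite !mxE => e.
rewrite -[RHS]e; apply: eq_bigr => j _.
by rewrite mxE enum_rankK /= -sra_scaleAl linearZ /= coef_poly ltn_ord inord_val.
Qed.

End OneSign.

(** * A twisted trace for each conjugacy class *)

Lemma twisted_trace_comb eps n (T : 'I_n -> {scalar A}) (c : 'I_n -> K) :
    (forall i, twisted_trace eps (T i)) ->
  exists T0 : {scalar A}, twisted_trace eps T0 /\
    (forall a, T0 a = \sum_i c i * T i a).
Proof.
move=> TT; have lin : linear_for *%R (fun a : A => \sum_i c i * T i a).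
  move=> k x y; rewrite mulr_sumr -big_split; apply: eq_bigr => i _ /=.
  by rewrite linearP /=; ring.
pose T0 : {scalar A} := HB.pack (fun a : A => \sum_i c i * T i a)
  (GRing.isLinear.Build K A K _ _ lin).
exists T0; split=> //; split=> [h a|v a|a] /=.
- by apply: eq_bigr => i _; have [-> _ _] := TT i.
- by rewrite mulr_sumr; apply: eq_bigr => i _; have [_ -> _] := TT i; rewrite mulrCA.
- by rewrite big1 // => i _; have [_ _ ->] := TT i; rewrite mulr0.
Qed.

(** As eps^2 = 1, eps g x = x means g x = eps x. Thus supertraces are counted by classes without
    eigenvalue -1, traces by those without eigenvalue 1. *)
Lemma twist_dim_eigen eps g : eps * eps = 1 ->
  ~~ passmx.leigenvalue (rho g) eps -> \dim (twist_fixed_space rho eps g) = 0%N.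
Proof.
move=> eps2; rewrite /passmx.leigenvalue negbK => /eqP e; apply/eqP.
rewrite dimv_eq0 -subv0; apply/subvP => x; rewrite twist_fixed_spaceE -e => /eqP.
rewrite twistE => gx; rewrite memv_ker add_lfunE opp_lfunE scale_lfunE id_lfunE.
by rewrite -{2}gx scalerA eps2 scale1r subrr.
Qed.

(** The free values of [T i] are taken to be the indicator function of the i-th class, so evaluation
    at a representative of class j isolates the coefficient [c j]. *)
Lemma independent_twisted_traces eps : eps * eps = 1 ->
  exists T : 'I_(num_classes_without_eigenvalue rho eps) -> {scalar A},
    (forall i, twisted_trace eps (T i)) /\
    (forall c, (forall a, \sum_i c i * T i a = 0) -> forall i, c i = 0).
Proof.
move=> eps2; pose cls (i : 'I_(num_classes_without_eigenvalue rho eps)) := enum_val i.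
have clsP i : cls i \in classes [set: gT] /\
    {in cls i, forall g, ~~ passmx.leigenvalue (rho g) eps}.
  have := enum_valP i; rewrite inE => /andP[ci /forallP ei]; split=> // g gi.
  by have := ei g; rewrite gi.
have cJ i g h : ((g ^ h)%g \in cls i) = (g \in cls i).
  have [/imsetP[x _ ->] _] := clsP i.
  by rewrite (class_transl _ (memJ_class g (in_setT h))).
have [T TP] := choice (fun i => twisted_trace_exists charK omega_anti omega_nondeg
  G_srg eta_class eps2 (c := fun g => (g \in cls i)%:R)
  (fun g h => congr1 (fun b : bool => b%:R) (cJ i g h))).
exists T; split=> [i|c c0 j]; first by have [Ti Tt Te _] := TP i.
have [cj ej] := clsP j; have gj := mem_repr_classes cj.
have := c0 (grp (repr (cls j))); rewrite (bigD1 j) //= big1 ?addr0 => [|i ij].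
  have [_ _ _ ->] := TP j; first by rewrite gj mulr1.
  exact/twist_dim_eigen/ej.
have [_ _ _ ->] := TP i; last exact/twist_dim_eigen/ej.
have [/imsetP[x _ xi] _] := clsP i; have /imsetP[y _ yj] := cj.
case gi: (repr (cls j) \in cls i); last by rewrite mulr0.
case/eqP: ij; apply: enum_val_inj; rewrite -/(cls i) -/(cls j).
set g := repr (cls j) in gi gj.
have /class_eqP ei : g \in (x ^: [set: gT])%g by rewrite -xi.
have /class_eqP ey : g \in (y ^: [set: gT])%g by rewrite -yj.
by rewrite xi yj -ei -ey.
Qed.

Lemma biscalar_of (L : lmodType K) (f : L -> L -> K) :
    (forall a x y z, f (a *: x + y) z = a * f x z + f y z) ->
    (forall a x y z, f z (a *: x + y) = a * f z x + f z y) ->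
  exists B : {biscalar L}, forall x y, B x y = f x y.
Proof.
move=> fl fr; have fb : bilinear_for *%R *%R f by split=> [z a x y|z a x y]; [exact: fl | exact: fr].
pose B : {biscalar L} := HB.pack f (bilinear_isBilinear.Build K L L K *%R *%R f fb).
by exists B.
Qed.

(** * Forms on the Lie algebra modulo scalars *)

Section LieForms.
Local Notation scalars := (@sra_dlie_scalars K V omega gT rho eta).
Implicit Types (x y : sra_dlie omega rho eta) (u v w : sra_qlie omega rho eta).

Lemma trace_mulC T a b : twisted_trace 1 T -> T (a * b) = T (b * a).
Proof.
move=> TT; rewrite -[a in LHS](sra_part_sum a) -[a in RHS](sra_part_sum a).
rewrite mulr_suml mulr_sumr !linear_sum; apply: eq_bigr => d _ /=.
by rewrite (twisted_trace_homog (mulr1 1) _ _ _ TT) expr1n mul1r.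
Qed.

Lemma trace_derived T x : twisted_trace 1 T -> T (derived_val x) = 0.
Proof.
move=> TT; case: x => x /= /asboolP[s ->]; rewrite linear_sum big1 // => p _ /=.
by rewrite linearZ /sra_lie linearB /= (trace_mulC _ _ TT) subrr mulr0.
Qed.

(** The representative respects sums and brackets only up to scalars. In T (x y) this error is
    invisible, since traces vanish on the derived algebra. *)
Definition qlie_val u : A := derived_val (quotmod_repr u).

Lemma qlie_val_pi x : exists c : K,
  qlie_val (quotmod_pi scalars x) = derived_val x + c *: (1 : A).
Proof.
have /asboolP[a aE] : quotmod_repr (quotmod_pi scalars x) - x \in scalars.
  by apply/quotmod_piP; rewrite quotmod_reprK.
by exists a; rewrite -aE addrC subrK.
Qed.

Lemma qlie_val_lin a u v : exists c : K,
  qlie_val (a *: u + v) = a *: qlie_val u + qlie_val v + c *: (1 : A).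
Proof.
have -> : a *: u + v = quotmod_pi scalars (a *: quotmod_repr u + quotmod_repr v).
  rewrite quotmod_piD -quotmod_scale_pi !quotmod_reprK //.
have [c ->] := qlie_val_pi (a *: quotmod_repr u + quotmod_repr v).
by exists c.
Qed.

Lemma qlie_val_br u v : exists c : K,
  qlie_val (sra_qlie_br u v) = sra_lie (qlie_val u) (qlie_val v) + c *: (1 : A).
Proof. exact: qlie_val_pi. Qed.

Lemma trace_qlie T u : twisted_trace 1 T -> T (qlie_val u) = 0.
Proof. exact: trace_derived. Qed.

Lemma trace_scalar_r T (a : A) c u : twisted_trace 1 T ->
  T (qlie_val u * (a + c *: (1 : A))) = T (qlie_val u * a).
Proof.
by move=> TT; rewrite mulrDr linearD scalar_comm linearZ /= trace_qlie // mulr0 addr0.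
Qed.

Lemma trace_scalar_l T (a : A) c u : twisted_trace 1 T ->
  T ((a + c *: (1 : A)) * qlie_val u) = T (a * qlie_val u).
Proof. by move=> TT; rewrite trace_mulC // trace_scalar_r // trace_mulC. Qed.

Lemma lie_form T : twisted_trace 1 T ->
  exists B : {biscalar sra_qlie omega rho eta},
    forall u v, B u v = T (qlie_val u * qlie_val v).
Proof.
move=> TT.
have l a u v w : T (qlie_val (a *: u + v) * qlie_val w) =
    a * T (qlie_val u * qlie_val w) + T (qlie_val v * qlie_val w).
  have [c ->] := qlie_val_lin a u v.
  by rewrite trace_scalar_l // mulrDl -sra_scaleAl linearP.
apply: biscalar_of => // a u v w.
by rewrite !(trace_mulC (qlie_val w) _ TT) l.
Qed.

Lemma lie_form_invariant T u v w : twisted_trace 1 T ->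
  T (qlie_val (sra_qlie_br u v) * qlie_val w) =
  T (qlie_val u * qlie_val (sra_qlie_br v w)).
Proof.
move=> TT; have [c ->] := qlie_val_br u v; have [d ->] := qlie_val_br v w.
rewrite trace_scalar_l // trace_scalar_r // /sra_lie mulrBl mulrBr !linearB /=.
by rewrite -!mulrA (trace_mulC (qlie_val v) _ TT) !mulrA.
Qed.

(** If x is orthogonal to all brackets, then T ([x, a] b) = T (x [a, b]) = 0 for all b, so [x, a] =
    0. Hence x is central, a scalar, and zero in the quotient. *)
Lemma lie_form_nondegenerate T v : twisted_trace 1 T -> (exists a, T a != 0) ->
  (forall u, T (qlie_val v * qlie_val u) = 0) -> v = 0.
Proof.
move=> TT Tn0 Tv; set x := qlie_val v in Tv.
have xc a : x * a = a * x.
  apply/eqP; rewrite -subr_eq0; apply/eqP.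
  apply: (twisted_trace_nondeg (mulr1 1) TT Tn0) => b.
  pose y : sra_dlie omega rho eta :=
    Derived (in_derived_br (@sra_lie _ _ omega _ rho eta) a b).
  have [c yE] := qlie_val_pi y; have := Tv (quotmod_pi scalars y).
  rewrite yE trace_scalar_r // => <-; rewrite /= /sra_lie mulrBl mulrBr !linearB /=.
  congr (_ - _); first by rewrite mulrA.
  by rewrite -mulrA (trace_mulC a _ TT) -mulrA.
have [c xE] := central_scalar (mulr1 1) TT Tn0 xc.
have pi0 : quotmod_pi scalars 0 = 0.
  by apply: (@addrI _ (quotmod_pi scalars 0)); rewrite -quotmod_piD !addr0.
rewrite -[v]quotmod_reprK -pi0; apply/quotmod_piP; rewrite subr0.
by apply/asboolP; exists c.
Qed.

End LieForms.

(** Keeps the quotient Lie algebra from being zero. If all brackets were scalars, [x, xy] = x [x, y]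
    would force x to be a scalar or [x, y] = 0; either way [x, y] = 0, which a functional
    refutes. *)
Lemma sra_lie_not_scalar (v : V) : v != 0 ->
  exists a b : A, forall c : K, sra_lie a b <> c *: (1 : A).
Proof.
move=> v0; have [w vw] : exists w, omega v w != 0.
  apply/not_existsP => H; case/eqP: v0; apply: omega_nondeg => w.
  by apply/eqP/negPn/negP/H.
pose x := vec v; pose y := vec w.
have xy0 : sra_lie x y <> 0.
  have s1m : multilinear (on_size 0 (fun=> 1 : K) : seq V -> K).
    by move=> a u z [|? ?] q; rewrite /on_size /= mulr0 addr0.
  have s1s : symmetric_words (on_size 0 (fun=> 1 : K) : seq V -> K).
    by move=> [|? ?] u z q; rewrite /on_size.
  (* This functional is 1 at the unit and 0 at the other group elements, so it sends [v, w] to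
     [omega v w]. *)
  have [F FE] := symbol_functional charK omega_anti G_srg eta_class 0 1%g s1m s1s.
  move=> /(congr1 F); rewrite /sra_lie /x /y (vec_comm eta G_srg) linear_sum linear0.
  rewrite (bigD1 1%g) //= big1 ?addr0 => [|h h1]; last first.
    have := FE [::] h isT; rewrite (word_nil omega rho eta) mul1r (negPf h1) andbF.
    by rewrite linearZ /= => ->; rewrite mulr0.
  have := FE [::] 1%g isT; rewrite (word_nil omega rho eta) mul1r eqxx /on_size /=.
  by rewrite linearZ /= => ->; rewrite mulr1 /kappa eqxx; apply/eqP.
apply: contrapT => H.
have sc a b : exists c : K, sra_lie a b = c *: (1 : A).
  by apply: contrapT => nc; apply: H; exists a, b => c e; apply: nc; exists c.
have [c cE] := sc x y; have [d dE] := sc x (x * y).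
have xcE : c *: x = d *: (1 : A).
  by rewrite -dE /sra_lie -mulrA -mulrBr -/(sra_lie x y) cE scalar_comm.
have [c0|c0] := eqVneq c 0; first by apply: xy0; rewrite cE c0 scale0r.
have xE : x = (c^-1 * d) *: (1 : A) by rewrite -scalerA -xcE scalerA mulVf // scale1r.
by apply: xy0; rewrite /sra_lie xE scalar_comm scalar_mull subrr.
Qed.

Lemma lie_forms_exist : (exists v : V, v != 0) ->
  exists B : 'I_(num_classes_without_eigenvalue rho 1) ->
             {biscalar sra_qlie omega rho eta},
    (forall i, [/\ form_symmetric (B i),
                   form_invariant (@sra_qlie_br _ _ omega _ rho eta) (B i)
                 & form_nondegenerate (B i)])
    /\ forms_independent (fun i => B i).
Proof.
move=> [v0 v0n0]; have [T [TT Tind]] := independent_twisted_traces (mulr1 1).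
have Tn0 i : exists a, T i a != 0.
  apply: contrapT => H; have /eqP := oner_neq0 K; apply.
  have := Tind (fun j => (j == i)%:R) _ i; rewrite eqxx; apply=> a.
  rewrite (bigD1 i) //= big1 ?eqxx ?mul1r ?addr0 => [|j /negPf->]; last by rewrite mul0r.
  by apply/eqP/negPn/negP => Ta; apply: H; exists a.
have [B BE] := choice (fun i => lie_form (TT i)).
exists B; split=> [i|c cB].
  split=> [u v|u v w|u Bu]; rewrite ?BE.
  - exact: trace_mulC.
  - exact: lie_form_invariant.
  - by apply: (lie_form_nondegenerate (TT i) (Tn0 i)) => v; rewrite -BE.
have [T0 [TT0 T0E]] := twisted_trace_comb c TT.
(* The combination of the forms is the form of [T0]. Were [T0] nonzero, that form would be both zero
   and nondegenerate, and the quotient would vanish. *)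
apply: Tind => a; rewrite -T0E; apply: contrapT => Ta.
have T0n0 : exists a, T0 a != 0 by exists a; apply/eqP.
have q0 u : u = 0 :> sra_qlie omega rho eta.
  apply: (lie_form_nondegenerate TT0 T0n0) => w; rewrite T0E -[RHS](cB u w).
  by apply: eq_bigr => i _; rewrite BE.
have [x [y xy]] := sra_lie_not_scalar v0n0.
pose z : sra_dlie omega rho eta :=
  Derived (in_derived_br (@sra_lie _ _ omega _ rho eta) x y).
have : quotmod_pi (@sra_dlie_scalars K V omega gT rho eta) z =
       quotmod_pi (@sra_dlie_scalars K V omega gT rho eta) 0.
  by rewrite [LHS](q0 _) [RHS](q0 _).
by move/quotmod_piP; rewrite subr0 => /asboolP[d] /=; apply: xy.
Qed.

(** * Forms on the derived Lie superalgebra *)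

Section SuperForms.

Lemma sra_part_part (a : A) b c :
  sra_part (sra_part a b) c = if b == c then sra_part a b else 0.
Proof.
rewrite -!/(parity_part _ _).
apply: (sra_ind (P := fun a => parity_part c (parity_part b a) =
  if b == c then parity_part b a else 0)) => [k x y ex ey||p g].
- by rewrite !linearP /= ex ey; case: ifP => _; rewrite ?scaler0 ?addr0.
- by rewrite !linear0 if_same.
rewrite /parity_part !sra_part_word.
have part0 : sra_part (0 : A) c = 0 by exact: (linear0 (parity_part c)).
by case: eqP => [<-|_]; rewrite ?sra_part_word ?part0 ?if_same.
Qed.

Lemma sra_part_homog_mul (x y : A) b c d :
  sra_part (sra_part x b * sra_part y c) d =
  if b (+) c == d then sra_part x b * sra_part y c else 0.
Proof.
rewrite sra_part_mul big_bool /= !sra_part_part.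
by case: b c d => [] [] [] /=; rewrite ?mul0r ?mulr0 ?addr0 ?add0r.
Qed.

Lemma super_odd T (x y z : A) b c d : twisted_trace (-1) T -> b (+) c (+) d ->
  T (sra_part x b * sra_part y c * sra_part z d) = 0.
Proof.
case=> _ _ Te bcd.
have xy : sra_part x b * sra_part y c = sra_part (sra_part x b * sra_part y c) (b (+) c).
  by rewrite sra_part_homog_mul eqxx.
have <- : sra_part (sra_part x b * sra_part y c * sra_part z d) true =
    sra_part x b * sra_part y c * sra_part z d by rewrite xy sra_part_homog_mul bcd.
exact: Te.
Qed.

(** For parts of parities b, c, d only y x z and x z y have to be compared, and T (y x z) = (-1)^c T
    (x z y). The signs agree when b + c + d is even; otherwise both values are 0 by [super_odd]. *)
Lemma superlie_invariant T (x y z : A) : twisted_trace (-1) T ->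
  T (sra_superlie x y * z) = T (x * sra_superlie y z).
Proof.
move=> TT; have e2 : -1 * -1 = 1 :> K by rewrite mulrNN mulr1.
rewrite -{1}(sra_part_sum z) -{2}(sra_part_sum x) /sra_superlie.
rewrite !mulr_suml linear_sum linear_sum; apply: eq_bigr => b _ /=.
rewrite mulr_suml mulr_sumr !linear_sum; apply: eq_bigr => c _ /=.
rewrite mulr_sumr mulr_sumr !linear_sum; apply: eq_bigr => d _ /=.
rewrite mulrBl mulrBr !linearB /= !mulrA; congr (_ - _).
have e := twisted_trace_homog e2 y (sra_part x b * sra_part z d) c TT.
have o := @super_odd T x z y b d c TT.
case: b c d e o => [] [] [] /=;
  rewrite ?expr0 ?expr1 ?mulN1r ?mul1r ?mulNr ?mulrN ?mulN1r ?mul1r !mulrA => e o;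
  rewrite ?mulNr ?mulr1 ?linearN /= e;
  by [rewrite (o isT) ?oppr0 | rewrite ?opprK].
Qed.

Lemma superlie1 (x : A) : sra_superlie x 1 = 0.
Proof.
rewrite /sra_superlie -(sra_grp1 omega rho eta) big1 // => b _.
rewrite big_bool /= !sra_part_grp !(mulr0, mul0r) subrr add0r andbF expr0 mul1r.
by rewrite sra_grp1 mul1r mulr1 subrr.
Qed.

Lemma superlie_trace0 T (x y : A) : twisted_trace (-1) T -> T (sra_superlie x y) = 0.
Proof.
by move=> TT; rewrite -[sra_superlie x y]mulr1 superlie_invariant // superlie1 mulr0 linear0.
Qed.

(** Separating parities in the bracket with homogeneous a shows that both parts of x supercommute
    with everything. The odd part then has square 0 and lies in its own annihilator, a two-sided
    ideal that is proper unless this part is 0. So x is even and central. *)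
Lemma superlie_center T (x : A) : twisted_trace (-1) T -> (exists a, T a != 0) ->
  (forall a, sra_superlie x a = 0) -> exists c : K, x = c *: (1 : A).
Proof.
move=> TT Tn0 xs; have e2 : -1 * -1 = 1 :> K by rewrite mulrNN mulr1.
have sign_mul (k : bool) (u : A) : (-1) ^+ k * u = (-1) ^+ k *: u.
  by case: k; rewrite ?expr0 ?expr1 ?mulN1r ?mul1r ?scaleN1r ?scale1r.
have xh b c a : sra_part x b * sra_part a c =
    (-1) ^+ (b && c) *: (sra_part a c * sra_part x b).
  pose t b' := sra_part x b' * sra_part a c - (-1) ^+ (b' && c) *: (sra_part a c * sra_part x b').
  have tp b' d : parity_part d (t b') = if b' (+) c == d then t b' else 0.
    rewrite /t linearB linearZ /= /parity_part !sra_part_homog_mul [c (+) b']addbC.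
    by case: ifP => // _; rewrite scaler0 subrr.
  have : sra_superlie x (sra_part a c) = \sum_b' t b'.
    apply: eq_bigr => b' _; rewrite big_bool /= !sra_part_part !sign_mul /t.
    by case: c {t tp}; rewrite /= mulr0 mul0r scaler0 subr0 ?addr0 ?add0r.
  rewrite xs => /(congr1 (parity_part (b (+) c))).
  rewrite linear0 linear_sum big_bool /= !tp.
  move=> e; apply/eqP; rewrite -subr_eq0 -/(t b); apply/eqP; rewrite e.
  by case: b c @t {tp e} => [] [] t /=; rewrite ?addr0 ?add0r.
pose x1 := sra_part x true.
have x1a c a : sra_part a c * x1 = (-1) ^+ c *: (x1 * sra_part a c).
  by rewrite /x1 xh /= scalerA; case: c; rewrite ?expr1 ?expr0 ?mulrNN mulr1 scale1r.
have x1x1 : x1 * x1 = 0.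
  have := x1a true x; rewrite -/x1 expr1 scaleN1r => /eqP.
  rewrite -addr_eq0 -mulr2n -scaler_nat => /eqP/(congr1 (fun u => 2%:R^-1 *: u)).
  by rewrite scalerA mulVf ?charK // scale1r scaler0.
have x10 : x1 = 0.
  have [//|x1n0] := eqVneq x1 0.
  apply: (@simple_proper_ideal0 (fun u => u * x1 = 0)) => //.
  - by rewrite mul0r.
  - by move=> u v eu ev; rewrite mulrDl eu ev addr0.
  - by move=> a u eu; rewrite -mulrA eu mulr0.
  - move=> a u ua /=; rewrite -(sra_part_sum a) mulr_sumr mulr_suml big1 // => c _.
    rewrite /= -mulrA x1a -sra_scaleAr mulrA ua mul0r scaler0 //.
  - by rewrite mul1r; apply/eqP.
have xE : x = sra_part x false.
  by rewrite -[LHS]sra_part_sum big_bool /= -/x1 x10 add0r.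
apply: (central_scalar e2 TT Tn0) => a; rewrite xE -[in LHS](sra_part_sum a).
rewrite -[in RHS](sra_part_sum a) mulr_sumr mulr_suml; apply: eq_bigr => c _.
by rewrite xh expr0 scale1r.
Qed.

Lemma derived_val_linear (br : A -> A -> A) c (x y : derived br) :
  derived_val (c *: x + y) = c *: derived_val x + derived_val y.
Proof. by []. Qed.

Lemma dsuper_trace0 T (x : sra_dsuper omega rho eta) : twisted_trace (-1) T ->
  T (derived_val x) = 0.
Proof.
move=> TT; case: x => x /= /asboolP[s ->]; rewrite linear_sum big1 // => p _ /=.
by rewrite linearZ /= superlie_trace0 // mulr0.
Qed.

(** The radical consists of scalars in the derived algebra. The unit of the group has no eigenvalue
    -1, so there is a supertrace [T1] with value 1 at the unit; it vanishes on brackets and kills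
    these scalars. *)
Lemma super_form_nondegenerate T (x : sra_dsuper omega rho eta) :
    twisted_trace (-1) T -> (exists a, T a != 0) ->
    (forall y : sra_dsuper omega rho eta, T (derived_val x * derived_val y) = 0) ->
  x = 0.
Proof.
move=> TT Tn0 Tx; have e2 : -1 * -1 = 1 :> K by rewrite mulrNN mulr1.
have [c xE] : exists c : K, derived_val x = c *: (1 : A).
  apply: (superlie_center TT Tn0) => a; apply: (twisted_trace_nondeg e2 TT Tn0) => b.
  rewrite superlie_invariant //.
  exact: (Tx (Derived (in_derived_br (@sra_superlie _ _ omega _ rho eta) a b))).
have [T1 [T1i T1t T1e T11]] := twisted_trace_exists charK omega_anti omega_nondeg
  G_srg eta_class e2 (c := fun=> 1) (fun _ _ => erefl).
have g1 : \dim (twist_fixed_space rho (-1) 1%g) = 0%N.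
  apply: twist_dim_eigen => //; rewrite /passmx.leigenvalue negbK -subv0.
  apply/subvP => v; rewrite memv_ker add_lfunE opp_lfunE scale_lfunE id_lfunE memv0.
  rewrite (srg_oneE G_srg) scaleN1r opprK -mulr2n -scaler_nat scaler_eq0.
  by rewrite (negPf (charK 1)).
have := @dsuper_trace0 T1 x (And3 T1i T1t T1e).
rewrite xE linearZ /= -(sra_grp1 omega rho eta) T11 // mulr1 => c0.
by apply: val_inj; rewrite /= xE c0 scale0r.
Qed.

Lemma sra_superlie_nonzero (v : V) : v != 0 ->
  exists a b : A, sra_superlie a b <> 0.
Proof.
move=> v0; have [w vw] : exists w, omega v w != 0.
  apply/not_existsP => H; case/eqP: v0; apply: omega_nondeg => w.
  by apply/eqP/negPn/negP/H.
exists (vec v), (vec v).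
rewrite /sra_superlie !big_bool /= !sra_part_vec !(mulr0, mul0r, subrr, addr0).
rewrite expr1 mulN1r opprK -mulr2n -scaler_nat => /(congr1 (fun u => 2%:R^-1 *: u)).
rewrite scalerA mulVf ?charK // scale1r scaler0.
(* The bracket of v with itself is 2 v^2, and on v^2 this symbol takes the value (omega v w)^2,
   which is nonzero. *)
pose s (p : seq V) := \prod_(x <- p) omega x w.
have sm : multilinear s.
  move=> a x y p q; rewrite /s !big_cat !big_cons /= linearPl /=; ring.
have ss : symmetric_words s.
  by move=> p x y q; rewrite /s !big_cat !big_cons /=; ring.
have [F FE] := symbol_functional charK omega_anti G_srg eta_class 2 1%g sm ss.
have := FE [:: v; v] 1%g isT.
rewrite sra_grp1 mulr1 !(word_cons omega rho eta) (word_nil omega rho eta) mulr1 => FE2.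
move/(congr1 F); rewrite linear0 FE2 eqxx /= /s !big_cons big_nil mulr1.
by apply/eqP; rewrite mulf_neq0.
Qed.

Lemma super_forms_exist : (exists v : V, v != 0) ->
  exists B : 'I_(num_classes_without_eigenvalue rho (-1)) ->
             {biscalar sra_dsuper omega rho eta},
    (forall i, [/\ form_supersymmetric
                     (@sra_dsuper_homog _ _ omega _ rho eta) (B i),
                   form_invariant (@sra_dsuper_br _ _ omega _ rho eta) (B i)
                 & form_nondegenerate (B i)])
    /\ forms_independent (fun i => B i).
Proof.
move=> [v0 v0n0]; have e2 : -1 * -1 = 1 :> K by rewrite mulrNN mulr1.
have [T [TT Tind]] := independent_twisted_traces e2.
have Tn0 i : exists a, T i a != 0.
  apply: contrapT => H; have /eqP := oner_neq0 K; apply.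
  have := Tind (fun j => (j == i)%:R) _ i; rewrite eqxx; apply=> a.
  rewrite (bigD1 i) //= big1 ?eqxx ?mul1r ?addr0 => [|j /negPf->]; last by rewrite mul0r.
  by apply/eqP/negPn/negP => Ta; apply: H; exists a.
have form i : exists B : {biscalar sra_dsuper omega rho eta},
    forall x y, B x y = T i (derived_val x * derived_val y).
  apply: biscalar_of => a x y z; rewrite derived_val_linear.
    by rewrite mulrDl -sra_scaleAl linearP.
  by rewrite mulrDr -sra_scaleAr linearP.
have [B BE] := choice form.
exists B; split=> [i|c cB].
  split=> [b c x y xb yc|x y z|x Bx]; rewrite ?BE.
  (* Moving [x] gives the sign (-1)^b, correct for odd [y]; for even [y] it is [y] that is moved, at
     no cost. *)
  - have [exc|exb] := boolP c; last first.
      have := twisted_trace_homog e2 (derived_val y) (derived_val x) false (TT i).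
      move: yc; rewrite (negPf exb) /sra_dsuper_homog /sra_homog => -> ->.
      by rewrite andbF !expr0 !mul1r.
    have := twisted_trace_homog e2 (derived_val x) (derived_val y) b (TT i).
    by move: xb; rewrite /sra_dsuper_homog /sra_homog andbT => -> ->.
  - exact: superlie_invariant.
  - by apply: (super_form_nondegenerate (TT i) (Tn0 i)) => y; rewrite -BE.
have [T0 [TT0 T0E]] := twisted_trace_comb c TT.
apply: Tind => a; rewrite -T0E; apply: contrapT => Ta.
have T0n0 : exists a, T0 a != 0 by exists a; apply/eqP.
have [x [y xy]] := sra_superlie_nonzero v0n0; apply: xy.
pose z : sra_dsuper omega rho eta :=
  Derived (in_derived_br (@sra_superlie _ _ omega _ rho eta) x y).
rewrite -[LHS]/(derived_val z) (_ : z = 0) //.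
apply: (super_form_nondegenerate TT0 T0n0) => w; rewrite T0E -[RHS](cB z w).
by apply: eq_bigr => i _; rewrite BE.
Qed.

End SuperForms.

End TwistedTraces.

(* omega is unbundled because in the final theorem the two canonical lmodType
   structures of 'cV, on which bilinearity is stated, are only convertible. *)
Theorem invariant_forms_exist (K : fieldType) (V : vectType K)
    (gT : finGroupType) (rho : gT -> 'End(V)) (eta : gT -> K)
    (omega : V -> V -> K) (omegaB : {biscalar V}) :
    (forall n, n.+1%:R != 0 :> K) ->
    (forall p : {poly K}, size p != 1 -> exists x, root p x) ->
    omega = omegaB -> (exists v : V, v != 0) ->
    form_antisymmetric omega -> form_nondegenerate omega ->
    symplectic_reflection_group omega rho ->
    reflection_class_function rho eta ->
    sra_simple omega rho eta ->
  (exists B : 'I_(num_classes_without_eigenvalue rho (-1)) ->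
              {biscalar sra_dsuper omega rho eta},
     (forall i, [/\ form_supersymmetric
                      (@sra_dsuper_homog _ _ omega _ rho eta) (B i),
                    form_invariant (@sra_dsuper_br _ _ omega _ rho eta) (B i)
                  & form_nondegenerate (B i)])
     /\ forms_independent (fun i => B i))
  /\
  (exists B : 'I_(num_classes_without_eigenvalue rho 1) ->
              {biscalar sra_qlie omega rho eta},
     (forall i, [/\ form_symmetric (B i),
                    form_invariant (@sra_qlie_br _ _ omega _ rho eta) (B i)
                  & form_nondegenerate (B i)])
     /\ forms_independent (fun i => B i)).
Proof.
move=> charK closedK -> V0 anti nondeg srg cl simple.
split; first exact: (super_forms_exist charK closedK anti nondeg srg cl simple V0).
exact: (lie_forms_exist charK closedK anti nondeg srg cl simple V0).
Qed.
Theorem mainTheorem4 (R : realType) (N : nat) (N_gt0 : (0 < N)%N)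
    (omega : {biscalar 'cV[R[i]]_(2 * N)})
    (omega_antisymmetric : form_antisymmetric omega)
    (omega_nondegenerate : form_nondegenerate omega)
    (gT : finGroupType) (rho : gT -> 'End('cV[R[i]]_(2 * N)))
    (G_srg : symplectic_reflection_group omega rho)
    (eta : gT -> R[i])
    (eta_class : reflection_class_function rho eta)
    (A_simple : sra_simple omega rho eta) :
  (exists B : 'I_(num_classes_without_eigenvalue rho (-1)) ->
              {biscalar sra_dsuper omega rho eta},
     (forall i, [/\ form_supersymmetric
                      (@sra_dsuper_homog _ _ omega _ rho eta) (B i),
                    form_invariant (@sra_dsuper_br _ _ omega _ rho eta) (B i)
                  & form_nondegenerate (B i)])
     /\ forms_independent (fun i => B i))
  /\
  (exists B : 'I_(num_classes_without_eigenvalue rho 1) ->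
              {biscalar sra_qlie omega rho eta},
     (forall i, [/\ form_symmetric (B i),
                    form_invariant (@sra_qlie_br _ _ omega _ rho eta) (B i)
                  & form_nondegenerate (B i)])
     /\ forms_independent (fun i => B i)).
Proof.
have charK n : n.+1%:R != 0 :> R[i] by rewrite Num.Theory.pnatr_eq0.
have closedK (p : {poly R[i]}) : size p != 1%N -> exists x, root p x.
  by move/closed_rootP.
have V0 : exists v : 'cV[R[i]]_(2 * N), v != 0.
  exists (const_mx 1); have N2 : (0 < 2 * N)%N by rewrite muln_gt0.
  apply/eqP => /colP/(_ (Ordinal N2)); rewrite !mxE.
  exact/eqP/oner_neq0.
pose omegaB : {biscalar ('cV[R[i]]_(2 * N) : vectType R[i])} := omega.
have omegaE : (omega : 'cV[R[i]]_(2 * N) -> 'cV[R[i]]_(2 * N) -> R[i]) = omegaB by [].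
exact: (invariant_forms_exist charK closedK omegaE V0
  omega_antisymmetric omega_nondegenerate G_srg eta_class A_simple).
Qed.
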